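(* Let $1<p<\infty$, $d\ge1$, and let $M$ be a nonempty compact subset of $\mathbb{R}^d$. Then there exists a trivial isomorphic extension $\theta_M$ of $K(l^p)$ by $C(M)$ such that $[\theta_M]=[\theta_M]+[\theta_M]$ and such that for every isomorphic extension $\phi$ of $K(l^p)$ by $C(M)$ there exists an isomorphic extension $\phi^{(-1)}$ of $K(l^p)$ by $C(M)$ with $[\theta_M]=[\phi]+[\phi^{(-1)}]$. Moreover, $\theta_M$ is unique up to equivalence (any two isomorphic extensions with these properties are equivalent).
   Context: $C(M)$ is the Banach algebra of continuous complex functions on $M$ with sup norm. $\pi:B(l^p)\to B(l^p)/K(l^p)$ is the quotient map. A homomorphism $\phi:\mathcal{A}_1\to\mathcal{A}_2$ of Banach algebras is an isomorphism (into) if there is $C\ge1$ with $C^{-1}\|a\|\le\|\phi(a)\|\le C\|a\|$ for all $a$. For a separable unital Banach algebra $\mathcal{A}$, an isomorphic extension of $K(l^p)$ by $\mathcal{A}$ is a unital isomorphism (into) $\phi:\mathcal{A}\to B(l^p)/K(l^p)$; it is trivial if $\phi=\pi\circ\rho$ for some unital isomorphism (into) $\rho:\mathcal{A}\to B(l^p)$. Two isomorphic extensions $\phi_1,\phi_2$ are equivalent if there is an invertible $S\in B(l^p)$ with $\phi_2(a)=\pi(S)\phi_1(a)\pi(S)^{-1}$ for all $a$; $[\phi]$ denotes the equivalence class. The sum is $[\phi_1]+[\phi_2]=[\phi]$ where $\phi(a)=\pi(S_0(T_1\oplus T_2)S_0^{-1})$, with $T_i\in B(l^p)$ any operators satisfying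 $\pi(T_i)=\phi_i(a)$ and $S_0:l^p\oplus l^p\to l^p$ any invertible operator; this makes the set of classes a commutative semigroup. *)

(* Defs.v *)
From Stdlib Require Import Reals Lra List.
Open Scope R_scope.

Definition CC := (R * R)%type.
Definition C0 : CC := (0, 0).
Definition C1 : CC := (1, 0).
Definition Cadd (a b : CC) : CC := (fst a + fst b, snd a + snd b).
Definition Copp (a : CC) : CC := (- fst a, - snd a).
Definition Cmul (a b : CC) : CC :=
  (fst a * fst b - snd a * snd b, fst a * snd b + snd a * fst b).
Definition Cnorm (a : CC) : R := sqrt (fst a * fst a + snd a * snd a).

(* power x^p for x >= 0 (with 0^p = 0, p > 0) *)
Definition rpow (x p : R) : R := if Rlt_dec 0 x then Rpower x p else 0.

Definition vec := nat -> CC.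
Definition vadd (x y : vec) : vec := fun n => Cadd (x n) (y n).
Definition vsub (x y : vec) : vec := fun n => Cadd (x n) (Copp (y n)).
Definition vscale (c : CC) (x : vec) : vec := fun n => Cmul c (x n).
Definition veq (x y : vec) : Prop := forall n, x n = y n.

Definition lp_norm_le (p : R) (x : vec) (r : R) : Prop :=
  0 <= r /\ forall N, sum_f_R0 (fun n => rpow (Cnorm (x n)) p) N <= rpow r p.
Definition lp (p : R) (x : vec) : Prop := exists r, lp_norm_le p x r.

Definition op := vec -> vec.
Definition op_id : op := fun x => x.
Definition op_comp (T S : op) : op := fun x => T (S x).
Definition op_sub (T S : op) : op := fun x => vsub (T x) (S x).
Definition op_add (T S : op) : op := fun x => vadd (T x) (S x).
Definition op_scale (c : CC) (T : op) : op := fun x => vscale c (T x).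
Definition op_eq (p : R) (T S : op) : Prop := forall x, lp p x -> veq (T x) (S x).

Definition op_bound (p : R) (T : op) (r : R) : Prop :=
  forall x s, lp_norm_le p x s -> lp_norm_le p (T x) (r * s).

Definition bdd (p : R) (T : op) : Prop :=
  (forall x y, lp p x -> lp p y -> veq (T (vadd x y)) (vadd (T x) (T y))) /\
  (forall c x, lp p x -> veq (T (vscale c x)) (vscale c (T x))) /\
  exists r, op_bound p T r.

Definition compact_op (p : R) (T : op) : Prop :=
  bdd p T /\
  forall eps, 0 < eps -> exists ys : list vec,
    forall x, lp_norm_le p x 1 ->
      exists y, In y ys /\ lp_norm_le p (vsub (T x) y) eps.

Definition calk_eq (p : R) (T S : op) : Prop := compact_op p (op_sub T S).

Definition calk_norm_le (p : R) (T : op) (r : R) : Prop :=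
  forall eps, 0 < eps -> exists K, compact_op p K /\ op_bound p (op_add T K) (r + eps).

Definition invertible_op (p : R) (S S' : op) : Prop :=
  bdd p S /\ bdd p S' /\ op_eq p (op_comp S S') op_id /\ op_eq p (op_comp S' S) op_id.

(* points of R^d are sequences; only the first d coordinates are used and the
   points of M are required to vanish beyond d (canonical embedding). *)
Definition pt := nat -> R.
Definition dist (d : nat) (x y : pt) : R :=
  sqrt (sum_f_R0 (fun i => (x i - y i) * (x i - y i)) (d - 1)).
Definition in_Rd (d : nat) (M : pt -> Prop) : Prop :=
  forall x, M x -> forall i, (d <= i)%nat -> x i = 0.
Definition open_set (d : nat) (U : pt -> Prop) : Prop :=
  forall x, U x -> exists r, 0 < r /\ forall y, dist d x y < r -> U y.
Definition compact_set (d : nat) (M : pt -> Prop) : Prop :=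
  forall (I : Type) (U : I -> pt -> Prop),
    (forall i, open_set d (U i)) ->
    (forall x, M x -> exists i, U i x) ->
    exists l : list I, forall x, M x -> exists i, In i l /\ U i x.

Definition fn := pt -> CC.
Definition cont_on (d : nat) (M : pt -> Prop) (f : fn) : Prop :=
  forall x, M x -> forall eps, 0 < eps -> exists del, 0 < del /\
    forall y, M y -> dist d x y < del -> Cnorm (Cadd (f y) (Copp (f x))) < eps.
Definition sup_le (M : pt -> Prop) (f : fn) (s : R) : Prop :=
  forall x, M x -> Cnorm (f x) <= s.
Definition fadd (f g : fn) : fn := fun x => Cadd (f x) (g x).
Definition fmul (f g : fn) : fn := fun x => Cmul (f x) (g x).
Definition fscale (c : CC) (f : fn) : fn := fun x => Cmul c (f x).
Definition fone : fn := fun _ => C1.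
Definition feq (M : pt -> Prop) (f g : fn) : Prop := forall x, M x -> f x = g x.

(* An isomorphic extension phi : C(M) -> B(l^p)/K(l^p) is represented by a
   choice of lifts Phi f in B(l^p) with pi(Phi f) = phi(f). *)
Definition is_ext (p : R) (d : nat) (M : pt -> Prop) (Phi : fn -> op) : Prop :=
  (forall f, cont_on d M f -> bdd p (Phi f)) /\
  (forall f g, cont_on d M f -> cont_on d M g -> feq M f g -> calk_eq p (Phi f) (Phi g)) /\
  (forall f g, cont_on d M f -> cont_on d M g ->
     calk_eq p (Phi (fadd f g)) (op_add (Phi f) (Phi g))) /\
  (forall c f, cont_on d M f -> calk_eq p (Phi (fscale c f)) (op_scale c (Phi f))) /\
  (forall f g, cont_on d M f -> cont_on d M g ->
     calk_eq p (Phi (fmul f g)) (op_comp (Phi f) (Phi g))) /\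
  calk_eq p (Phi fone) op_id /\
  exists C, 1 <= C /\ forall f, cont_on d M f ->
    (forall s, calk_norm_le p (Phi f) s -> sup_le M f (C * s)) /\
    (forall s, sup_le M f s -> calk_norm_le p (Phi f) (C * s)).

Definition is_iso_into_B (p : R) (d : nat) (M : pt -> Prop) (rho : fn -> op) : Prop :=
  (forall f, cont_on d M f -> bdd p (rho f)) /\
  (forall f g, cont_on d M f -> cont_on d M g -> feq M f g -> op_eq p (rho f) (rho g)) /\
  (forall f g, cont_on d M f -> cont_on d M g ->
     op_eq p (rho (fadd f g)) (op_add (rho f) (rho g))) /\
  (forall c f, cont_on d M f -> op_eq p (rho (fscale c f)) (op_scale c (rho f))) /\
  (forall f g, cont_on d M f -> cont_on d M g ->
     op_eq p (rho (fmul f g)) (op_comp (rho f) (rho g))) /\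
  op_eq p (rho fone) op_id /\
  exists C, 1 <= C /\ forall f, cont_on d M f ->
    (forall s, op_bound p (rho f) s -> sup_le M f (C * s)) /\
    (forall s, sup_le M f s -> op_bound p (rho f) (C * s)).

Definition trivial_ext (p : R) (d : nat) (M : pt -> Prop) (Phi : fn -> op) : Prop :=
  exists rho, is_iso_into_B p d M rho /\
    forall f, cont_on d M f -> calk_eq p (Phi f) (rho f).

Definition equiv_ext (p : R) (d : nat) (M : pt -> Prop) (Phi1 Phi2 : fn -> op) : Prop :=
  exists S S', invertible_op p S S' /\
    forall f, cont_on d M f -> calk_eq p (Phi2 f) (op_comp S (op_comp (Phi1 f) S')).

(* the sum, using the invertible S0 : l^p (+) l^p -> l^p, (u,v) |-> interleave *)
Definition evens (x : vec) : vec := fun n => x (2 * n)%nat.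
Definition odds (x : vec) : vec := fun n => x (2 * n + 1)%nat.
Definition interleave (u v : vec) : vec :=
  fun n => if Nat.even n then u (Nat.div2 n) else v (Nat.div2 n).
Definition sum_ext (Phi1 Phi2 : fn -> op) : fn -> op :=
  fun f x => interleave (Phi1 f (evens x)) (Phi2 f (odds x)).

(* Main.v *)
(** Let [T] be a lift of an extension of K(l^p) by C(M).  At scale [n] choose a grid partition of
    unity [sum_i h_i^2 = 1] on [M], subordinate to points [x_i], whose multiplicity is bounded in
    terms of [d] only, and a finite-rank cutoff [g_n] that almost commutes with finitely many of the
    operators [T f] ([sum_n g_n = 1]).  Averaging over signs, the maps
      [x |-> (sum_i eps_i T(h_i) g_n x)_eps]  and  [(y_eps) |-> g'_n E_eps (sum_i eps_i T(h_i)) y_eps]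
    between l^p and L^p({-1,1}^k; l^p) are bounded uniformly in [n], because
    [sum_i eps_i h_i] is bounded uniformly.  On the span of the Rademacher functions, which is
    complemented uniformly in [k] by Khinchine's inequality, let [f] act by [eps_i |-> f(x_i) eps_i],
    and on the complement by the scalar [f(x_0)]; the l^p-sum over [n] of these actions is a
    representation [rho] of C(M) on l^p that does not depend on [T].  The maps above add up to [V] and
    [W] with [W V = 1] that intertwine [T] and [rho] modulo the compacts.  With [N = 1 - V W], the
    involution with matrix [(0, W; V, N)] conjugates the direct sum of [f(x_0)] and [rho(f)] into that
    of [T(f)] and [f(x_0) V W + N rho(f) N], so every extension is a direct summand of the sum [theta]
    of [f(x_0)] and [rho(f)].  As [rho] has infinite multiplicity, [theta] absorbs itself; the
    uniqueness is formal. *)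

From Stdlib Require Import Reals Lra Lia List Arith ZArith Cantor.
From Stdlib Require Import ClassicalEpsilon FunctionalExtensionality ProofIrrelevance Classical.
From Stdlib Require Import Setoid Morphisms.
(* After [Reals], which has its own [C1]. *)
Require Import Defs.
Import ListNotations.
Open Scope R_scope.

(** In a Hilbert space the column of the operators [T(h_i)] would be controlled by positivity. Here
    there is no adjoint and no order, and the plain l^p-norm of that column is not bounded
    independently of the number of functions. What an extension does bound is the image of a single
    function by its sup norm, and this bounds all sign sums at once, since the functions [h_i] add
    up to at most [2^d]: each coordinate contributes at most two overlapping tents of total at most
    2. Hence the column is indexed by sign vectors rather than by [i], at the price of needing the
    Rademacher projection bounded uniformly in [k]; this uses [1 < p < oo].

    A second obstacle is that [sum_i T(h_i)^2] is the identity only modulo the compacts, whereas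
    [W V = 1] has to hold exactly for the final matrix to be an involution. The defect is routed
    through one spare slice, next to the sign vectors, on which the model is scalar.

    Finally, a bound in the Calkin algebra becomes a bound in norm only far out along the
    coordinates, so the [n]-th cutoff has to live beyond an index that depends on the scale [n]. *)

Fixpoint gsum {A : Type} (add : A -> A -> A) (z : A) (n : nat) (F : nat -> A) : A :=
  match n with O => z | S m => add (gsum add z m F) (F m) end.

Lemma gsum_ext {A : Type} (add : A -> A -> A) (z : A) (n : nat) (F G : nat -> A) :
  (forall i, (i < n)%nat -> F i = G i) -> gsum add z n F = gsum add z n G.
Proof.
  induction n as [|n IH]; intros H; simpl; auto.
  rewrite IH, H by auto. reflexivity.
Qed.

(** Coordinates, evaluation at a vector, composition with an operator and the embedding of the reals
    are all additive, so this one induction serves scalars, vectors and operators. *)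
Lemma gsum_morph {A B : Type} (add : A -> A -> A) (z : A) (add' : B -> B -> B) (z' : B)
  (phi : A -> B) (n : nat) (F : nat -> A) :
  phi z = z' -> (forall a b, phi (add a b) = add' (phi a) (phi b)) ->
  phi (gsum add z n F) = gsum add' z' n (fun i => phi (F i)).
Proof.
  intros Hz Ha; induction n as [|n IH]; simpl; auto. rewrite Ha, IH. reflexivity.
Qed.

(** * Finite sums of real numbers *)

Notation rsum := (gsum Rplus 0).

Lemma rsum_le (n : nat) (F G : nat -> R) :
  (forall i, (i < n)%nat -> F i <= G i) -> rsum n F <= rsum n G.
Proof.
  induction n as [|n IH]; intros H; simpl; [lra|].
  assert (rsum n F <= rsum n G) by (apply IH; auto).
  assert (F n <= G n) by auto. lra.
Qed.

Lemma rsum_nonneg (n : nat) (F : nat -> R) :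
  (forall i, (i < n)%nat -> 0 <= F i) -> 0 <= rsum n F.
Proof.
  induction n as [|n IH]; intros H; simpl; [lra|].
  assert (0 <= rsum n F) by (apply IH; auto).
  assert (0 <= F n) by auto. lra.
Qed.

Lemma rsum_plus (n : nat) (F G : nat -> R) :
  rsum n (fun i => F i + G i) = rsum n F + rsum n G.
Proof. induction n as [|n IH]; simpl; [lra|]. rewrite IH. lra. Qed.

Lemma rsum_scal (n : nat) (c : R) (F : nat -> R) :
  rsum n (fun i => c * F i) = c * rsum n F.
Proof. induction n as [|n IH]; simpl; [lra|]. rewrite IH. lra. Qed.

Lemma rsum_const (n : nat) (c : R) : rsum n (fun _ => c) = INR n * c.
Proof. induction n as [|n IH]; [simpl; lra|]. rewrite S_INR. simpl gsum. rewrite IH. lra. Qed.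

Lemma rsum_swap (n m : nat) (F : nat -> nat -> R) :
  rsum n (fun i => rsum m (fun j => F i j)) = rsum m (fun j => rsum n (fun i => F i j)).
Proof.
  induction n as [|n IH]; simpl.
  - symmetry. rewrite rsum_const. ring.
  - rewrite IH, rsum_plus. reflexivity.
Qed.

Lemma rsum_split (n m : nat) (F : nat -> R) :
  rsum (n + m) F = rsum n F + rsum m (fun i => F (n + i)%nat).
Proof.
  induction m as [|m IH]; simpl.
  - rewrite Nat.add_0_r. lra.
  - rewrite Nat.add_succ_r. simpl. rewrite IH. lra.
Qed.

Lemma rsum_single (n k : nat) (F : nat -> R) :
  (k < n)%nat -> (forall i, (i < n)%nat -> i <> k -> F i = 0) -> rsum n F = F k.
Proof.
  induction n as [|n IH]; intros Hk H; [lia|]. simpl.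
  destruct (Nat.eq_dec k n) as [->|Hn].
  - rewrite (gsum_ext _ _ n F (fun _ => 0)), rsum_const by (intros; apply H; lia). lra.
  - rewrite IH, (H n) by (auto; lia). lra.
Qed.

Lemma rsum_ge_term (n k : nat) (F : nat -> R) :
  (k < n)%nat -> (forall i, 0 <= F i) -> F k <= rsum n F.
Proof.
  induction n as [|n IH]; intros Hk H; [lia|]. simpl.
  assert (0 <= rsum n F) by (apply rsum_nonneg; auto).
  pose proof (H n).
  destruct (Nat.eq_dec k n) as [->|Hn]; [lra|].
  assert (F k <= rsum n F) by (apply IH; auto; lia). lra.
Qed.

Lemma rsum_mono (n m : nat) (F : nat -> R) :
  (n <= m)%nat -> (forall i, 0 <= F i) -> rsum n F <= rsum m F.
Proof.
  intros H HF. replace m with (n + (m - n))%nat by lia.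
  rewrite rsum_split. assert (0 <= rsum (m - n) (fun i => F (n + i)%nat))
    by (apply rsum_nonneg; auto). lra.
Qed.

Lemma rsum_shift_two (m j : nat) (F : nat -> R) :
  (S j < m)%nat -> (forall i, i <> j -> i <> S j -> F i = 0) -> rsum m F = F j + F (S j).
Proof.
  intros Hj H.
  replace m with (j + (2 + (m - S (S j))))%nat by lia.
  rewrite !rsum_split.
  rewrite (gsum_ext _ _ j F (fun _ => 0)), rsum_const by (intros; apply H; lia).
  rewrite (gsum_ext _ _ (m - S (S j)) _ (fun _ => 0)), rsum_const by (intros; apply H; lia).
  simpl. replace (j + 0)%nat with j by lia. replace (j + 1)%nat with (S j) by lia. lra.
Qed.

Lemma sum_f_R0_rsum (F : nat -> R) (N : nat) : sum_f_R0 F N = rsum (S N) F.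
Proof. induction N as [|N IH]; simpl in *; [lra|]. rewrite IH. reflexivity. Qed.

(** * Sums over lists and double sums along Cantor's pairing *)

Definition lsum {A : Type} (F : A -> R) (l : list A) : R :=
  fold_right (fun a s => F a + s) 0 l.

Lemma lsum_app {A : Type} (F : A -> R) (l l' : list A) :
  lsum F (l ++ l') = lsum F l + lsum F l'.
Proof. induction l as [|a l IH]; simpl; [lra|]. rewrite IH. lra. Qed.

Lemma lsum_nonneg {A : Type} (F : A -> R) (l : list A) :
  (forall a, 0 <= F a) -> 0 <= lsum F l.
Proof. intros H; induction l as [|a l IH]; simpl; [lra|]. pose proof (H a). lra. Qed.

(** Combined with an injective map of indices, this monotonicity stands in for the rearrangement of
    double series with nonnegative terms. *)
Lemma lsum_incl {A : Type} (F : A -> R) (l l' : list A) :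
  (forall a, 0 <= F a) -> NoDup l -> incl l l' -> lsum F l <= lsum F l'.
Proof.
  intros HF Hl; revert l'; induction Hl as [|a l Ha Hl IH]; intros l' Hi; simpl.
  - apply lsum_nonneg; auto.
  - destruct (in_split a l') as (l1 & l2 & ->); [apply Hi; left; auto|].
    rewrite lsum_app. simpl.
    assert (lsum F l <= lsum F (l1 ++ l2)).
    { apply IH. intros b Hb. assert (In b (l1 ++ a :: l2)) by (apply Hi; right; auto).
      apply in_app_iff in H. apply in_app_iff. destruct H as [H|[H|H]]; auto.
      subst. contradiction. }
    rewrite lsum_app in H. lra.
Qed.

Lemma lsum_map {A B : Type} (F : B -> R) (g : A -> B) (l : list A) :
  lsum F (map g l) = lsum (fun a => F (g a)) l.
Proof. induction l as [|a l IH]; simpl; [lra|]. rewrite IH. reflexivity. Qed.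

Lemma rsum_lsum (n : nat) (F : nat -> R) : rsum n F = lsum F (seq 0 n).
Proof.
  induction n as [|n IH]; [reflexivity|].
  rewrite seq_S, lsum_app. simpl. rewrite IH. simpl. lra.
Qed.

Lemma lsum_list_prod (F : nat * nat -> R) (l l' : list nat) :
  lsum F (list_prod l l') = lsum (fun a => lsum (fun b => F (a, b)) l') l.
Proof.
  induction l as [|a l IH]; simpl; [lra|].
  rewrite lsum_app, lsum_map, IH. reflexivity.
Qed.

Lemma NoDup_list_prod {A B : Type} (l : list A) (l' : list B) :
  NoDup l -> NoDup l' -> NoDup (list_prod l l').
Proof.
  intros Hl Hl'; induction Hl as [|a l Ha Hl IH]; simpl; [constructor|].
  apply NoDup_app; auto.
  - apply NoDup_map_NoDup_ForallPairs; auto. intros x y _ _ E; congruence.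
  - intros [b c] H1 H2. apply in_map_iff in H1. destruct H1 as (x & E & _).
    apply in_prod_iff in H2. inversion E; subst. tauto.
Qed.

Lemma pair_sum_le_seq (a : nat -> nat -> R) (S : R) :
  (forall n s, 0 <= a n s) ->
  (forall N, rsum N (fun t => let '(n, s) := of_nat t in a n s) <= S) ->
  forall N M, rsum N (fun n => rsum M (fun s => a n s)) <= S.
Proof.
  intros Ha H N M.
  set (F := fun c : nat * nat => a (fst c) (snd c)).
  assert (Hm : exists K, forall n s, (n < N)%nat -> (s < M)%nat -> (to_nat (n, s) < K)%nat).
  (* A crude bound on the rectangle, from twice the code of [(n, s)] being
     [2 s + (s + n) (s + n + 1)]. *)
  { exists (M + (M + N) * Datatypes.S (M + N))%nat. intros n s Hn Hs.
    pose proof (to_nat_spec n s). nia. }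
  destruct Hm as [K HK].
  apply Rle_trans with (rsum K (fun t => let '(n, s) := of_nat t in a n s)); [|apply H].
  rewrite (gsum_ext _ _ K _ (fun t => F (of_nat t)))
    by (intros i _; unfold F; destruct (of_nat i); reflexivity).
  rewrite (rsum_lsum K), <- (lsum_map F of_nat).
  rewrite (gsum_ext _ _ N _ (fun n => lsum (fun s => F (n, s)) (seq 0 M)))
    by (intros; apply rsum_lsum).
  rewrite rsum_lsum, <- lsum_list_prod.
  apply lsum_incl.
  - intros; apply Ha.
  - apply NoDup_list_prod; apply seq_NoDup.
  - intros [n s] Hi. apply in_prod_iff in Hi. rewrite !in_seq in Hi.
    apply in_map_iff. exists (to_nat (n, s)). rewrite cancel_of_to. split; auto.
    apply in_seq. specialize (HK n s). lia.
Qed.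

Lemma fst_of_nat_le (t : nat) : (fst (of_nat t) <= t)%nat.
Proof.
  destruct (of_nat t) as [n s] eqn:E. pose proof (cancel_to_of t) as H. rewrite E in H.
  pose proof (to_nat_non_decreasing n s). simpl. lia.
Qed.

Lemma snd_of_nat_le (t : nat) : (snd (of_nat t) <= t)%nat.
Proof.
  destruct (of_nat t) as [n s] eqn:E. pose proof (cancel_to_of t) as H. rewrite E in H.
  pose proof (to_nat_non_decreasing n s). simpl. lia.
Qed.

Lemma of_nat_inj (t t' : nat) : of_nat t = of_nat t' -> t = t'.
Proof. intros H. rewrite <- (cancel_to_of t), H, cancel_to_of. reflexivity. Qed.

Lemma pair_sum_seq_le (a : nat -> nat -> R) (S : R) :
  (forall n s, 0 <= a n s) ->
  (forall N M, rsum N (fun n => rsum M (fun s => a n s)) <= S) ->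
  forall N, rsum N (fun t => let '(n, s) := of_nat t in a n s) <= S.
Proof.
  intros Ha H N.
  set (F := fun c : nat * nat => a (fst c) (snd c)).
  (* Both components of the pair number [t] are at most [t], so the first [N] pairs lie in the
     square of side [N]. *)
  apply Rle_trans with (rsum N (fun n => rsum N (fun s => a n s))); [|apply H].
  rewrite (gsum_ext _ _ N (fun t => let '(n, s) := of_nat t in a n s) (fun t => F (of_nat t)))
    by (intros i _; unfold F; destruct (of_nat i); reflexivity).
  rewrite (rsum_lsum N (fun t => F (of_nat t))), <- (lsum_map F of_nat).
  rewrite (gsum_ext _ _ N _ (fun n => lsum (fun s => F (n, s)) (seq 0 N)))
    by (intros; apply rsum_lsum).
  rewrite rsum_lsum, <- lsum_list_prod.
  apply lsum_incl.
  - intros; apply Ha.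
  - apply NoDup_map_NoDup_ForallPairs; [|apply seq_NoDup].
    intros x y _ _ E. apply of_nat_inj; auto.
  - intros c Hc. apply in_map_iff in Hc. destruct Hc as (t & E & Ht).
    apply in_seq in Ht. pose proof (fst_of_nat_le t). pose proof (snd_of_nat_le t).
    rewrite E in *. destruct c as [n s]. apply in_prod_iff. rewrite !in_seq. simpl in *. lia.
Qed.

(** * Real powers *)

(** The tangent line of [exp] at the weighted mean [m] of the logarithms lies below the graph; in
    the weighted sum over [a] and [b] the linear terms cancel. *)
Lemma Rpower_weighted_AMGM (a b th : R) :
  0 < a -> 0 < b -> 0 <= th <= 1 ->
  Rpower a th * Rpower b (1 - th) <= th * a + (1 - th) * b.
Proof.
  intros Ha Hb Ht.
  set (m := th * ln a + (1 - th) * ln b).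
  assert (E : Rpower a th * Rpower b (1 - th) = exp m).
  { unfold Rpower, m. rewrite exp_plus. reflexivity. }
  rewrite E.
  assert (H1 : forall c, 0 < c -> exp m * (1 + (ln c - m)) <= c).
  { intros c Hc. replace c with (exp m * exp (ln c - m)) at 2.
    - apply Rmult_le_compat_l; [left; apply exp_pos|]. apply exp_ineq1_le.
    - rewrite <- exp_plus. replace (m + (ln c - m)) with (ln c) by ring. apply exp_ln; auto. }
  pose proof (H1 a Ha) as HA. pose proof (H1 b Hb) as HB.
  apply Rle_trans with (th * (exp m * (1 + (ln a - m))) + (1 - th) * (exp m * (1 + (ln b - m)))).
  - right. unfold m. ring.
  - apply Rplus_le_compat; apply Rmult_le_compat_l; lra.
Qed.

Lemma rpow_nonneg (x p : R) : 0 <= rpow x p.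
Proof. unfold rpow. destruct (Rlt_dec 0 x); [left; apply exp_pos|lra]. Qed.

Lemma rpow_pos (x p : R) : 0 < x -> 0 < rpow x p.
Proof. intros. unfold rpow. destruct (Rlt_dec 0 x); [apply exp_pos|lra]. Qed.

Lemma rpow_Rpower (x p : R) : 0 < x -> rpow x p = Rpower x p.
Proof. intros. unfold rpow. destruct (Rlt_dec 0 x); [reflexivity|lra]. Qed.

Lemma rpow_0 (p : R) : rpow 0 p = 0.
Proof. unfold rpow. destruct (Rlt_dec 0 0); lra. Qed.

Lemma rpow_1 (p : R) : rpow 1 p = 1.
Proof. rewrite rpow_Rpower by lra. unfold Rpower. rewrite ln_1, Rmult_0_r. apply exp_0. Qed.

Lemma rpow_exp1 (x : R) : 0 <= x -> rpow x 1 = x.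
Proof.
  intros [H|<-]; [|apply rpow_0]. rewrite rpow_Rpower by auto. apply Rpower_1; auto.
Qed.

Lemma rpow_le (x y p : R) : 0 <= p -> 0 <= x <= y -> rpow x p <= rpow y p.
Proof.
  intros Hp [[Hx|<-] Hy]; [|rewrite rpow_0; apply rpow_nonneg].
  rewrite !rpow_Rpower by lra. apply Rle_Rpower_l; lra.
Qed.

Lemma rpow_mult (x y p : R) : 0 <= x -> 0 <= y -> rpow (x * y) p = rpow x p * rpow y p.
Proof.
  intros [Hx|<-]; [intros [Hy|<-]|].
  - rewrite !rpow_Rpower by (auto; nra). symmetry. apply Rpower_mult_distr; auto.
  - rewrite Rmult_0_r, rpow_0. ring.
  - rewrite Rmult_0_l, rpow_0. intros; ring.
Qed.

Lemma rpow_rpow (x p q : R) : 0 <= x -> rpow (rpow x p) q = rpow x (p * q).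
Proof.
  intros [Hx|<-]; [|rewrite !rpow_0; reflexivity].
  rewrite (rpow_Rpower x) by auto. rewrite !rpow_Rpower; auto.
  apply Rpower_mult. apply exp_pos.
Qed.

Lemma rpow_plus (x p q : R) : 0 <= x -> rpow x (p + q) = rpow x p * rpow x q.
Proof.
  intros [Hx|<-]; [|rewrite !rpow_0; ring].
  rewrite !rpow_Rpower by auto. apply Rpower_plus.
Qed.

Lemma rpow_inv (x p : R) : 0 < p -> 0 <= x -> rpow (rpow x p) (/ p) = x.
Proof.
  intros Hp Hx. rewrite rpow_rpow, Rinv_r by lra. apply rpow_exp1; auto.
Qed.

Lemma rpow_inv' (x p : R) : 0 < p -> 0 <= x -> rpow (rpow x (/ p)) p = x.
Proof.
  intros Hp Hx. rewrite rpow_rpow, Rinv_l by lra. apply rpow_exp1; auto.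
Qed.

Lemma rpow_le_inv (x y p : R) : 0 < p -> 0 <= x -> 0 <= y -> rpow x p <= rpow y p -> x <= y.
Proof.
  intros Hp Hx Hy H. rewrite <- (rpow_inv x p), <- (rpow_inv y p) by auto.
  apply rpow_le; [left; apply Rinv_0_lt_compat; auto|]. split; [apply rpow_nonneg|auto].
Qed.

Lemma rpow_le_self (x p : R) : 1 <= p -> 0 <= x <= 1 -> rpow x p <= x.
Proof.
  intros Hp [[Hx|<-] H1]; [|rewrite rpow_0; lra].
  replace p with (1 + (p - 1)) by ring. rewrite rpow_plus, rpow_exp1 by lra.
  assert (rpow x (p - 1) <= 1).
  { pose proof (rpow_le x 1 (p - 1)) as H. rewrite rpow_1 in H. apply H; lra. }
  pose proof (rpow_nonneg x (p - 1)). nra.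
Qed.

(** Weighted AM-GM for [w = 1 + p (u - 1)] and [1] with weight [1/p]: the arithmetic mean is exactly
    [u], the geometric mean is [w^(1/p)]. *)
Lemma rpow_Bernoulli (u p : R) : 1 <= p -> 0 <= u -> 1 + p * (u - 1) <= rpow u p.
Proof.
  intros Hp Hu. destruct (Rle_dec (1 + p * (u - 1)) 0) as [H|H].
  - pose proof (rpow_nonneg u p). lra.
  - apply Rnot_le_lt in H. set (w := 1 + p * (u - 1)) in *.
    assert (E : u = / p * w + (1 - / p) * 1) by (unfold w; field; lra).
    assert (Hi : 0 < / p <= 1).
    { split; [apply Rinv_0_lt_compat; lra|]. rewrite <- Rinv_1. apply Rinv_le_contravar; lra. }
    pose proof (Rpower_weighted_AMGM w 1 (/ p) H Rlt_0_1) as A.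
    rewrite <- E in A. unfold Rpower at 2 in A. rewrite ln_1, Rmult_0_r, exp_0, Rmult_1_r in A.
    rewrite <- (rpow_inv' w p) by lra.
    apply rpow_le; [lra|]. split; [apply rpow_nonneg|].
    rewrite rpow_Rpower by auto. apply A. lra.
Qed.

(** Bernoulli's inequality at [c / m] is the supporting line of the power function at the mean [m];
    averaging it over [x] and [y] removes the linear term. *)
Lemma rpow_convex (x y t p : R) : 1 <= p -> 0 <= x -> 0 <= y -> 0 <= t <= 1 ->
  rpow (t * x + (1 - t) * y) p <= t * rpow x p + (1 - t) * rpow y p.
Proof.
  intros Hp Hx Hy Ht. set (m := t * x + (1 - t) * y).
  assert (Hm : 0 <= m) by (unfold m; nra).
  destruct Hm as [Hm|Hm].
  - assert (H : forall c, 0 <= c -> rpow m p * (1 + p * (c / m - 1)) <= rpow c p).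
    { intros c Hc. replace c with (m * (c / m)) at 2 by (field; lra).
      assert (0 <= c / m) by (apply Rmult_le_pos; [lra|left; apply Rinv_0_lt_compat; auto]).
      rewrite rpow_mult by lra.
      apply Rmult_le_compat_l; [apply rpow_nonneg|]. apply rpow_Bernoulli; auto. }
    pose proof (H x Hx) as HX. pose proof (H y Hy) as HY.
    apply Rle_trans with (t * (rpow m p * (1 + p * (x / m - 1)))
                          + (1 - t) * (rpow m p * (1 + p * (y / m - 1)))).
    + right. replace (t * (rpow m p * (1 + p * (x / m - 1)))
        + (1 - t) * (rpow m p * (1 + p * (y / m - 1))))
        with (rpow m p * (1 + p * ((t * x + (1 - t) * y) / m - 1))) by (field; lra).
      fold m. field. lra.
    + apply Rplus_le_compat; apply Rmult_le_compat_l; lra.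
  - rewrite <- Hm, rpow_0. pose proof (rpow_nonneg x p). pose proof (rpow_nonneg y p). nra.
Qed.

Lemma rpow_add_le (x y p : R) : 1 <= p -> 0 <= x -> 0 <= y ->
  rpow (x + y) p <= rpow 2 p * (rpow x p + rpow y p).
Proof.
  intros Hp Hx Hy. replace (x + y) with (2 * (/ 2 * x + (1 - / 2) * y)) by field.
  rewrite rpow_mult by lra.
  apply Rmult_le_compat_l; [apply rpow_nonneg|].
  pose proof (rpow_convex x y (/ 2) p Hp Hx Hy ltac:(lra)).
  pose proof (rpow_nonneg x p). pose proof (rpow_nonneg y p). lra.
Qed.

Lemma Young (x y p q : R) : 1 < p -> 0 <= x -> 0 <= y -> / p + / q = 1 -> 0 < q ->
  x * y <= rpow x p / p + rpow y q / q.
Proof.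
  intros Hp [Hx|<-] [Hy|<-] E Hq.
  - assert (Hi : 0 < / p < 1).
    { split; [apply Rinv_0_lt_compat; lra|]. rewrite <- Rinv_1. apply Rinv_lt_contravar; lra. }
    pose proof (Rpower_weighted_AMGM (rpow x p) (rpow y q) (/ p)
                  (rpow_pos _ _ Hx) (rpow_pos _ _ Hy) ltac:(lra)) as A.
    rewrite <- !rpow_Rpower in A by (apply rpow_pos; auto).
    replace (1 - / p) with (/ q) in A by lra.
    rewrite !rpow_inv in A by lra. unfold Rdiv. lra.
  - rewrite Rmult_0_r, rpow_0. pose proof (rpow_pos x p Hx).
    assert (0 < / p) by (apply Rinv_0_lt_compat; lra). unfold Rdiv. nra.
  - rewrite Rmult_0_l, rpow_0. pose proof (rpow_pos y q Hy).
    assert (0 < / q) by (apply Rinv_0_lt_compat; lra). unfold Rdiv. nra.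
  - rewrite Rmult_0_l, !rpow_0. unfold Rdiv. lra.
Qed.

Lemma rpow_mean (n : nat) (a : nat -> R) (p : R) : 1 <= p -> (0 < n)%nat ->
  (forall i, 0 <= a i) ->
  rpow (rsum n a / INR n) p <= rsum n (fun i => rpow (a i) p) / INR n.
Proof.
  intros Hp Hn Ha. induction n as [|n IH]; [lia|].
  destruct n as [|n].
  - simpl. rewrite !Rplus_0_l. replace (a 0%nat / 1) with (a 0%nat) by field. lra.
  - specialize (IH ltac:(lia)). set (N := S n) in *.
    assert (HN : 0 < INR N) by (apply lt_0_INR; lia).
    change (rsum (S N) a) with (rsum N a + a N).
    change (rsum (S N) (fun i => rpow (a i) p)) with (rsum N (fun i => rpow (a i) p) + rpow (a N) p).
    rewrite S_INR.
    (* The mean of [N + 1] numbers is the convex combination, with weight [t], of the mean of the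
       first [N] and the last number. *)
    set (t := INR N / (INR N + 1)).
    assert (Ht : 0 <= t <= 1).
    { unfold t. split; [apply Rmult_le_pos; [lra|left; apply Rinv_0_lt_compat; lra]|].
      apply Rmult_le_reg_r with (INR N + 1); [lra|]. unfold Rdiv. rewrite Rmult_assoc, Rinv_l; lra. }
    replace ((rsum N a + a N) / (INR N + 1)) with (t * (rsum N a / INR N) + (1 - t) * a N)
      by (unfold t; field; lra).
    eapply Rle_trans.
    + apply rpow_convex; auto. apply Rmult_le_pos; [apply rsum_nonneg; auto|].
      left; apply Rinv_0_lt_compat; auto.
    + replace ((rsum N (fun i => rpow (a i) p) + rpow (a N) p) / (INR N + 1))
        with (t * (rsum N (fun i => rpow (a i) p) / INR N) + (1 - t) * rpow (a N) p)
        by (unfold t; field; lra).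
      apply Rplus_le_compat_r. apply Rmult_le_compat_l; [apply Ht|exact IH].
Qed.

(** * Complex scalars *)

Lemma CC_ring_theory : ring_theory C0 C1 Cadd Cmul (fun a b => Cadd a (Copp b)) Copp (@eq CC).
Proof.
  constructor; intros; repeat match goal with x : CC |- _ => destruct x end;
  unfold C0, C1, Cadd, Cmul, Copp; simpl; try f_equal; ring.
Qed.
Add Ring CC_ring : CC_ring_theory.

Definition RC (r : R) : CC := (r, 0).

Lemma RC_1 : RC 1 = C1. Proof. reflexivity. Qed.
Lemma RC_0 : RC 0 = C0. Proof. reflexivity. Qed.
Lemma RC_mul (a b : R) : RC (a * b) = Cmul (RC a) (RC b).
Proof. unfold RC, Cmul; simpl; f_equal; ring. Qed.
Lemma RC_add (a b : R) : RC (a + b) = Cadd (RC a) (RC b).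
Proof. unfold RC, Cadd; simpl; f_equal; ring. Qed.
Lemma RC_opp (a : R) : RC (- a) = Copp (RC a).
Proof. unfold RC, Copp; simpl; f_equal; ring. Qed.

Lemma Cnorm_nonneg (a : CC) : 0 <= Cnorm a.
Proof. apply sqrt_pos. Qed.

Lemma Cnorm_sq (a : CC) : Cnorm a * Cnorm a = fst a * fst a + snd a * snd a.
Proof. unfold Cnorm. apply sqrt_sqrt. nra. Qed.

Lemma Cnorm_mul (a b : CC) : Cnorm (Cmul a b) = Cnorm a * Cnorm b.
Proof.
  unfold Cnorm at 2 3. rewrite <- sqrt_mult by nra. unfold Cnorm. f_equal.
  unfold Cmul; simpl; ring.
Qed.

Lemma Cnorm_add (a b : CC) : Cnorm (Cadd a b) <= Cnorm a + Cnorm b.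
Proof.
  pose proof (Cnorm_nonneg a). pose proof (Cnorm_nonneg b). pose proof (Cnorm_nonneg (Cadd a b)).
  pose proof (Cnorm_sq a) as Ha. pose proof (Cnorm_sq b) as Hb.
  pose proof (Cnorm_sq (Cadd a b)) as Hab. unfold Cadd in Hab; simpl in Hab.
  assert (Hcs : fst a * fst b + snd a * snd b <= Cnorm a * Cnorm b).
  { destruct (Rle_dec (fst a * fst b + snd a * snd b) 0); [nra|].
    apply Rsqr_incr_0_var; [unfold Rsqr|nra].
    replace (Cnorm a * Cnorm b * (Cnorm a * Cnorm b))
      with ((Cnorm a * Cnorm a) * (Cnorm b * Cnorm b)) by ring.
    rewrite Ha, Hb. pose proof (Rle_0_sqr (fst a * snd b - snd a * fst b)). unfold Rsqr in *. nra. }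
  apply Rsqr_incr_0_var; [unfold Rsqr|lra]. fold (Cadd a b). rewrite Cnorm_sq. simpl. nra.
Qed.

Lemma Cnorm_opp (a : CC) : Cnorm (Copp a) = Cnorm a.
Proof. unfold Cnorm, Copp; simpl. f_equal. ring. Qed.

Lemma Cnorm_RC (r : R) : Cnorm (RC r) = Rabs r.
Proof. unfold Cnorm, RC; simpl. rewrite Rmult_0_l, Rplus_0_r. apply sqrt_Rsqr_abs. Qed.

Lemma Cnorm_C0 : Cnorm C0 = 0.
Proof. rewrite <- RC_0, Cnorm_RC. apply Rabs_R0. Qed.

Lemma Cnorm_C1 : Cnorm C1 = 1.
Proof. rewrite <- RC_1, Cnorm_RC. apply Rabs_R1. Qed.

Lemma Cnorm_fst (a : CC) : Rabs (fst a) <= Cnorm a.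
Proof.
  apply Rsqr_incr_0_var; [|apply Cnorm_nonneg]. rewrite <- Rsqr_abs. unfold Rsqr.
  rewrite Cnorm_sq. nra.
Qed.

Lemma Cnorm_snd (a : CC) : Rabs (snd a) <= Cnorm a.
Proof.
  apply Rsqr_incr_0_var; [|apply Cnorm_nonneg]. rewrite <- Rsqr_abs. unfold Rsqr.
  rewrite Cnorm_sq. nra.
Qed.

Lemma Cnorm_le_parts (a : CC) : Cnorm a <= Rabs (fst a) + Rabs (snd a).
Proof.
  apply Rsqr_incr_0_var; [unfold Rsqr|pose proof (Rabs_pos (fst a)); pose proof (Rabs_pos (snd a)); lra].
  rewrite Cnorm_sq. pose proof (Rsqr_abs (fst a)). pose proof (Rsqr_abs (snd a)). unfold Rsqr in *.
  pose proof (Rabs_pos (fst a)). pose proof (Rabs_pos (snd a)). nra.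
Qed.

Lemma Cnorm_eq0 (a : CC) : Cnorm a = 0 -> a = C0.
Proof.
  intros H. pose proof (Cnorm_fst a). pose proof (Cnorm_snd a). rewrite H in *.
  pose proof (Rabs_pos (fst a)). pose proof (Rabs_pos (snd a)).
  destruct a as [x y]; simpl in *. unfold C0. f_equal.
  - destruct (Req_dec x 0); auto. apply Rabs_no_R0 in H4. lra.
  - destruct (Req_dec y 0); auto. apply Rabs_no_R0 in H4. lra.
Qed.

Notation csum := (gsum Cadd C0).

Lemma csum_norm (n : nat) (F : nat -> CC) : Cnorm (csum n F) <= rsum n (fun i => Cnorm (F i)).
Proof.
  induction n as [|n IH]; simpl; [rewrite Cnorm_C0; lra|].
  eapply Rle_trans; [apply Cnorm_add|]. lra.
Qed.

Lemma csum_add (n : nat) (F G : nat -> CC) :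
  csum n (fun i => Cadd (F i) (G i)) = Cadd (csum n F) (csum n G).
Proof. induction n as [|n IH]; simpl; [ring|]. rewrite IH. ring. Qed.

Lemma csum_scal (n : nat) (c : CC) (F : nat -> CC) :
  csum n (fun i => Cmul c (F i)) = Cmul c (csum n F).
Proof. induction n as [|n IH]; simpl; [ring|]. rewrite IH. ring. Qed.

Lemma csum_zero (n : nat) (F : nat -> CC) : (forall i, (i < n)%nat -> F i = C0) -> csum n F = C0.
Proof. induction n as [|n IH]; intros H; simpl; [auto|]. rewrite IH, H by auto. ring. Qed.

Lemma csum_RC (n : nat) (F : nat -> R) : csum n (fun i => RC (F i)) = RC (rsum n F).
Proof.
  symmetry. apply (gsum_morph Rplus 0 Cadd C0 RC); [reflexivity|apply RC_add].
Qed.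

(** * The space l^p *)

Class exponent := Exponent { pexp : R; pexp_gt1 : 1 < pexp }.

Section Space.
Context {E : exponent}.
Notation p := pexp.

Lemma pexp_ge1 : 1 <= p. Proof. pose proof pexp_gt1. lra. Qed.
Lemma pexp_pos : 0 < p. Proof. pose proof pexp_gt1. lra. Qed.
Lemma pexp_nonneg : 0 <= p. Proof. pose proof pexp_gt1. lra. Qed.

Lemma lp_norm_le_iff (x : vec) (r : R) :
  lp_norm_le p x r <-> 0 <= r /\ forall N, rsum N (fun n => rpow (Cnorm (x n)) p) <= rpow r p.
Proof.
  unfold lp_norm_le. split; intros [Hr H]; split; auto; intros N.
  - destruct N as [|N]; [apply rpow_nonneg|]. rewrite <- sum_f_R0_rsum. apply H.
  - rewrite sum_f_R0_rsum. apply H.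
Qed.

Lemma lp_norm_le_coord (x : vec) (r : R) (n : nat) : lp_norm_le p x r -> Cnorm (x n) <= r.
Proof.
  rewrite lp_norm_le_iff. intros [Hr H].
  apply rpow_le_inv with p; auto using pexp_pos, Cnorm_nonneg.
  eapply Rle_trans; [|apply (H (S n))].
  apply (rsum_ge_term (S n) n (fun n => rpow (Cnorm (x n)) p)); auto.
  intros; apply rpow_nonneg.
Qed.

Lemma lp_norm_le_dom (x y : vec) (r : R) :
  (forall n, Cnorm (x n) <= Cnorm (y n)) -> lp_norm_le p y r -> lp_norm_le p x r.
Proof.
  rewrite !lp_norm_le_iff. intros H [Hr Hy]. split; auto. intros N.
  eapply Rle_trans; [|apply Hy]. apply rsum_le. intros i _.
  apply rpow_le; [apply pexp_nonneg|]. split; auto using Cnorm_nonneg.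
Qed.

Lemma lp_norm_le_weaken (x : vec) (r s : R) : r <= s -> lp_norm_le p x r -> lp_norm_le p x s.
Proof.
  rewrite !lp_norm_le_iff. intros H [Hr Hx]. split; [lra|]. intros N.
  eapply Rle_trans; [apply Hx|]. apply rpow_le; [apply pexp_nonneg|lra].
Qed.

(** Minkowski's inequality from convexity: [(x + y) / (r + s)] is the convex combination of [x / r]
    and [y / s] with weight [r / (r + s)]. If [r] or [s] is zero, the corresponding vector
    vanishes. *)
Lemma lp_norm_le_add (x y : vec) (r s : R) :
  lp_norm_le p x r -> lp_norm_le p y s -> lp_norm_le p (vadd x y) (r + s).
Proof.
  intros Hx Hy.
  destruct (proj1 (lp_norm_le_iff _ _) Hx) as [[Hr|Hr] HX];
  destruct (proj1 (lp_norm_le_iff _ _) Hy) as [[Hs|Hs] HY].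
  - apply lp_norm_le_iff. split; [lra|]. intros N.
    set (t := r / (r + s)).
    assert (Ht : 0 <= t <= 1).
    { unfold t. split; [apply Rmult_le_pos; [lra|left; apply Rinv_0_lt_compat; lra]|].
      apply Rmult_le_reg_r with (r + s); [lra|]. unfold Rdiv. rewrite Rmult_assoc, Rinv_l; lra. }
    apply Rle_trans with (rpow (r + s) p *
      (t * (rsum N (fun n => rpow (Cnorm (x n) / r) p))
       + (1 - t) * rsum N (fun n => rpow (Cnorm (y n) / s) p))).
    + rewrite <- !rsum_scal, <- rsum_plus, <- rsum_scal. apply rsum_le. intros n _.
      assert (Hxr : 0 <= Cnorm (x n) / r)
        by (apply Rmult_le_pos; [apply Cnorm_nonneg|left; apply Rinv_0_lt_compat; lra]).
      assert (Hys : 0 <= Cnorm (y n) / s)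
        by (apply Rmult_le_pos; [apply Cnorm_nonneg|left; apply Rinv_0_lt_compat; lra]).
      eapply Rle_trans.
      * apply rpow_le with (y := (r + s) * (t * (Cnorm (x n) / r) + (1 - t) * (Cnorm (y n) / s)));
          [apply pexp_nonneg|].
        split; [apply Cnorm_nonneg|]. eapply Rle_trans; [apply Cnorm_add|].
        right. unfold t. field. lra.
      * rewrite rpow_mult by (try nra).
        apply Rmult_le_compat_l; [apply rpow_nonneg|]. apply rpow_convex; auto using pexp_ge1.
    + rewrite <- (Rmult_1_r (rpow (r + s) p)) at 2. apply Rmult_le_compat_l; [apply rpow_nonneg|].
      assert (Hd : forall (z : vec) c, 0 < c ->
        (forall N, rsum N (fun n => rpow (Cnorm (z n)) p) <= rpow c p) ->
        rsum N (fun n => rpow (Cnorm (z n) / c) p) <= 1).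
      { intros z c Hc HZ.
        rewrite (gsum_ext _ _ N _ (fun n => rpow (/ c) p * rpow (Cnorm (z n)) p)).
        - rewrite rsum_scal. replace 1 with (rpow (/ c) p * rpow c p).
          + apply Rmult_le_compat_l; [apply rpow_nonneg|auto].
          + rewrite <- rpow_mult, Rinv_l, rpow_1; try lra. left; apply Rinv_0_lt_compat; lra.
        - intros n _. unfold Rdiv. rewrite Rmult_comm, rpow_mult; auto using Cnorm_nonneg.
          left; apply Rinv_0_lt_compat; lra. }
      pose proof (Hd x r Hr HX). pose proof (Hd y s Hs HY). nra.
  - subst s. apply (lp_norm_le_dom _ x); [|rewrite Rplus_0_r; auto].
    intros n. pose proof (lp_norm_le_coord _ _ n Hy). pose proof (Cnorm_nonneg (y n)).
    pose proof (Cnorm_add (x n) (y n)). unfold vadd. lra.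
  - subst r. apply (lp_norm_le_dom _ y); [|rewrite Rplus_0_l; auto].
    intros n. pose proof (lp_norm_le_coord _ _ n Hx). pose proof (Cnorm_nonneg (x n)).
    pose proof (Cnorm_add (x n) (y n)). unfold vadd. lra.
  - subst. apply (lp_norm_le_dom _ x); [|rewrite Rplus_0_r; auto].
    intros n. pose proof (lp_norm_le_coord _ _ n Hy). pose proof (Cnorm_nonneg (y n)).
    pose proof (Cnorm_add (x n) (y n)). unfold vadd. lra.
Qed.

Lemma lp_norm_le_scale (c : CC) (x : vec) (r : R) :
  lp_norm_le p x r -> lp_norm_le p (vscale c x) (Cnorm c * r).
Proof.
  rewrite !lp_norm_le_iff. intros [Hr H]. pose proof (Cnorm_nonneg c).
  split; [nra|]. intros N. rewrite rpow_mult by auto.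
  eapply Rle_trans; [|apply Rmult_le_compat_l; [apply rpow_nonneg|apply (H N)]].
  rewrite <- rsum_scal. right. apply gsum_ext. intros i _. unfold vscale.
  rewrite Cnorm_mul, rpow_mult; auto using Cnorm_nonneg.
Qed.

(** Vectors carry their membership in l^p, so that Leibniz equality is pointwise equality and
    identities between vectors and operators can be rewritten. *)
Definition LP : Type := { x : vec | lp p x }.
Definition lv (x : LP) : vec := proj1_sig x.

Lemma LP_ext (x y : LP) : (forall n, lv x n = lv y n) -> x = y.
Proof.
  destruct x as [x Hx], y as [y Hy]; simpl. intros H.
  assert (x = y) by (apply functional_extensionality; auto). subst.
  f_equal. apply proof_irrelevance.
Qed.

Lemma nrm_exists (x : LP) :
  exists s, lp_norm_le p (lv x) s /\ forall r, lp_norm_le p (lv x) r -> s <= r.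
Proof.
  destruct x as [x [r0 Hx]]; simpl. set (a := fun n => rpow (Cnorm (x n)) p).
  destruct (completeness (fun t => exists N, t = rsum N a)) as [S [Hub Hl]].
  - exists (rpow r0 p). intros t [N ->]. apply lp_norm_le_iff in Hx. apply Hx.
  - exists 0, 0%nat. reflexivity.
  - assert (HS : 0 <= S) by (apply Hub; exists 0%nat; reflexivity).
    exists (rpow S (/ p)). split.
    + apply lp_norm_le_iff. split; [apply rpow_nonneg|]. intros N.
      rewrite rpow_inv' by auto using pexp_pos. apply Hub. exists N; reflexivity.
    + intros r Hr. apply lp_norm_le_iff in Hr. destruct Hr as [Hr H].
      apply rpow_le_inv with p; auto using pexp_pos, rpow_nonneg.
      rewrite rpow_inv' by auto using pexp_pos. apply Hl. intros t [N ->]. apply H.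
Qed.

Definition nrm (x : LP) : R := proj1_sig (constructive_indefinite_description _ (nrm_exists x)).

Lemma nrm_le_iff (x : LP) (r : R) : nrm x <= r <-> lp_norm_le p (lv x) r.
Proof.
  unfold nrm. destruct (constructive_indefinite_description _ (nrm_exists x)) as [s [H1 H2]]; simpl.
  split; intros H; auto. eapply lp_norm_le_weaken; eauto.
Qed.

Lemma nrm_self (x : LP) : lp_norm_le p (lv x) (nrm x).
Proof. apply nrm_le_iff. lra. Qed.

Lemma nrm_nonneg (x : LP) : 0 <= nrm x.
Proof. destruct (nrm_self x); auto. Qed.

Lemma nrm_coord (x : LP) (n : nat) : Cnorm (lv x n) <= nrm x.
Proof. apply lp_norm_le_coord, nrm_self. Qed.

Lemma nrm_pow_le (x : LP) (N : nat) : rsum N (fun n => rpow (Cnorm (lv x n)) p) <= rpow (nrm x) p.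
Proof. apply lp_norm_le_iff, nrm_self. Qed.

Lemma nrm_le_of_sums (x : LP) (r : R) :
  0 <= r -> (forall N, rsum N (fun n => rpow (Cnorm (lv x n)) p) <= rpow r p) -> nrm x <= r.
Proof. intros. apply nrm_le_iff, lp_norm_le_iff. auto. Qed.

Lemma nrm_pow_le_of_sums (x : LP) (S : R) :
  (forall N, rsum N (fun n => rpow (Cnorm (lv x n)) p) <= S) -> rpow (nrm x) p <= S.
Proof.
  intros H. assert (HS : 0 <= S) by (apply (H 0%nat)).
  rewrite <- (rpow_inv' S p) by auto using pexp_pos.
  apply rpow_le; [apply pexp_nonneg|]. split; [apply nrm_nonneg|].
  apply nrm_le_of_sums; [apply rpow_nonneg|]. intros N. rewrite rpow_inv' by auto using pexp_pos.
  apply H.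
Qed.

Lemma nrm_dom (x y : LP) : (forall n, Cnorm (lv x n) <= Cnorm (lv y n)) -> nrm x <= nrm y.
Proof. intros H. apply nrm_le_iff. eapply lp_norm_le_dom; [apply H|]. apply nrm_self. Qed.

Lemma lp_add (x y : LP) : lp p (vadd (lv x) (lv y)).
Proof. exists (nrm x + nrm y). apply lp_norm_le_add; apply nrm_self. Qed.
Lemma lp_scale (c : CC) (x : LP) : lp p (vscale c (lv x)).
Proof. exists (Cnorm c * nrm x). apply lp_norm_le_scale; apply nrm_self. Qed.
Lemma lp_zero : lp p (fun _ => C0).
Proof.
  exists 0. apply lp_norm_le_iff. split; [lra|]. intros N. rewrite Cnorm_C0, rpow_0, rsum_const. lra.
Qed.

Definition ladd (x y : LP) : LP := exist _ _ (lp_add x y).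
Definition lscale (c : CC) (x : LP) : LP := exist _ _ (lp_scale c x).
Definition lzero : LP := exist _ _ lp_zero.
Definition lsub (x y : LP) : LP := ladd x (lscale (Copp C1) y).

Lemma lv_add (x y : LP) (n : nat) : lv (ladd x y) n = Cadd (lv x n) (lv y n).
Proof. reflexivity. Qed.
Lemma lv_scale (c : CC) (x : LP) (n : nat) : lv (lscale c x) n = Cmul c (lv x n).
Proof. reflexivity. Qed.
Lemma lv_zero (n : nat) : lv lzero n = C0.
Proof. reflexivity. Qed.

Lemma nrm_add (x y : LP) : nrm (ladd x y) <= nrm x + nrm y.
Proof. apply nrm_le_iff. apply lp_norm_le_add; apply nrm_self. Qed.

Lemma nrm_scale_le (c : CC) (x : LP) : nrm (lscale c x) <= Cnorm c * nrm x.
Proof. apply nrm_le_iff. apply lp_norm_le_scale, nrm_self. Qed.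

Lemma nrm_zero : nrm lzero = 0.
Proof.
  apply Rle_antisym; [|apply nrm_nonneg]. apply nrm_le_of_sums; [lra|].
  intros N. rewrite (gsum_ext _ _ N _ (fun _ => 0)), rsum_const, rpow_0; [lra|].
  intros. rewrite lv_zero, Cnorm_C0, rpow_0. reflexivity.
Qed.

Lemma nrm_eq0 (x : LP) : nrm x = 0 -> x = lzero.
Proof.
  intros H. apply LP_ext. intros n. apply Cnorm_eq0.
  pose proof (nrm_coord x n). pose proof (Cnorm_nonneg (lv x n)). lra.
Qed.

Lemma nrm_sub (x y : LP) : nrm (lsub x y) <= nrm x + nrm y.
Proof.
  eapply Rle_trans; [apply nrm_add|]. pose proof (nrm_scale_le (Copp C1) y) as H.
  rewrite Cnorm_opp, Cnorm_C1 in H. lra.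
Qed.

Lemma lscale_1 (x : LP) : lscale C1 x = x.
Proof. apply LP_ext. intros. rewrite lv_scale. ring. Qed.

Lemma lscale_lscale (c d : CC) (x : LP) : lscale c (lscale d x) = lscale (Cmul c d) x.
Proof. apply LP_ext. intros. rewrite !lv_scale. ring. Qed.

Lemma ladd_lsub (x y : LP) : ladd y (lsub x y) = x.
Proof. apply LP_ext. intros. unfold lsub. rewrite !lv_add, lv_scale. ring. Qed.

Lemma nrm_triangle (x y : LP) : nrm x <= nrm y + nrm (lsub x y).
Proof. rewrite <- (ladd_lsub x y) at 1. apply nrm_add. Qed.

(** * Bounded operators *)

(** The bound is existential, so that operators with the same action are equal; a concrete bound is
    attached from outside by [ob]. *)
Record Bop : Type := mkBop {
  bapp :> LP -> LP;
  b_add : forall x y, bapp (ladd x y) = ladd (bapp x) (bapp y);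
  b_scale : forall c x, bapp (lscale c x) = lscale c (bapp x);
  b_bounded : exists r, 0 <= r /\ forall x, nrm (bapp x) <= r * nrm x }.

Lemma Bop_ext (A B : Bop) : (forall x, A x = B x) -> A = B.
Proof.
  destruct A as [a a1 a2 a3], B as [b b1 b2 b3]; simpl. intros H.
  assert (a = b) by (apply functional_extensionality; auto). subst.
  f_equal; apply proof_irrelevance.
Qed.

Lemma b_zero (A : Bop) : A lzero = lzero.
Proof.
  replace lzero with (lscale C0 lzero) by (apply LP_ext; intros; rewrite lv_scale, lv_zero; ring).
  rewrite b_scale. apply LP_ext; intros; rewrite !lv_scale, lv_zero; ring.
Qed.

Lemma b_sub (A : Bop) (x y : LP) : A (lsub x y) = lsub (A x) (A y).
Proof. unfold lsub. rewrite b_add, b_scale. reflexivity. Qed.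

Definition ob (A : Bop) (r : R) : Prop := 0 <= r /\ forall x, nrm (A x) <= r * nrm x.

Lemma ob_exists (A : Bop) : exists r, ob A r.
Proof. exact (b_bounded A). Qed.

Definition good_map (F : LP -> vec) : Prop :=
  (forall x y n, F (ladd x y) n = Cadd (F x n) (F y n)) /\
  (forall c x n, F (lscale c x) n = Cmul c (F x n)) /\
  exists r, 0 <= r /\ forall x, lp_norm_le p (F x) (r * nrm x).

Lemma good_map_lp (F : LP -> vec) : good_map F -> forall x, lp p (F x).
Proof. intros (_ & _ & r & _ & H) x. eexists; apply H. Qed.

Definition badd (A B : Bop) : Bop.
Proof.
  refine (mkBop (fun x => ladd (A x) (B x)) _ _ _).
  - abstract (intros; rewrite !b_add; apply LP_ext; intros; rewrite !lv_add; ring).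
  - abstract (intros; rewrite !b_scale; apply LP_ext; intros;
              rewrite lv_add, !lv_scale, lv_add; ring).
  - abstract (destruct (b_bounded A) as (r & Hr & HA), (b_bounded B) as (s & Hs & HB);
      exists (r + s); split; [lra|]; intros x; eapply Rle_trans; [apply nrm_add|];
      specialize (HA x); specialize (HB x); lra).
Defined.

Definition bscale (c : CC) (A : Bop) : Bop.
Proof.
  refine (mkBop (fun x => lscale c (A x)) _ _ _).
  - abstract (intros; rewrite !b_add; apply LP_ext; intros;
              rewrite lv_add, !lv_scale, lv_add; ring).
  - abstract (intros; rewrite !b_scale; apply LP_ext; intros; rewrite !lv_scale; ring).
  - abstract (destruct (b_bounded A) as (r & Hr & HA); pose proof (Cnorm_nonneg c);
      exists (Cnorm c * r); split; [nra|]; intros x; eapply Rle_trans; [apply nrm_scale_le|];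
      rewrite Rmult_assoc; apply Rmult_le_compat_l; auto).
Defined.

Definition bcomp (A B : Bop) : Bop.
Proof.
  refine (mkBop (fun x => A (B x)) _ _ _).
  - abstract (intros; rewrite !b_add; reflexivity).
  - abstract (intros; rewrite !b_scale; reflexivity).
  - abstract (destruct (b_bounded A) as (r & Hr & HA), (b_bounded B) as (s & Hs & HB);
      exists (r * s); split; [nra|]; intros x; eapply Rle_trans; [apply HA|];
      rewrite Rmult_assoc; apply Rmult_le_compat_l; auto).
Defined.

Definition bid : Bop.
Proof.
  refine (mkBop (fun x => x) _ _ _); auto.
  abstract (exists 1; split; [lra|]; intros; lra).
Defined.

Definition bzero : Bop.
Proof.
  refine (mkBop (fun x => lzero) _ _ _).
  - abstract (intros; apply LP_ext; intros; rewrite lv_add, !lv_zero; ring).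
  - abstract (intros; apply LP_ext; intros; rewrite lv_scale, !lv_zero; ring).
  - abstract (exists 0; split; [lra|]; intros; rewrite nrm_zero; lra).
Defined.

Definition bsub (A B : Bop) : Bop := badd A (bscale (Copp C1) B).

(** The zero operator is the default for maps that are not linear and bounded. Constructions such as
    [col] and [row] can thus be named before their bounds are established. *)
Definition mkB (F : LP -> vec) : Bop.
Proof.
  refine (match excluded_middle_informative (good_map F) with
    | left H => mkBop (fun x => exist _ (F x) (good_map_lp F H x)) _ _ _
    | right _ => bzero end).
  - abstract (intros; apply LP_ext; intros; rewrite lv_add; apply (proj1 H)).
  - abstract (intros; apply LP_ext; intros; rewrite lv_scale; apply (proj1 (proj2 H))).
  - abstract (destruct H as (H1 & H2 & r & Hr & H3); exists r; split; auto;
              intros x; apply nrm_le_iff; apply H3).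
Defined.

Lemma mkB_app (F : LP -> vec) : good_map F -> forall x n, lv (mkB F x) n = F x n.
Proof.
  intros H x n. unfold mkB. destruct (excluded_middle_informative (good_map F)); [|contradiction].
  reflexivity.
Qed.

End Space.

Declare Scope bop_scope.
Delimit Scope bop_scope with B.
Infix "[+]" := badd (at level 50, left associativity) : bop_scope.
Infix "[-]" := bsub (at level 50, left associativity) : bop_scope.
Infix "[*]" := bcomp (at level 40, left associativity) : bop_scope.
Infix "[.]" := bscale (at level 35, right associativity) : bop_scope.
Open Scope bop_scope.
Notation bsum := (gsum badd bzero).

Ltac lin := repeat first [rewrite b_add | rewrite b_scale | rewrite b_zero].
Ltac lvs := repeat first [rewrite lv_add | rewrite lv_scale | rewrite lv_zero].
Ltac bapps := unfold bsub, lsub; cbn [bapp badd bscale bcomp bid bzero].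
(* Proves identities of noncommutative polynomials in bounded operators. *)
Ltac bop := intros; apply Bop_ext; let x := fresh "x" in intro x; bapps; lin;
  apply LP_ext; let n := fresh "n" in intro n; lvs; ring.

Section Operators.
Context {E : exponent}.
Notation p := pexp.

Lemma ob_mono (A : Bop) (r s : R) : r <= s -> ob A r -> ob A s.
Proof.
  intros H [Hr HA]. split; [lra|]. intros x. eapply Rle_trans; [apply HA|].
  apply Rmult_le_compat_r; [apply nrm_nonneg|auto].
Qed.

Lemma ob_add (A B : Bop) (r s : R) : ob A r -> ob B s -> ob (A [+] B) (r + s).
Proof.
  intros [Hr HA] [Hs HB]. split; [lra|]. intros x. simpl.
  eapply Rle_trans; [apply nrm_add|]. specialize (HA x); specialize (HB x); lra.
Qed.

Lemma ob_scale (c : CC) (A : Bop) (r : R) : ob A r -> ob (c [.] A) (Cnorm c * r).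
Proof.
  intros [Hr HA]. pose proof (Cnorm_nonneg c). split; [nra|]. intros x. simpl.
  eapply Rle_trans; [apply nrm_scale_le|]. rewrite Rmult_assoc.
  apply Rmult_le_compat_l; auto.
Qed.

Lemma ob_sub (A B : Bop) (r s : R) : ob A r -> ob B s -> ob (A [-] B) (r + s).
Proof.
  intros HA HB. apply ob_add; auto.
  replace s with (Cnorm (Copp C1) * s) by (rewrite Cnorm_opp, Cnorm_C1; ring).
  apply ob_scale; auto.
Qed.

Lemma ob_comp (A B : Bop) (r s : R) : ob A r -> ob B s -> ob (A [*] B) (r * s).
Proof.
  intros [Hr HA] [Hs HB]. split; [nra|]. intros x. simpl.
  eapply Rle_trans; [apply HA|]. rewrite Rmult_assoc. apply Rmult_le_compat_l; auto.
Qed.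

Lemma ob_id : ob bid 1.
Proof. split; [lra|]. intros; simpl; lra. Qed.

Lemma ob_zero : ob bzero 0.
Proof. split; [lra|]. intros; simpl. rewrite nrm_zero. lra. Qed.

Lemma ob_bsum (n : nat) (F : nat -> Bop) (r : nat -> R) :
  (forall i, (i < n)%nat -> ob (F i) (r i)) -> ob (bsum n F) (rsum n r).
Proof.
  induction n as [|n IH]; intros H; simpl; [apply ob_zero|].
  apply ob_add; [apply IH|]; auto.
Qed.

Lemma good_map_intro (F : LP -> vec) (r : R) :
  (forall x y n, F (ladd x y) n = Cadd (F x n) (F y n)) ->
  (forall c x n, F (lscale c x) n = Cmul c (F x n)) ->
  0 <= r -> (forall x, lp_norm_le p (F x) (r * nrm x)) -> good_map F.
Proof. intros; repeat split; auto. exists r; auto. Qed.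

Lemma ob_mkB (F : LP -> vec) (r : R) :
  good_map F -> 0 <= r -> (forall x, lp_norm_le p (F x) (r * nrm x)) -> ob (mkB F) r.
Proof.
  intros H Hr HF. split; auto. intros x. apply nrm_le_iff.
  eapply lp_norm_le_dom; [|apply HF]. intros n. rewrite mkB_app by auto. lra.
Qed.

Lemma bsum_app (n : nat) (F : nat -> Bop) (x : LP) :
  bsum n F x = gsum ladd lzero n (fun i => F i x).
Proof. apply (gsum_morph badd bzero ladd lzero (fun A : Bop => A x)); reflexivity. Qed.

Lemma lsum_lv (n : nat) (F : nat -> LP) (t : nat) :
  lv (gsum ladd lzero n F) t = csum n (fun i => lv (F i) t).
Proof. apply (gsum_morph ladd lzero Cadd C0 (fun x : LP => lv x t)); reflexivity. Qed.

Lemma bsum_lv (n : nat) (F : nat -> Bop) (x : LP) (t : nat) :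
  lv (bsum n F x) t = csum n (fun i => lv (F i x) t).
Proof. rewrite bsum_app. apply lsum_lv. Qed.

Lemma bcompA (A B C : Bop) : A [*] B [*] C = A [*] (B [*] C).
Proof. bop. Qed.
Lemma bcomp1l (A : Bop) : bid [*] A = A. Proof. bop. Qed.
Lemma bcomp1r (A : Bop) : A [*] bid = A. Proof. bop. Qed.
Lemma bcomp0l (A : Bop) : bzero [*] A = bzero. Proof. bop. Qed.
Lemma bcomp0r (A : Bop) : A [*] bzero = bzero. Proof. bop. Qed.
Lemma badd0r (A : Bop) : A [+] bzero = A. Proof. bop. Qed.
Lemma baddC (A B : Bop) : A [+] B = B [+] A. Proof. bop. Qed.
Lemma bcompDl (A B C : Bop) : (A [+] B) [*] C = A [*] C [+] B [*] C. Proof. bop. Qed.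
Lemma bcompDr (A B C : Bop) : A [*] (B [+] C) = A [*] B [+] A [*] C. Proof. bop. Qed.
Lemma bscale_comp_l (c : CC) (A B : Bop) : (c [.] A) [*] B = c [.] (A [*] B). Proof. bop. Qed.
Lemma bscale_comp_r (c : CC) (A B : Bop) : A [*] (c [.] B) = c [.] (A [*] B). Proof. bop. Qed.
Lemma bscale_scale (c d : CC) (A : Bop) : c [.] d [.] A = Cmul c d [.] A. Proof. bop. Qed.
Lemma bscale_1 (A : Bop) : C1 [.] A = A. Proof. bop. Qed.
Lemma bscale_0 (A : Bop) : C0 [.] A = bzero. Proof. bop. Qed.

Lemma bsum_comp_l (n : nat) (A : Bop) (F : nat -> Bop) :
  A [*] bsum n F = bsum n (fun i => A [*] F i).
Proof. apply (gsum_morph badd bzero badd bzero (fun B => A [*] B)); intros; bop. Qed.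

Lemma bsum_comp_r (n : nat) (A : Bop) (F : nat -> Bop) :
  bsum n F [*] A = bsum n (fun i => F i [*] A).
Proof. apply (gsum_morph badd bzero badd bzero (fun B => B [*] A)); intros; bop. Qed.

Lemma bsum_scale (n : nat) (c : CC) (F : nat -> Bop) :
  c [.] bsum n F = bsum n (fun i => c [.] F i).
Proof. apply (gsum_morph badd bzero badd bzero (fun B => c [.] B)); intros; bop. Qed.

Lemma bsum_add (n : nat) (F G : nat -> Bop) :
  bsum n (fun i => F i [+] G i) = bsum n F [+] bsum n G.
Proof. induction n as [|n IH]; simpl; [bop|]. rewrite IH. bop. Qed.

Lemma bsum_sub (n : nat) (F G : nat -> Bop) :
  bsum n (fun i => F i [-] G i) = bsum n F [-] bsum n G.
Proof. induction n as [|n IH]; simpl; [bop|]. rewrite IH. bop. Qed.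

Lemma bsum_zero (n : nat) (F : nat -> Bop) :
  (forall i, (i < n)%nat -> F i = bzero) -> bsum n F = bzero.
Proof. induction n as [|n IH]; intros H; simpl; auto. rewrite IH, H by auto. bop. Qed.

Lemma bsum_swap (n m : nat) (F : nat -> nat -> Bop) :
  bsum n (fun i => bsum m (fun j => F i j)) = bsum m (fun j => bsum n (fun i => F i j)).
Proof.
  induction n as [|n IH]; simpl.
  - symmetry. apply bsum_zero; auto.
  - rewrite IH, bsum_add. reflexivity.
Qed.

Lemma bsum_single (n k : nat) (F : nat -> Bop) :
  (k < n)%nat -> (forall i, (i < n)%nat -> i <> k -> F i = bzero) -> bsum n F = F k.
Proof.
  induction n as [|n IH]; intros Hk H; [lia|]. simpl.
  destruct (Nat.eq_dec k n) as [->|Hn].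
  - rewrite bsum_zero by (intros; apply H; lia). bop.
  - rewrite IH, (H n) by (auto; lia). bop.
Qed.

Lemma bsum_csum (n : nat) (c : nat -> CC) (A : Bop) :
  bsum n (fun i => c i [.] A) = csum n c [.] A.
Proof. symmetry. apply (gsum_morph Cadd C0 badd bzero (fun z => z [.] A)); intros; bop. Qed.

End Operators.

(** * Compact operators *)

Section Compact.
Context {E : exponent}.
Notation p := pexp.

Definition cpt (A : Bop) : Prop :=
  forall eps, 0 < eps -> exists ys : list LP,
    forall x, nrm x <= 1 -> exists y, In y ys /\ nrm (lsub (A x) y) <= eps.

Lemma nrm_normalize (x : LP) (r : R) : 0 < r -> nrm x <= r -> nrm (lscale (RC (/ r)) x) <= 1.
Proof.
  intros Hr Hx. eapply Rle_trans; [apply nrm_scale_le|]. rewrite Cnorm_RC.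
  assert (0 < / r) by (apply Rinv_0_lt_compat; auto).
  rewrite Rabs_pos_eq by lra. apply Rmult_le_reg_l with r; auto.
  rewrite <- Rmult_assoc, Rinv_r; lra.
Qed.

Lemma lscale_RC_inv (x : LP) (r : R) : r <> 0 -> lscale (RC r) (lscale (RC (/ r)) x) = x.
Proof.
  intros Hr. rewrite lscale_lscale, <- RC_mul, Rinv_r by auto. apply lscale_1.
Qed.

Lemma cpt_zero : cpt bzero.
Proof.
  intros eps He. exists [lzero]. intros x _. exists lzero. split; [left; auto|].
  simpl. replace (lsub lzero lzero) with lzero.
  - rewrite nrm_zero. lra.
  - apply LP_ext; intros; bapps; lvs; ring.
Qed.

Lemma cpt_add (A B : Bop) : cpt A -> cpt B -> cpt (A [+] B).
Proof.
  intros HA HB eps He.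
  destruct (HA (eps / 2)) as [ys Hy]; [lra|]. destruct (HB (eps / 2)) as [zs Hz]; [lra|].
  exists (map (fun c => ladd (fst c) (snd c)) (list_prod ys zs)).
  intros x Hx. destruct (Hy x Hx) as (y & Iy & Ny). destruct (Hz x Hx) as (z & Iz & Nz).
  exists (ladd y z). split.
  - apply in_map_iff. exists (y, z). split; auto. apply in_prod; auto.
  - replace (lsub ((A [+] B) x) (ladd y z)) with (ladd (lsub (A x) y) (lsub (B x) z)).
    + eapply Rle_trans; [apply nrm_add|lra].
    + apply LP_ext; intros; bapps; lvs; ring.
Qed.

Lemma cpt_comp_l (A K : Bop) : cpt K -> cpt (A [*] K).
Proof.
  intros HK eps He. destruct (ob_exists A) as (r & Hr & HA).
  destruct (HK (eps / (r + 1))) as [ys Hy].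
  { apply Rmult_lt_0_compat; auto. apply Rinv_0_lt_compat; lra. }
  exists (map A ys). intros x Hx. destruct (Hy x Hx) as (y & Iy & Ny).
  exists (A y). split; [apply in_map; auto|]. simpl. rewrite <- b_sub.
  eapply Rle_trans; [apply HA|].
  apply Rle_trans with ((r + 1) * (eps / (r + 1))); [|right; field; lra].
  apply Rmult_le_compat; try lra. apply nrm_nonneg.
Qed.

Lemma cpt_comp_r (A K : Bop) : cpt K -> cpt (K [*] A).
Proof.
  intros HK eps He. destruct (ob_exists A) as (r0 & Hr0 & HA0).
  set (r := r0 + 1). assert (Hr : 0 < r) by (unfold r; lra).
  assert (HA : forall x, nrm x <= 1 -> nrm (A x) <= r).
  { intros x Hx. eapply Rle_trans; [apply HA0|]. unfold r. pose proof (nrm_nonneg x). nra. }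
  destruct (HK (eps / r)) as [ys Hy].
  { apply Rmult_lt_0_compat; auto. apply Rinv_0_lt_compat; lra. }
  exists (map (lscale (RC r)) ys). intros x Hx.
  destruct (Hy (lscale (RC (/ r)) (A x))) as (y & Iy & Ny).
  { apply nrm_normalize; auto. }
  exists (lscale (RC r) y). split; [apply in_map; auto|].
  replace (lsub ((K [*] A) x) (lscale (RC r) y))
    with (lscale (RC r) (lsub (K (lscale (RC (/ r)) (A x))) y)).
  - eapply Rle_trans; [apply nrm_scale_le|]. rewrite Cnorm_RC, Rabs_pos_eq by lra.
    apply Rle_trans with (r * (eps / r)); [|right; field; lra].
    apply Rmult_le_compat_l; lra.
  - simpl. rewrite b_scale. apply LP_ext; intros; bapps; lvs.
    assert (Er : Cmul (RC r) (RC (/ r)) = C1) by (rewrite <- RC_mul, Rinv_r by lra; reflexivity).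
    transitivity (Cadd (Cmul (Cmul (RC r) (RC (/ r))) (lv (K (A x)) n))
                       (Copp (Cmul (RC r) (lv y n)))); [ring|]. rewrite Er. ring.
Qed.

Lemma cpt_scale (c : CC) (K : Bop) : cpt K -> cpt (c [.] K).
Proof.
  intros HK. replace (c [.] K) with ((c [.] bid) [*] K) by bop. apply cpt_comp_l; auto.
Qed.

Lemma cpt_sub (A B : Bop) : cpt A -> cpt B -> cpt (A [-] B).
Proof. intros HA HB. apply cpt_add; auto. apply cpt_scale; auto. Qed.

Lemma cpt_bsum (n : nat) (F : nat -> Bop) :
  (forall i, (i < n)%nat -> cpt (F i)) -> cpt (bsum n F).
Proof.
  induction n as [|n IH]; intros H; simpl; [apply cpt_zero|]. apply cpt_add; auto.
Qed.

Lemma cpt_limit (A : Bop) :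
  (forall eps, 0 < eps -> exists K, cpt K /\ ob (A [-] K) eps) -> cpt A.
Proof.
  intros H eps He. destruct (H (eps / 2)) as (K & HK & _ & HO); [lra|].
  destruct (HK (eps / 2)) as [ys Hy]; [lra|]. exists ys. intros x Hx.
  destruct (Hy x Hx) as (y & Iy & Ny). exists y. split; auto.
  replace (lsub (A x) y) with (ladd ((A [-] K) x) (lsub (K x) y)).
  - eapply Rle_trans; [apply nrm_add|]. specialize (HO x). nra.
  - apply LP_ext; intros; bapps; lvs; ring.
Qed.

Lemma ob_of_unit (A : Bop) (r : R) : 0 <= r -> (forall x, nrm x <= 1 -> nrm (A x) <= r) -> ob A r.
Proof.
  intros Hr H1. split; auto. intros x.
  destruct (Req_dec (nrm x) 0) as [E0|E0].
  - apply nrm_eq0 in E0. subst. rewrite !b_zero, nrm_zero. lra.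
  - pose proof (nrm_nonneg x).
    rewrite <- (lscale_RC_inv x (nrm x)) at 1 by auto. rewrite !b_scale.
    eapply Rle_trans; [apply nrm_scale_le|]. rewrite Cnorm_RC, Rabs_pos_eq by auto.
    rewrite Rmult_comm. apply Rmult_le_compat_r; auto. rewrite <- !b_scale.
    apply H1. apply nrm_normalize; lra.
Qed.

(** Equality in the Calkin algebra. The instances below make it a congruence, so that calculations
    there become rewriting of lifts. *)
Definition ceq (A B : Bop) : Prop := cpt (A [-] B).

Lemma ceq_refl (A : Bop) : ceq A A.
Proof. unfold ceq. replace (A [-] A) with bzero by bop. apply cpt_zero. Qed.

Lemma ceq_sym (A B : Bop) : ceq A B -> ceq B A.
Proof.
  unfold ceq. intros H. replace (B [-] A) with (Copp C1 [.] (A [-] B)) by bop.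
  apply cpt_scale; auto.
Qed.

Lemma ceq_trans (A B C : Bop) : ceq A B -> ceq B C -> ceq A C.
Proof.
  unfold ceq. intros H1 H2. replace (A [-] C) with ((A [-] B) [+] (B [-] C)) by bop.
  apply cpt_add; auto.
Qed.

Lemma ceq_eq (A B : Bop) : A = B -> ceq A B.
Proof. intros ->. apply ceq_refl. Qed.

#[global] Instance ceq_equiv : Equivalence ceq.
Proof. split; [exact ceq_refl|exact ceq_sym|exact ceq_trans]. Qed.

#[global] Instance badd_ceq : Proper (ceq ==> ceq ==> ceq) badd.
Proof.
  intros A A' HA B B' HB. unfold ceq in *.
  replace (A [+] B [-] (A' [+] B')) with ((A [-] A') [+] (B [-] B')) by bop.
  apply cpt_add; auto.
Qed.

#[global] Instance bscale_ceq (c : CC) : Proper (ceq ==> ceq) (bscale c).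
Proof.
  intros A A' HA. unfold ceq in *.
  replace (c [.] A [-] c [.] A') with (c [.] (A [-] A')) by bop. apply cpt_scale; auto.
Qed.

#[global] Instance bsub_ceq : Proper (ceq ==> ceq ==> ceq) bsub.
Proof. intros A A' HA B B' HB. unfold bsub. rewrite HA, HB. reflexivity. Qed.

#[global] Instance bcomp_ceq : Proper (ceq ==> ceq ==> ceq) bcomp.
Proof.
  intros A A' HA B B' HB. unfold ceq in *.
  replace (A [*] B [-] A' [*] B') with ((A [-] A') [*] B [+] A' [*] (B [-] B')) by bop.
  apply cpt_add; [apply cpt_comp_r|apply cpt_comp_l]; auto.
Qed.

#[global] Instance cpt_ceq : Proper (ceq ==> iff) cpt.
Proof.
  assert (H : forall A B, ceq A B -> cpt A -> cpt B).
  { intros A B H HA. replace B with (A [-] (A [-] B)) by bop. apply cpt_sub; auto. }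
  intros A B HAB. split; apply H; auto. symmetry; auto.
Qed.

Lemma ceq_bsum (n : nat) (F G : nat -> Bop) :
  (forall i, (i < n)%nat -> ceq (F i) (G i)) -> ceq (bsum n F) (bsum n G).
Proof.
  induction n as [|n IH]; intros H; simpl; [reflexivity|].
  rewrite IH, H by auto. reflexivity.
Qed.

Lemma ceq_zero (A : Bop) : ceq A bzero <-> cpt A.
Proof. unfold ceq. replace (A [-] bzero) with A by bop. reflexivity. Qed.

(** * Diagonal operators *)

Definition clip (r : R) : R := Rmax 0 (Rmin 1 r).

Lemma clip_range (r : R) : 0 <= clip r <= 1.
Proof. unfold clip, Rmax, Rmin. repeat destruct Rle_dec; lra. Qed.

Lemma clip_id (r : R) : 0 <= r <= 1 -> clip r = r.
Proof. unfold clip, Rmax, Rmin. repeat destruct Rle_dec; lra. Qed.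

(* The weight is truncated to [0, 1], so that every weight gives a contraction. *)
Definition diag (w : nat -> R) : Bop := mkB (fun x t => Cmul (RC (clip (w t))) (lv x t)).

Lemma diag_good (w : nat -> R) : good_map (fun x t => Cmul (RC (clip (w t))) (lv x t)) /\
  forall x, lp_norm_le p (fun t => Cmul (RC (clip (w t))) (lv x t)) (1 * nrm x).
Proof.
  assert (H : forall x, lp_norm_le p (fun t => Cmul (RC (clip (w t))) (lv x t)) (1 * nrm x)).
  { intros x. rewrite Rmult_1_l. eapply lp_norm_le_dom; [|apply nrm_self]. intros n. simpl.
    rewrite Cnorm_mul, Cnorm_RC. pose proof (clip_range (w n)).
    rewrite Rabs_pos_eq by lra. pose proof (Cnorm_nonneg (lv x n)). nra. }
  split; auto. apply good_map_intro with 1; auto; try lra; intros; lvs; ring.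
Qed.

Lemma diag_app (w : nat -> R) (x : LP) (t : nat) :
  lv (diag w x) t = Cmul (RC (clip (w t))) (lv x t).
Proof. unfold diag. rewrite mkB_app; auto. apply diag_good. Qed.

Lemma ob_diag (w : nat -> R) : ob (diag w) 1.
Proof. apply ob_mkB; try apply diag_good. lra. Qed.

Lemma diag_nrm (w : nat -> R) (x : LP) : nrm (diag w x) <= nrm x.
Proof. pose proof (proj2 (ob_diag w) x). lra. Qed.

Lemma diag_comp (w w' w'' : nat -> R) :
  (forall t, clip (w t) * clip (w' t) = clip (w'' t)) -> diag w [*] diag w' = diag w''.
Proof.
  intros H. apply Bop_ext. intros x. apply LP_ext. intros t. simpl.
  rewrite !diag_app, <- H, RC_mul. ring.
Qed.

Lemma diag_comm (w w' : nat -> R) : diag w [*] diag w' = diag w' [*] diag w.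
Proof.
  apply Bop_ext. intros x. apply LP_ext. intros t. bapps. rewrite !diag_app. ring.
Qed.

Definition low (m t : nat) : R := if (t <? m)%nat then 1 else 0.
Definition Pm (m : nat) : Bop := diag (low m).
Definition Qm (m : nat) : Bop := diag (fun t => 1 - low m t).

Lemma low_clip (m t : nat) : clip (low m t) = low m t.
Proof. apply clip_id. unfold low. destruct (t <? m)%nat; lra. Qed.

Lemma low_clip' (m t : nat) : clip (1 - low m t) = 1 - low m t.
Proof. apply clip_id. unfold low. destruct (t <? m)%nat; lra. Qed.

Lemma Pm_app (m : nat) (x : LP) (t : nat) :
  lv (Pm m x) t = if (t <? m)%nat then lv x t else C0.
Proof.
  unfold Pm. rewrite diag_app, low_clip. unfold low. destruct (t <? m)%nat.
  - rewrite RC_1; ring.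
  - rewrite RC_0; ring.
Qed.

Lemma Qm_app (m : nat) (x : LP) (t : nat) :
  lv (Qm m x) t = if (t <? m)%nat then C0 else lv x t.
Proof.
  unfold Qm. rewrite diag_app, low_clip'. unfold low. destruct (t <? m)%nat.
  - rewrite Rminus_diag, RC_0; ring.
  - rewrite Rminus_0_r, RC_1; ring.
Qed.

Lemma PQ_id (m : nat) : Pm m [+] Qm m = bid.
Proof.
  apply Bop_ext. intros x. apply LP_ext. intros t. bapps. rewrite lv_add, Pm_app, Qm_app.
  destruct (t <? m)%nat; ring.
Qed.

Lemma Qm_eq (m : nat) : Qm m = bid [-] Pm m.
Proof. rewrite <- (PQ_id m). bop. Qed.

Lemma Qm_tail (x : LP) (eps : R) : 0 < eps -> exists m0, forall m, (m0 <= m)%nat -> nrm (Qm m x) <= eps.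
Proof.
  intros He. set (a := fun n => rpow (Cnorm (lv x n)) p).
  assert (Ha : forall n, 0 <= a n) by (intros; apply rpow_nonneg).
  (* Cauchy criterion: otherwise every partial sum could be exceeded by more than [eps^p], and
     enough repetitions would beat the bound by the norm of [x]. *)
  assert (Hc : exists m0, forall N, rsum N a <= rsum m0 a + rpow eps p).
  { apply NNPP. intros Hn.
    assert (H : forall k, exists N, INR k * rpow eps p <= rsum N a).
    { induction k as [|k [N HN]].
      - exists 0%nat. simpl. lra.
      - apply NNPP. intros Hk. apply Hn. exists N. intros N'.
        apply Rnot_lt_le. intros Hl. apply Hk. exists N'. rewrite S_INR. lra. }
    pose proof (rpow_pos eps p He) as Hp.
    destruct (INR_unbounded (rpow (nrm x) p / rpow eps p)) as [k Hk].
    destruct (H k) as [N HN]. pose proof (nrm_pow_le x N) as HX. fold a in HX.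
    assert (rpow (nrm x) p < INR k * rpow eps p).
    { apply Rmult_lt_reg_r with (/ rpow eps p); [apply Rinv_0_lt_compat; auto|].
      rewrite Rmult_assoc, Rinv_r by lra. unfold Rdiv in Hk. lra. }
    lra. }
  destruct Hc as [m0 Hm0]. exists m0. intros m Hm.
  apply nrm_le_of_sums; [lra|]. intros N.
  apply Rle_trans with (rsum (m0 + N) a - rsum m0 a); [|specialize (Hm0 (m0 + N)%nat); lra].
  rewrite rsum_split.
  destruct (le_lt_dec N m0) as [HN|HN].
  - rewrite (gsum_ext _ _ N _ (fun _ => 0)), rsum_const.
    + assert (0 <= rsum N (fun i => a (m0 + i)%nat)) by (apply rsum_nonneg; auto). lra.
    + intros i Hi. rewrite Qm_app. destruct (Nat.ltb_spec i m); [|lia].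
      rewrite Cnorm_C0, rpow_0; auto.
  - replace N with (m0 + (N - m0))%nat at 1 by lia. rewrite rsum_split.
    rewrite (gsum_ext _ _ m0 _ (fun _ => 0)), rsum_const.
    + assert (rsum (N - m0) (fun i => rpow (Cnorm (lv (Qm m x) (m0 + i)%nat)) p)
              <= rsum N (fun i => a (m0 + i)%nat)); [|lra].
      eapply Rle_trans; [|apply (rsum_mono (N - m0) N); [lia|auto]].
      apply rsum_le. intros i _. apply rpow_le; [apply pexp_nonneg|].
      split; [apply Cnorm_nonneg|]. rewrite Qm_app. destruct (_ <? m)%nat; [|lra].
      rewrite Cnorm_C0. apply Cnorm_nonneg.
    + intros i Hi. rewrite Qm_app. destruct (Nat.ltb_spec i m); [|lia].
      rewrite Cnorm_C0, rpow_0; auto.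
Qed.

Lemma R_grid (eps : R) : 0 < eps ->
  exists l : list R, forall t, Rabs t <= 1 -> exists s, In s l /\ Rabs (t - s) <= eps.
Proof.
  intros He. destruct (INR_unbounded (2 / eps)) as [n Hn].
  assert (Hn' : 2 < INR n * eps).
  { apply Rmult_lt_reg_r with (/ eps); [apply Rinv_0_lt_compat; auto|].
    rewrite Rmult_assoc, Rinv_r by lra. unfold Rdiv in Hn. lra. }
  exists (map (fun k => -1 + INR k * eps) (seq 0 (S n))). intros t Ht.
  assert (Ht' : -1 <= t <= 1) by (unfold Rabs in Ht; destruct (Rcase_abs t); lra).
  assert (H : forall k, t <= -1 + INR k * eps ->
     exists j, (j <= k)%nat /\ Rabs (t - (-1 + INR j * eps)) <= eps).
  { induction k as [|k IH]; intros Hk.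
    - exists 0%nat. split; auto. simpl in *. rewrite Rabs_pos_eq; lra.
    - destruct (Rle_dec t (-1 + INR k * eps)) as [H|H].
      + destruct (IH H) as (j & Hj & Hd). exists j; auto.
      + exists k. split; auto. rewrite S_INR in Hk. rewrite Rabs_pos_eq; lra. }
  destruct (H n) as (j & Hj & Hd); [lra|].
  exists (-1 + INR j * eps). split; auto. apply in_map_iff. exists j. split; auto.
  apply in_seq. lia.
Qed.

Lemma C_grid (eps : R) : 0 < eps ->
  exists l : list CC, forall z, Cnorm z <= 1 -> exists s, In s l /\ Cnorm (Cadd z (Copp s)) <= eps.
Proof.
  intros He. destruct (R_grid (eps / 2)) as [l Hl]; [lra|].
  exists (list_prod l l). intros [a b] Hz.
  pose proof (Cnorm_fst (a, b)). pose proof (Cnorm_snd (a, b)). simpl in *.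
  destruct (Hl a) as (s & Is & Hs); [lra|]. destruct (Hl b) as (t & It & Ht); [lra|].
  exists (s, t). split; [apply in_prod; auto|].
  eapply Rle_trans; [apply Cnorm_le_parts|]. unfold Cadd, Copp; simpl. unfold Rminus in *. lra.
Qed.

Lemma delta_norm_le (m : nat) : lp_norm_le p (fun t => if (t =? m)%nat then C1 else C0) 1.
Proof.
  apply lp_norm_le_iff. split; [lra|]. intros N. rewrite rpow_1.
  destruct (le_lt_dec N m) as [H|H].
  - rewrite (gsum_ext _ _ N _ (fun _ => 0)), rsum_const; [lra|].
    intros i Hi. destruct (Nat.eqb_spec i m); [lia|]. rewrite Cnorm_C0, rpow_0; auto.
  - rewrite (rsum_single N m); auto.
    + rewrite Nat.eqb_refl, Cnorm_C1, rpow_1. lra.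
    + intros i Hi Hm. destruct (Nat.eqb_spec i m); [lia|]. rewrite Cnorm_C0, rpow_0; auto.
Qed.

Definition delta (m : nat) : LP := exist _ _ (ex_intro _ 1 (delta_norm_le m)).

Lemma delta_app (m t : nat) : lv (delta m) t = if (t =? m)%nat then C1 else C0.
Proof. reflexivity. Qed.

Lemma nrm_delta (m : nat) : nrm (delta m) = 1.
Proof.
  apply Rle_antisym; [apply nrm_le_iff, delta_norm_le|].
  pose proof (nrm_coord (delta m) m) as H. rewrite delta_app, Nat.eqb_refl, Cnorm_C1 in H. lra.
Qed.

Lemma cpt_Pm (m : nat) : cpt (Pm m).
Proof.
  induction m as [|m IH].
  - replace (Pm 0) with bzero; [apply cpt_zero|]. apply Bop_ext. intros x. apply LP_ext. intros t.
    rewrite Pm_app. reflexivity.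
  (* The increment is the projection onto one coordinate; a grid of the unit disc yields the net for
     its image. *)
  - replace (Pm (S m)) with (Pm m [+] (Pm (S m) [-] Pm m)) by bop.
    apply cpt_add; auto. intros eps He.
    destruct (C_grid eps He) as [l Hl].
    exists (map (fun z => lscale z (delta m)) l). intros x Hx.
    destruct (Hl (lv x m)) as (s & Is & Hs).
    { pose proof (nrm_coord x m). lra. }
    exists (lscale s (delta m)). split; [apply in_map_iff; exists s; auto|].
    replace (lsub ((Pm (S m) [-] Pm m) x) (lscale s (delta m)))
      with (lscale (Cadd (lv x m) (Copp s)) (delta m)).
    + eapply Rle_trans; [apply nrm_scale_le|]. rewrite nrm_delta. lra.
    + apply LP_ext; intros t; bapps; lvs.
      rewrite !Pm_app, delta_app.
      destruct (Nat.ltb_spec t m), (Nat.ltb_spec t (S m)), (Nat.eqb_spec t m); try lia; try ring.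
      subst; ring.
Qed.

(** The projections [Qm m] tend to zero at every vector, hence uniformly on a finite net of the
    image of the ball; being contractions, they preserve the error of the net. *)
Lemma cpt_tail_l (K : Bop) (eps : R) : cpt K -> 0 < eps ->
  exists m0, forall m, (m0 <= m)%nat -> ob (Qm m [*] K) eps.
Proof.
  intros HK He. destruct (HK (eps / 2)) as [ys Hy]; [lra|].
  assert (Hm : exists m0, forall y, In y ys -> forall m, (m0 <= m)%nat -> nrm (Qm m y) <= eps / 2).
  { clear Hy. induction ys as [|y ys [m1 H1]].
    - exists 0%nat. intros y [].
    - destruct (Qm_tail y (eps / 2)) as [m2 H2]; [lra|].
      exists (Nat.max m1 m2). intros z [<-|Hz] m Hm; [apply H2|apply H1; auto]; lia. }
  destruct Hm as [m0 Hm]. exists m0. intros m Hmm.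
  assert (H1 : forall x, nrm x <= 1 -> nrm (Qm m (K x)) <= eps).
  { intros x Hx. destruct (Hy x Hx) as (y & Iy & Ny).
    rewrite <- (ladd_lsub (K x) y), b_add. eapply Rle_trans; [apply nrm_add|].
    pose proof (Hm y Iy m Hmm). pose proof (diag_nrm (fun t => 1 - low m t) (lsub (K x) y)).
    unfold Qm at 2. lra. }
  apply ob_of_unit; [lra|exact H1].
Qed.

End Compact.

(** * Tails of compact operators *)

Section Tails.
Context {E : exponent}.
Notation p := pexp.

Lemma nrm_pow_disjoint_le (v u : LP) : (forall t, lv v t = C0 \/ lv u t = C0) ->
  rpow (nrm (ladd v u)) p <= rpow (nrm v) p + rpow (nrm u) p.
Proof.
  intros H. apply nrm_pow_le_of_sums. intros N.
  apply Rle_trans with (rsum N (fun t => rpow (Cnorm (lv v t)) p) + rsum N (fun t => rpow (Cnorm (lv u t)) p)).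
  - rewrite <- rsum_plus. apply rsum_le. intros t _. rewrite lv_add.
    destruct (H t) as [Ez|Ez]; rewrite Ez, Cnorm_C0, rpow_0.
    + replace (Cadd C0 (lv u t)) with (lv u t) by ring. lra.
    + replace (Cadd (lv v t) C0) with (lv v t) by ring. lra.
  - apply Rplus_le_compat; apply nrm_pow_le.
Qed.

Lemma nrm_pow_disjoint_ge (v u : LP) : (forall t, lv v t = C0 \/ lv u t = C0) ->
  rpow (nrm v) p + rpow (nrm u) p <= rpow (nrm (ladd v u)) p.
Proof.
  intros H. set (S := rpow (nrm (ladd v u)) p).
  assert (HS : forall N, rsum N (fun t => rpow (Cnorm (lv v t)) p)
                         + rsum N (fun t => rpow (Cnorm (lv u t)) p) <= S).
  { intros N. rewrite <- rsum_plus. eapply Rle_trans; [|apply (nrm_pow_le (ladd v u) N)].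
    apply rsum_le. intros t _. rewrite lv_add.
    destruct (H t) as [Ez|Ez]; rewrite Ez, Cnorm_C0, rpow_0.
    + replace (Cadd C0 (lv u t)) with (lv u t) by ring. lra.
    + replace (Cadd (lv v t) C0) with (lv v t) by ring. lra. }
  (* The two norms are suprema over separate truncations [N1] and [N2], taken one after the other;
     the truncation at [N1 + N2] dominates both. *)
  assert (rpow (nrm v) p <= S - rpow (nrm u) p); [|lra].
  apply nrm_pow_le_of_sums. intros N1.
  assert (rpow (nrm u) p <= S - rsum N1 (fun t => rpow (Cnorm (lv v t)) p)); [|lra].
  apply nrm_pow_le_of_sums. intros N2.
  specialize (HS (N1 + N2)%nat).
  pose proof (rsum_mono N1 (N1 + N2) (fun t => rpow (Cnorm (lv v t)) p) ltac:(lia)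
    ltac:(intros; apply rpow_nonneg)).
  pose proof (rsum_mono N2 (N1 + N2) (fun t => rpow (Cnorm (lv u t)) p) ltac:(lia)
    ltac:(intros; apply rpow_nonneg)). lra.
Qed.

(** If every member failed from some index on, then beyond the largest of these indices no member
    would be left, because [Q] is inherited by smaller indices. *)
Lemma list_pigeonhole {A : Type} (l : list A) (Q : A -> nat -> Prop) :
  (forall y m m', (m <= m')%nat -> Q y m' -> Q y m) ->
  (forall m, exists y, In y l /\ Q y m) -> exists y, In y l /\ forall m, Q y m.
Proof.
  intros Hmono. induction l as [|y l IH]; intros H.
  - destruct (H 0%nat) as (y & [] & _).
  - destruct (classic (forall m, Q y m)) as [Hy|Hy]; [exists y; split; auto; left; auto|].
    apply not_all_ex_not in Hy. destruct Hy as [m0 Hm0].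
    destruct IH as (z & Iz & Hz); [|exists z; split; auto; right; auto].
    intros m. destruct (H (Nat.max m m0)) as (z & [<-|Iz] & Hz).
    + exfalso. apply Hm0. apply Hmono with (Nat.max m m0); auto. lia.
    + exists z. split; auto. apply Hmono with (Nat.max m m0); auto. lia.
Qed.

Lemma Qm_comp (m m' : nat) : (m <= m')%nat -> Qm m [*] Qm m' = Qm m'.
Proof.
  intros H. apply Bop_ext; intros x; apply LP_ext; intros t. bapps. rewrite !Qm_app.
  destruct (Nat.ltb_spec t m), (Nat.ltb_spec t m'); auto; lia.
Qed.

Lemma Pm_comp (m m' : nat) : (m <= m')%nat -> Pm m' [*] Pm m = Pm m.
Proof.
  intros H. apply Bop_ext; intros x; apply LP_ext; intros t. bapps. rewrite !Pm_app.
  destruct (Nat.ltb_spec t m), (Nat.ltb_spec t m'); auto; lia.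
Qed.

(* Gliding hump: disjoint normalized humps whose images cluster at some [y <> 0] would
   add up to vectors of norm at most [N^(1/p)] with images of norm at least [c N]. *)
Lemma cpt_tail_r (K : Bop) (eps : R) : cpt K -> 0 < eps ->
  exists m0, forall m, (m0 <= m)%nat -> ob (K [*] Qm m) eps.
Proof.
  intros HK He.
  assert (Hm : exists m0, ob (K [*] Qm m0) eps).
  2:{ destruct Hm as [m0 Hm0]. exists m0. intros m Hm.
      rewrite <- (Qm_comp m0 m Hm), <- bcompA, <- (Rmult_1_r eps).
      apply ob_comp; auto. apply ob_diag. }
  apply NNPP. intros Hn.
  destruct (ob_exists K) as (r & Hr & HKr).
  assert (Hump : forall m, exists u M, nrm u <= 1 /\ (forall t, (t < m)%nat -> lv u t = C0) /\
     (forall t, (M <= t)%nat -> lv u t = C0) /\ eps < nrm (K u)).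
  { intros m. assert (Hx : exists x, nrm x <= 1 /\ eps < nrm (K (Qm m x))).
    { apply NNPP. intros Hx. apply Hn. exists m. apply ob_of_unit; [lra|]. intros x Nx.
      apply Rnot_lt_le. intros Hl. apply Hx. exists x. auto. }
    (* The strict excess [sl] over [eps] leaves room to cut the hump down to finite support: the
       removed tail costs at most [sl / 2] after [K]. *)
    destruct Hx as (x & Nx & Hx). set (sl := nrm (K (Qm m x)) - eps).
    destruct (Qm_tail (Qm m x) (sl / (2 * (r + 1)))) as [M HM].
    { apply Rmult_lt_0_compat; [unfold sl; lra|apply Rinv_0_lt_compat; lra]. }
    exists (Pm M (Qm m x)), M. repeat split.
    - eapply Rle_trans; [apply diag_nrm|]. eapply Rle_trans; [apply diag_nrm|]. auto.
    - intros t Ht. rewrite Pm_app, Qm_app. destruct (Nat.ltb_spec t m); [|lia].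
      destruct (t <? M)%nat; auto.
    - intros t Ht. rewrite Pm_app. destruct (Nat.ltb_spec t M); [lia|auto].
    - specialize (HM M (le_n M)).
      assert (Ex : K (Qm m x) = ladd (K (Pm M (Qm m x))) (K (Qm M (Qm m x)))).
      { rewrite <- b_add. f_equal.
        change (Qm m x = (Pm M [+] Qm M) (Qm m x)). rewrite PQ_id. reflexivity. }
      pose proof (nrm_add (K (Pm M (Qm m x))) (K (Qm M (Qm m x)))) as Ht. rewrite <- Ex in Ht.
      pose proof (HKr (Qm M (Qm m x))) as HQ.
      assert (r * nrm (Qm M (Qm m x)) <= sl / 2).
      { apply Rle_trans with ((r + 1) * (sl / (2 * (r + 1)))); [|right; field; lra].
        apply Rmult_le_compat; try lra. apply nrm_nonneg. }
      unfold sl in *. lra. }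
  (* A net of width [eps / 4] gives a limit point [y] of norm at least [3 eps / 4], so the image of
     a sum of [N] humps keeps norm at least [N (3/4 - 1/4) eps]. *)
  destruct (HK (eps / 4)) as [ys Hy]; [lra|].
  destruct (list_pigeonhole ys (fun y m => exists u M, nrm u <= 1 /\
     (forall t, (t < m)%nat -> lv u t = C0) /\
     (forall t, (M <= t)%nat -> lv u t = C0) /\ eps < nrm (K u) /\ nrm (lsub (K u) y) <= eps / 4))
    as (y & Iy & Hyy).
  { intros y m m' Hm (u & M & H1 & H2 & H3 & H4). exists u, M. repeat split; try tauto.
    intros t Ht. apply H2. lia. }
  { intros m. destruct (Hump m) as (u & M & H1 & H2 & H3 & H4).
    destruct (Hy u H1) as (y & Iy & Ny). exists y. split; auto. exists u, M. auto. }
  assert (Ny : 3 * eps / 4 <= nrm y).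
  { destruct (Hyy 0%nat) as (u & M & _ & _ & _ & H4 & H5).
    pose proof (nrm_triangle (K u) y). lra. }
  assert (Hb : forall N m, exists v M, (forall t, (t < m)%nat -> lv v t = C0) /\
     (forall t, (M <= t)%nat -> lv v t = C0) /\ rpow (nrm v) p <= INR N /\
     nrm (lsub (K v) (lscale (RC (INR N)) y)) <= INR N * (eps / 4)).
  { induction N as [|N IH]; intros m.
    - exists lzero, 0%nat. repeat split; auto.
      + rewrite nrm_zero, rpow_0. simpl; lra.
      + rewrite b_zero. replace (lsub lzero (lscale (RC (INR 0)) y)) with lzero.
        * rewrite nrm_zero. simpl; lra.
        * apply LP_ext; intros. unfold lsub. lvs. simpl INR. rewrite RC_0. ring.
    - destruct (IH m) as (v & M & V1 & V2 & V3 & V4).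
      destruct (Hyy (Nat.max m M)) as (u & M' & U1 & U2 & U3 & U4 & U5).
      exists (ladd v u), (Nat.max M M'). repeat split.
      + intros t Ht. rewrite lv_add, V1, U2 by lia. ring.
      + intros t Ht. rewrite lv_add, V2, U3 by lia. ring.
      + rewrite S_INR. eapply Rle_trans; [apply nrm_pow_disjoint_le|].
        * intros t. destruct (le_lt_dec M t); [left; auto|right; apply U2; lia].
        * assert (rpow (nrm u) p <= 1); [|lra]. rewrite <- (rpow_1 p).
          apply rpow_le; [apply pexp_nonneg|]. split; [apply nrm_nonneg|auto].
      + replace (lsub (K (ladd v u)) (lscale (RC (INR (S N))) y))
          with (ladd (lsub (K v) (lscale (RC (INR N)) y)) (lsub (K u) y)).
        * eapply Rle_trans; [apply nrm_add|]. rewrite S_INR. lra.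
        * rewrite b_add, S_INR, RC_add, RC_1. apply LP_ext; intros. unfold lsub. lvs. ring. }
  (* The two estimates for the sum of humps give [N^p <= B N]. As [p > 1], this fails once
     [N^(p - 1)] exceeds [B]. *)
  set (B := rpow (2 * r / eps) p).
  destruct (INR_unbounded (rpow B (/ (p - 1)) + 1)) as [N HN].
  pose proof (rpow_nonneg B (/ (p - 1))) as HB.
  destruct (Hb N 0%nat) as (v & M & _ & _ & V3 & V4).
  assert (HNp : 0 < INR N) by lra.
  pose proof pexp_gt1 as Hp.
  assert (H1 : INR N * eps / 2 <= nrm (K v)).
  { pose proof (nrm_triangle (lscale (RC (INR N)) y) (K v)) as T1.
    assert (T2 : nrm (lsub (lscale (RC (INR N)) y) (K v)) <= INR N * (eps / 4)).
    { eapply Rle_trans; [|apply V4]. apply nrm_dom. intros t. unfold lsub. lvs.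
      rewrite <- (Cnorm_opp (Cadd (Cmul (RC (INR N)) (lv y t)) _)). right. f_equal. ring. }
    assert (T3 : INR N * nrm y <= nrm (lscale (RC (INR N)) y)).
    { rewrite <- (lscale_1 y) at 1.
      replace C1 with (Cmul (RC (/ INR N)) (RC (INR N))) by (rewrite <- RC_mul, Rinv_l; [reflexivity|lra]).
      rewrite <- lscale_lscale.
      pose proof (nrm_scale_le (RC (/ INR N)) (lscale (RC (INR N)) y)) as T.
      rewrite Cnorm_RC, Rabs_pos_eq in T by (left; apply Rinv_0_lt_compat; auto).
      apply Rmult_le_compat_l with (r := INR N) in T; [|lra].
      rewrite <- Rmult_assoc, Rinv_r in T; lra. }
    nra. }
  assert (H2 : INR N * eps / 2 <= r * nrm v) by (eapply Rle_trans; [apply H1|apply HKr]).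
  assert (H3 : rpow (INR N) p <= B * INR N).
  { apply Rle_trans with (B * rpow (nrm v) p).
    - unfold B. rewrite <- rpow_mult; [|apply Rmult_le_pos; [lra|left; apply Rinv_0_lt_compat; lra]|apply nrm_nonneg].
      apply rpow_le; [lra|]. split; [lra|].
      apply Rmult_le_reg_r with (eps / 2); [lra|].
      replace (2 * r / eps * nrm v * (eps / 2)) with (r * nrm v) by (field; lra). lra.
    - apply Rmult_le_compat_l; [apply rpow_nonneg|auto]. }
  replace p with (1 + (p - 1)) in H3 by ring.
  rewrite rpow_plus, rpow_exp1 in H3 by lra.
  assert (H4 : rpow (INR N) (p - 1) <= B).
  { apply Rmult_le_reg_l with (INR N); auto. lra. }
  rewrite <- (rpow_inv' B (p - 1)) in H4; [|lra|apply rpow_nonneg].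
  apply rpow_le_inv in H4; lra.
Qed.

(** * Block decompositions and quasicentral cutoffs *)

Definition Blk (ms : nat -> nat) (b : nat) : Bop := Pm (ms (S b)) [*] Qm (ms b).
Arguments Blk : simpl never.

Lemma Blk_app (ms : nat -> nat) (b : nat) (x : LP) (t : nat) :
  lv (Blk ms b x) t = if andb (ms b <=? t)%nat (t <? ms (S b))%nat then lv x t else C0.
Proof.
  unfold Blk. bapps. rewrite Pm_app, Qm_app.
  destruct (Nat.ltb_spec t (ms (S b))), (Nat.ltb_spec t (ms b)), (Nat.leb_spec (ms b) t); simpl; auto; lia.
Qed.

Lemma ob_Blk (ms : nat -> nat) (b : nat) : ob (Blk ms b) 1.
Proof. rewrite <- (Rmult_1_r 1). apply ob_comp; apply ob_diag. Qed.

Section Blocks.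
Variable ms : nat -> nat.
Hypothesis ms_incr : forall b, (ms b <= ms (S b))%nat.

Lemma Blk_sum_ge (N : nat) (x : LP) :
  rsum N (fun b => rpow (nrm (Blk ms b x)) p) <= rpow (nrm (Pm (ms N) x)) p.
Proof.
  induction N as [|N IH]; simpl; [apply rpow_nonneg|].
  replace (Pm (ms (S N)) x) with (ladd (Pm (ms N) x) (Blk ms N x)).
  - eapply Rle_trans; [apply Rplus_le_compat_r, IH|]. apply nrm_pow_disjoint_ge.
    intros t. rewrite Pm_app, Blk_app.
    destruct (Nat.ltb_spec t (ms N)), (Nat.leb_spec (ms N) t); simpl; auto; lia.
  - apply LP_ext; intros t. rewrite lv_add, !Pm_app, Blk_app. specialize (ms_incr N).
    destruct (Nat.ltb_spec t (ms N)), (Nat.leb_spec (ms N) t), (Nat.ltb_spec t (ms (S N)));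
      simpl; try lia; ring.
Qed.

Lemma Blk_sum_support (N : nat) (z : nat -> LP) (t : nat) : (ms N <= t)%nat ->
  lv (gsum ladd lzero N (fun b => Blk ms b (z b))) t = C0.
Proof.
  induction N as [|N IH]; intros Ht; auto.
  change (lv (ladd (gsum ladd lzero N (fun b => Blk ms b (z b))) (Blk ms N (z N))) t = C0).
  rewrite lv_add, IH, Blk_app.
  - destruct (Nat.ltb_spec t (ms (S N))); [lia|]. rewrite Bool.andb_false_r. ring.
  - specialize (ms_incr N). lia.
Qed.

Lemma Blk_sum_le (N : nat) (z : nat -> LP) :
  rpow (nrm (gsum ladd lzero N (fun b => Blk ms b (z b)))) p
    <= rsum N (fun b => rpow (nrm (Blk ms b (z b))) p).
Proof.
  induction N as [|N IH]; simpl.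
  - rewrite nrm_zero, rpow_0. lra.
  - eapply Rle_trans; [apply nrm_pow_disjoint_le|apply Rplus_le_compat_r, IH].
    intros t. destruct (le_lt_dec (ms N) t).
    + left. apply Blk_sum_support; auto.
    + right. change (lv (Blk ms N (z N)) t = C0). rewrite Blk_app. destruct (Nat.leb_spec (ms N) t); [lia|reflexivity].
Qed.

End Blocks.

(** The pieces have disjoint supports both in the domain and in the range, so their sum is bounded
    by [r] rather than by [N r]. Averaging over [N] therefore gains a factor [N]. *)
Lemma ob_band (ms ms' : nat -> nat) (A : Bop) (r : R) (N : nat) :
  (forall b, (ms b <= ms (S b))%nat) -> (forall b, (ms' b <= ms' (S b))%nat) -> ob A r ->
  ob (bsum N (fun b => Blk ms b [*] (A [*] Blk ms' b))) r.
Proof.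
  intros H H' [Hr HA]. split; auto. intros x. rewrite bsum_app.
  apply rpow_le_inv with p; auto using pexp_pos, nrm_nonneg.
  { apply Rmult_le_pos; auto using nrm_nonneg. }
  change (fun i => (Blk ms i [*] (A [*] Blk ms' i)) x) with (fun i => Blk ms i (A (Blk ms' i x))).
  eapply Rle_trans; [apply (Blk_sum_le ms H N (fun i => A (Blk ms' i x)))|].
  apply Rle_trans with (rsum N (fun b => rpow r p * rpow (nrm (Blk ms' b x)) p)).
  - apply rsum_le. intros b _. rewrite <- rpow_mult by auto using nrm_nonneg.
    apply rpow_le; [apply pexp_nonneg|]. split; [apply nrm_nonneg|].
    eapply Rle_trans; [|apply HA]. pose proof (proj2 (ob_Blk ms b) (A (Blk ms' b x))). lra.
  - rewrite rsum_scal, rpow_mult by auto using nrm_nonneg.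
    apply Rmult_le_compat_l; [apply rpow_nonneg|].
    eapply Rle_trans; [apply (Blk_sum_ge ms' H')|]. apply rpow_le; [apply pexp_nonneg|].
    split; [apply nrm_nonneg|apply diag_nrm].
Qed.

Lemma list_eventually {A : Type} (l : list A) (Q : A -> nat -> Prop) :
  (forall a, In a l -> exists m0, forall m, (m0 <= m)%nat -> Q a m) ->
  exists m0, forall m, (m0 <= m)%nat -> forall a, In a l -> Q a m.
Proof.
  induction l as [|a l IH]; intros H.
  - exists 0%nat. intros m _ a [].
  - destruct (H a) as [m1 H1]; [left; auto|].
    destruct IH as [m2 H2]; [intros b Hb; apply H; right; auto|].
    exists (Nat.max m1 m2). intros m Hm b [<-|Hb]; [apply H1; lia|apply H2; auto; lia].
Qed.

Lemma list_bounded {A : Type} (l : list A) (Q : A -> R -> Prop) :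
  (forall a r s, r <= s -> Q a r -> Q a s) ->
  (forall a, In a l -> exists r, 0 <= r /\ Q a r) ->
  exists r, 0 <= r /\ forall a, In a l -> Q a r.
Proof.
  intros Hm. induction l as [|a l IH]; intros H.
  - exists 0. split; [lra|]. intros a [].
  - destruct (H a) as (r & Hr & H1); [left; auto|].
    destruct IH as (s & Hs & H2); [intros b Hb; apply H; right; auto|].
    exists (r + s). split; [lra|]. intros b [<-|Hb].
    + apply Hm with r; auto. lra.
    + apply Hm with s; auto. lra.
Qed.

Lemma diag_average (ms : nat -> nat) (N : nat) : (0 < N)%nat ->
  diag (fun t => rsum N (fun b => low (ms b) t) / INR N)
  = RC (/ INR N) [.] bsum N (fun b => Pm (ms b)).
Proof.
  intros HN. assert (Hp : 0 < INR N) by (apply lt_0_INR; auto).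
  apply Bop_ext; intros x; apply LP_ext; intros t. bapps. rewrite diag_app, lv_scale, bsum_lv.
  rewrite clip_id.
  - rewrite (gsum_ext _ _ N _ (fun b => Cmul (lv x t) (RC (low (ms b) t)))).
    + rewrite csum_scal, csum_RC. unfold Rdiv. rewrite RC_mul. ring.
    + intros b _. unfold Pm. rewrite diag_app, low_clip. ring.
  - assert (Hl : forall b, 0 <= low (ms b) t <= 1) by (intros; unfold low; destruct (_ <? _)%nat; lra).
    assert (0 <= rsum N (fun b => low (ms b) t)) by (apply rsum_nonneg; intros; apply Hl).
    assert (rsum N (fun b => low (ms b) t) <= INR N).
    { eapply Rle_trans; [apply (rsum_le _ _ (fun _ => 1)); intros; apply Hl|].
      rewrite rsum_const. lra. }
    split.
    + apply Rmult_le_pos; auto. left; apply Rinv_0_lt_compat; auto.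
    + apply Rmult_le_reg_r with (INR N); auto. unfold Rdiv. rewrite Rmult_assoc, Rinv_l; lra.
Qed.

(** With [Q = 1 - P] one has [P A - A P = P A Q - Q A P]. Each corner is split into a part between
    two adjacent blocks, to which [ob_band] applies after summation, and parts that jump over a
    whole block, which are small if the blocks are long. *)
Lemma commutator_Pm (ms : nat -> nat) (b : nat) (A : Bop) :
  (forall b, (ms b <= ms (S b))%nat) ->
  Pm (ms (S b)) [*] A [-] A [*] Pm (ms (S b)) =
  (Blk ms b [*] (A [*] Blk (fun b => ms (S b)) b)
   [+] (Pm (ms b) [*] A [*] Qm (ms (S b)) [*] Pm (ms (S (S b))) [+] Pm (ms (S b)) [*] A [*] Qm (ms (S (S b)))))
  [-] (Blk (fun b => ms (S b)) b [*] (A [*] Blk ms b)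
   [+] (Pm (ms (S (S b))) [*] (Qm (ms (S b)) [*] A [*] Pm (ms b)) [+] Qm (ms (S (S b))) [*] A [*] Pm (ms (S b)))).
Proof.
  intros H. unfold Blk.
  assert (HPQ : forall m m', Qm m [*] Pm m' = Pm m' [*] Qm m) by (intros; apply diag_comm).
  assert (E1 : Qm (ms (S b)) = Pm (ms (S (S b))) [*] Qm (ms (S b)) [+] Qm (ms (S (S b)))).
  { rewrite <- HPQ. pattern (Qm (ms (S (S b)))) at 1. rewrite <- (Qm_comp (ms (S b))) by auto.
    rewrite <- bcompDr, PQ_id, bcomp1r. reflexivity. }
  assert (E2 : Pm (ms (S b)) = Pm (ms (S b)) [*] Qm (ms b) [+] Pm (ms b)).
  { pattern (Pm (ms b)) at 1. rewrite <- (Pm_comp (ms b) (ms (S b))) by auto.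
    rewrite <- bcompDr, (baddC (Qm _)), PQ_id, bcomp1r. reflexivity. }
  assert (L : forall B1 B2 P0 P1 Q1 Q2 : Bop, Q1 = B2 [+] Q2 -> P1 = B1 [+] P0 ->
    P1 [*] A [*] Q1 = B1 [*] (A [*] B2) [+] (P0 [*] (A [*] B2) [+] P1 [*] A [*] Q2)).
  { intros B1 B2 P0 P1 Q1 Q2 -> HP.
    transitivity (P1 [*] (A [*] B2) [+] P1 [*] A [*] Q2); [bop|].
    rewrite HP at 1. bop. }
  assert (L' : forall B1 B2 P0 P1 Q1 Q2 : Bop, Q1 = B2 [+] Q2 -> P1 = B1 [+] P0 ->
    Q1 [*] A [*] P1 = B2 [*] (A [*] B1) [+] (B2 [*] (A [*] P0) [+] Q2 [*] A [*] P1)).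
  { intros B1 B2 P0 P1 Q1 Q2 -> HP.
    transitivity (B2 [*] (A [*] P1) [+] Q2 [*] A [*] P1); [bop|].
    rewrite HP at 1. bop. }
  transitivity (Pm (ms (S b)) [*] A [*] Qm (ms (S b)) [-] Qm (ms (S b)) [*] A [*] Pm (ms (S b))).
  { rewrite Qm_eq. bop. }
  rewrite (L _ _ _ _ _ _ E1 E2), (L' _ _ _ _ _ _ E1 E2).
  rewrite !bcompA, HPQ. reflexivity.
Qed.

(** The weight is the average of [N] coordinate projections with widely spaced ends. The
    adjacent-block parts of the commutators add up to norm at most [2 r] in all, so they contribute
    [2 r / N]; the remaining parts are small one by one. *)
Lemma quasicentral_cutoff (l : list Bop) (m0 : nat) (dl : R) : 0 < dl ->
  exists w : nat -> R, (forall t, 0 <= w t <= 1) /\ (forall t, (t < m0)%nat -> w t = 1) /\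
    (exists s, forall t, (s <= t)%nat -> w t = 0) /\
    forall A, In A l -> ob (diag w [*] A [-] A [*] diag w) dl.
Proof.
  intros Hd.
  destruct (list_bounded l ob) as (r & Hr & HA).
  { intros a r s H. apply ob_mono; auto. }
  { intros a _. destruct (ob_exists a) as (r & H). exists r. split; auto. apply H. }
  (* The error is [2 r / N] from adjacent blocks and four times [dl / 8] from the jumps; this [N]
     makes the former at most [dl / 2]. *)
  destruct (INR_unbounded (4 * (r + 1) / dl)) as [N HN].
  assert (HNp : 0 < INR N).
  { eapply Rlt_trans; [|apply HN]. apply Rmult_lt_0_compat; [lra|apply Rinv_0_lt_compat; auto]. }
  assert (HN0 : (0 < N)%nat) by (apply INR_lt; auto).
  assert (HNr : 2 * r / INR N <= dl / 2).
  { apply Rmult_le_reg_r with (INR N); auto. unfold Rdiv at 1. rewrite Rmult_assoc, Rinv_l by lra.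
    assert (4 * (r + 1) < INR N * dl); [|lra].
    apply Rmult_lt_reg_r with (/ dl); [apply Rinv_0_lt_compat; auto|].
    rewrite (Rmult_assoc (INR N)), Rinv_r by lra. unfold Rdiv in HN. lra. }
  (* Since [Pm m [*] A] and [A [*] Pm m] are compact, [A] hardly connects the coordinates below [m]
     with those beyond a distant [m'], in either direction. *)
  assert (Hnx : forall m, exists m', (m <= m')%nat /\ forall A, In A l ->
    ob (Pm m [*] A [*] Qm m') (dl / 8) /\ ob (Qm m' [*] A [*] Pm m) (dl / 8)).
  { intros m. destruct (list_eventually l (fun A m' =>
      ob (Pm m [*] A [*] Qm m') (dl / 8) /\ ob (Qm m' [*] A [*] Pm m) (dl / 8))) as [m' Hm'].
    - intros A _.
      destruct (cpt_tail_r (Pm m [*] A) (dl / 8)) as [m1 H1]; [apply cpt_comp_r, cpt_Pm|lra|].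
      destruct (cpt_tail_l (A [*] Pm m) (dl / 8)) as [m2 H2]; [apply cpt_comp_l, cpt_Pm|lra|].
      exists (Nat.max m1 m2). intros m3 H3. split; [apply H1; lia|]. rewrite bcompA. apply H2; lia.
    - exists (Nat.max m m'). split; [lia|]. apply Hm'. lia. }
  set (nx := fun m => proj1_sig (constructive_indefinite_description _ (Hnx m))).
  assert (Hnx' : forall m, (m <= nx m)%nat /\ forall A, In A l ->
    ob (Pm m [*] A [*] Qm (nx m)) (dl / 8) /\ ob (Qm (nx m) [*] A [*] Pm m) (dl / 8)).
  { intros m. unfold nx. destruct constructive_indefinite_description. auto. }
  set (ms := fix ms b := match b with O => m0 | S b => nx (ms b) end).
  assert (Hms : forall b, (ms b <= ms (S b))%nat) by (intros; apply Hnx').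
  assert (Hms0 : forall b, (m0 <= ms b)%nat).
  { induction b as [|b IH]; auto. specialize (Hms b). lia. }
  assert (HmsN : forall b c, (b <= c)%nat -> (ms b <= ms c)%nat).
  { intros b c Hbc. induction Hbc; auto. specialize (Hms m). lia. }
  exists (fun t => rsum N (fun b => low (ms (S b)) t) / INR N).
  split; [intros t; split|split; [|split; [|intros A IA]]].
  - apply Rmult_le_pos; [|left; apply Rinv_0_lt_compat; auto].
    apply rsum_nonneg. intros; unfold low; destruct (_ <? _)%nat; lra.
  - apply Rmult_le_reg_r with (INR N); auto. unfold Rdiv. rewrite Rmult_assoc, Rinv_l by lra.
    apply Rle_trans with (rsum N (fun _ => 1)); [|rewrite rsum_const; lra].
    rewrite Rmult_1_r. apply rsum_le. intros; unfold low; destruct (_ <? _)%nat; lra.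
  - intros t Ht. rewrite (gsum_ext _ _ N _ (fun _ => 1)), rsum_const.
    + field. lra.
    + intros b _. unfold low. specialize (Hms0 (S b)). destruct (Nat.ltb_spec t (ms (S b))); [auto|lia].
  - exists (ms (S N)). intros t Ht. rewrite (gsum_ext _ _ N _ (fun _ => 0)), rsum_const.
    + unfold Rdiv. ring.
    + intros b Hb. unfold low. specialize (HmsN (S b) (S N) ltac:(lia)).
      destruct (Nat.ltb_spec t (ms (S b))); [lia|auto].
  - rewrite (diag_average (fun b => ms (S b)) N HN0).
    rewrite bscale_comp_l, bscale_comp_r, bsum_comp_l, bsum_comp_r.
    replace (RC (/ INR N) [.] bsum N (fun i => Pm (ms (S i)) [*] A)
             [-] RC (/ INR N) [.] bsum N (fun i => A [*] Pm (ms (S i))))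
      with (RC (/ INR N) [.] (bsum N (fun i => Pm (ms (S i)) [*] A [-] A [*] Pm (ms (S i)))))
      by (rewrite bsum_sub; bop).
    rewrite (gsum_ext _ _ N _ _ (fun b _ => commutator_Pm ms b A Hms)).
    rewrite bsum_sub, !bsum_add.
    assert (HAr : ob A r) by auto.
    replace dl with (Cnorm (RC (/ INR N)) * (INR N * dl))
      by (rewrite Cnorm_RC, Rabs_pos_eq by (left; apply Rinv_0_lt_compat; auto); field; lra).
    apply ob_scale.
    apply ob_mono with ((r + (INR N * (dl / 8) + INR N * (dl / 8))) + (r + (INR N * (dl / 8) + INR N * (dl / 8)))).
    { apply Rmult_le_compat_r with (r := INR N) in HNr; [|lra].
      unfold Rdiv at 1 in HNr. rewrite Rmult_assoc, Rinv_l in HNr by lra. lra. }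
    assert (H1 : ob (bsum N (fun i => Pm (ms i) [*] A [*] Qm (ms (S i)) [*] Pm (ms (S (S i))))) (INR N * (dl / 8))).
    { rewrite <- rsum_const. apply ob_bsum. intros i _. rewrite <- (Rmult_1_r (dl / 8)).
      apply ob_comp; [exact (proj1 (proj2 (Hnx' (ms i)) A IA))|apply ob_diag]. }
    assert (H2 : ob (bsum N (fun i => Pm (ms (S i)) [*] A [*] Qm (ms (S (S i))))) (INR N * (dl / 8))).
    { rewrite <- rsum_const. apply ob_bsum. intros i _. exact (proj1 (proj2 (Hnx' (ms (S i))) A IA)). }
    assert (H3 : ob (bsum N (fun i => Pm (ms (S (S i))) [*] (Qm (ms (S i)) [*] A [*] Pm (ms i)))) (INR N * (dl / 8))).
    { rewrite <- rsum_const. apply ob_bsum. intros i _. rewrite <- (Rmult_1_l (dl / 8)).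
      apply ob_comp; [apply ob_diag|exact (proj2 (proj2 (Hnx' (ms i)) A IA))]. }
    assert (H4 : ob (bsum N (fun i => Qm (ms (S (S i))) [*] A [*] Pm (ms (S i)))) (INR N * (dl / 8))).
    { rewrite <- rsum_const. apply ob_bsum. intros i _. exact (proj2 (proj2 (Hnx' (ms (S i))) A IA)). }
    apply ob_sub; (apply ob_add; [apply ob_band; auto|apply ob_add; auto]).
Qed.

End Tails.

(** * Rademacher sums and Khinchine's inequality *)

(** The numbers [e] below [2^k] encode the sign vectors of length [k] by their bits. Separating even
    and odd [e] peels off the sign of index 0, which drives the inductions below. *)
Definition rad (i e : nat) : R := if Nat.testbit e i then -1 else 1.

Lemma rad_sq (i e : nat) : rad i e * rad i e = 1.
Proof. unfold rad. destruct (Nat.testbit e i); ring. Qed.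

Lemma rad_even_0 (e : nat) : rad 0 (2 * e) = 1.
Proof. unfold rad. rewrite Nat.testbit_even_0. reflexivity. Qed.
Lemma rad_odd_0 (e : nat) : rad 0 (2 * e + 1) = -1.
Proof. unfold rad. rewrite Nat.testbit_odd_0. reflexivity. Qed.
Lemma rad_even_S (i e : nat) : rad (S i) (2 * e) = rad i e.
Proof. unfold rad. rewrite Nat.testbit_even_succ'. reflexivity. Qed.
Lemma rad_odd_S (i e : nat) : rad (S i) (2 * e + 1) = rad i e.
Proof. unfold rad. rewrite Nat.testbit_odd_succ'. reflexivity. Qed.

Lemma rsum_double (m : nat) (F : nat -> R) :
  rsum (2 * m) F = rsum m (fun e => F (2 * e)%nat + F (2 * e + 1)%nat).
Proof.
  induction m as [|m IH]; [reflexivity|].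
  replace (2 * S m)%nat with (S (S (2 * m))) by lia.
  cbn [gsum]. rewrite IH. replace (S (2 * m)) with (2 * m + 1)%nat by lia. lra.
Qed.

Lemma rsum_S_l (n : nat) (F : nat -> R) : rsum (S n) F = F 0%nat + rsum n (fun i => F (S i)).
Proof.
  replace (S n) with (1 + n)%nat by lia. rewrite rsum_split. simpl. lra.
Qed.

Lemma INR_pow2 (k : nat) : INR (2 ^ k) = 2 ^ k.
Proof. rewrite pow_INR. f_equal. Qed.

Lemma rad_orthogonal (k i j : nat) : (i < k)%nat -> (j < k)%nat ->
  rsum (2 ^ k) (fun e => rad i e * rad j e) = if (i =? j)%nat then 2 ^ k else 0.
Proof.
  revert i j. induction k as [|k IH]; intros i j Hi Hj; [lia|].
  change (2 ^ S k)%nat with (2 * 2 ^ k)%nat. rewrite rsum_double.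
  destruct i as [|i], j as [|j].
  - rewrite (gsum_ext _ _ _ _ (fun _ => 2)), rsum_const, INR_pow2.
    + simpl. ring.
    + intros. rewrite !rad_sq. ring.
  - rewrite (gsum_ext _ _ _ _ (fun _ => 0)), rsum_const.
    + simpl. ring.
    + intros. rewrite rad_even_0, rad_odd_0, rad_even_S, rad_odd_S. ring.
  - rewrite (gsum_ext _ _ _ _ (fun _ => 0)), rsum_const.
    + simpl. ring.
    + intros. rewrite rad_even_0, rad_odd_0, rad_even_S, rad_odd_S. ring.
  - rewrite (gsum_ext _ _ _ _ (fun e => 2 * (rad i e * rad j e))), rsum_scal, IH by
      (try lia; intros; rewrite !rad_even_S, !rad_odd_S; ring).
    simpl. destruct (i =? j)%nat; ring.
Qed.

Lemma exp_le (x y : R) : x <= y -> exp x <= exp y.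
Proof. intros [H| ->]; [left; apply exp_increasing; auto|lra]. Qed.

(** For [|a| <= 1] the linear terms of the two quadratic bounds cancel; for larger [a] already
    [|a| <= 2 a^2]. *)
Lemma cosh_bound (a : R) : exp a + exp (- a) <= 2 * exp (2 * (a * a)).
Proof.
  (* Squaring [exp (a / 2) (1 - a / 2) <= 1] bounds [exp a] by [(1 - a / 2)^(-2)], and the
     polynomial identity below compares this with the quadratic. *)
  assert (H1 : forall a, -1 <= a <= 1 -> exp a <= 1 + a + 2 * (a * a)).
  { clear a. intros a Ha.
    assert (Hx : 0 < 1 - a / 2) by lra.
    pose proof (exp_ineq1_le (- (a / 2))) as H.
    assert (Hm : exp (a / 2) * exp (- (a / 2)) = 1) by (rewrite <- exp_plus, Rplus_opp_r; apply exp_0).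
    pose proof (exp_pos (a / 2)) as Hp.
    assert (H2 : exp (a / 2) * (1 - a / 2) <= 1).
    { rewrite <- Hm. apply Rmult_le_compat_l; lra. }
    assert (E : exp a = exp (a / 2) * exp (a / 2)) by (rewrite <- exp_plus; f_equal; field).
    rewrite E. set (u := exp (a / 2)) in *. set (v := 1 - a / 2) in *.
    assert (Huv : 0 < u * v) by (apply Rmult_lt_0_compat; auto).
    assert (Hu : u * v * (u * v) <= 1) by (rewrite <- (Rmult_1_r 1); apply Rmult_le_compat; lra).
    apply Rmult_le_reg_r with (v * v); [apply Rmult_lt_0_compat; auto|].
    replace (u * u * (v * v)) with (u * v * (u * v)) by ring.
    apply Rle_trans with 1; auto. unfold v.
    replace ((1 + a + 2 * (a * a)) * ((1 - a / 2) * (1 - a / 2)))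
      with (1 + a * a * ((1 - a) * (5 / 4 - a / 2))) by field.
    assert (0 <= (1 - a) * (5 / 4 - a / 2)) by (apply Rmult_le_pos; lra). nra. }
  destruct (Rle_dec (-1) a); [destruct (Rle_dec a 1)|].
  - pose proof (H1 a ltac:(lra)). pose proof (H1 (- a) ltac:(lra)).
    pose proof (exp_ineq1_le (2 * (a * a))). lra.
  - assert (exp a <= exp (2 * (a * a))) by (apply exp_le; nra).
    assert (exp (- a) <= exp (2 * (a * a))) by (apply exp_le; nra). lra.
  - assert (exp a <= exp (2 * (a * a))) by (apply exp_le; nra).
    assert (exp (- a) <= exp (2 * (a * a))) by (apply exp_le; nra). lra.
Qed.

(** By independence of the signs the mean of the exponential is the product of the [cosh (a i)]; the
    induction integrates out one sign at a time. *)
Lemma rad_exp_moment (k : nat) (a : nat -> R) :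
  rsum (2 ^ k) (fun e => exp (rsum k (fun i => a i * rad i e)))
    <= 2 ^ k * exp (2 * rsum k (fun i => a i * a i)).
Proof.
  revert a. induction k as [|k IH]; intros a.
  - simpl. rewrite Rmult_0_r, exp_0. lra.
  - change (2 ^ S k)%nat with (2 * 2 ^ k)%nat. rewrite rsum_double.
    rewrite (gsum_ext _ _ _ _ (fun e => (exp (a 0%nat) + exp (- a 0%nat)) *
       exp (rsum k (fun i => a (S i) * rad i e)))).
    + rewrite rsum_scal, rsum_S_l.
      replace (2 ^ S k * exp (2 * (a 0%nat * a 0%nat + rsum k (fun i => a (S i) * a (S i)))))
        with ((2 * exp (2 * (a 0%nat * a 0%nat))) *
              (2 ^ k * exp (2 * rsum k (fun i => a (S i) * a (S i)))))
        by (rewrite Rmult_plus_distr_l, exp_plus; simpl; ring).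
      apply Rmult_le_compat.
      * left. apply Rplus_lt_0_compat; apply exp_pos.
      * apply rsum_nonneg. intros; left; apply exp_pos.
      * apply cosh_bound.
      * apply (IH (fun i => a (S i))).
    + intros e _. rewrite !rsum_S_l, rad_even_0, rad_odd_0, !exp_plus.
      rewrite (gsum_ext _ _ k (fun i => a (S i) * rad (S i) (2 * e)) (fun i => a (S i) * rad i e))
        by (intros; rewrite rad_even_S; auto).
      rewrite (gsum_ext _ _ k (fun i => a (S i) * rad (S i) (2 * e + 1)) (fun i => a (S i) * rad i e))
        by (intros; rewrite rad_odd_S; auto).
      replace (a 0%nat * 1) with (a 0%nat) by ring.
      replace (a 0%nat * -1) with (- a 0%nat) by ring. ring.
Qed.

(** From [1 + ln (s / r) <= s / r] one even gets [s^r <= r^r exp (s - r)]. *)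
Lemma rpow_le_exp (s r : R) : 0 < r -> 0 <= s -> rpow s r <= rpow r r * exp s.
Proof.
  intros Hr [Hs|<-].
  - rewrite !rpow_Rpower by auto. unfold Rpower. rewrite <- exp_plus.
    apply exp_le. pose proof (exp_ineq1_le (ln (s / r))) as H.
    rewrite exp_ln in H by (apply Rmult_lt_0_compat; auto; apply Rinv_0_lt_compat; auto).
    assert (Hl : ln (s / r) = ln s - ln r).
    { unfold Rdiv. rewrite ln_mult, ln_Rinv; auto. apply Rinv_0_lt_compat; auto. }
    rewrite Hl in H. apply Rmult_le_compat_l with (r := r) in H; [|lra].
    replace (r * (s / r)) with s in H by (field; lra). nra.
  - rewrite rpow_0. apply Rmult_le_pos; [apply rpow_nonneg|left; apply exp_pos].
Qed.

(** For unit coefficients [|S|^r <= r^r exp |S|], and [exp |S| <= exp S + exp (- S)], where both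
    exponentials have mean at most [exp 2]. *)
Definition khinchine_const (r : R) : R := rpow r r * (2 * exp 2).
Definition l2norm (k : nat) (a : nat -> R) : R := sqrt (rsum k (fun i => a i * a i)).

Lemma khinchine_const_pos (r : R) : 0 < r -> 0 < khinchine_const r.
Proof.
  intros. apply Rmult_lt_0_compat; [apply rpow_pos; auto|]. pose proof (exp_pos 2). lra.
Qed.

Lemma l2norm_sq (k : nat) (a : nat -> R) : l2norm k a * l2norm k a = rsum k (fun i => a i * a i).
Proof. apply sqrt_sqrt. apply rsum_nonneg. intros; nra. Qed.

Lemma l2norm_nonneg (k : nat) (a : nat -> R) : 0 <= l2norm k a.
Proof. apply sqrt_pos. Qed.

Lemma l2norm_zero (k : nat) (a : nat -> R) : l2norm k a = 0 -> forall i, (i < k)%nat -> a i = 0.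
Proof.
  intros H i Hi. pose proof (l2norm_sq k a) as E. rewrite H in E.
  pose proof (rsum_ge_term k i (fun i => a i * a i) Hi ltac:(intros; simpl; nra)). simpl in *. nra.
Qed.

Lemma l2norm_normalized (k : nat) (a : nat -> R) : l2norm k a <> 0 ->
  rsum k (fun i => a i / l2norm k a * (a i / l2norm k a)) = 1.
Proof.
  intros H. rewrite (gsum_ext _ _ k _ (fun i => / (l2norm k a * l2norm k a) * (a i * a i)))
    by (intros; field; auto).
  rewrite rsum_scal, <- l2norm_sq. field. auto.
Qed.

Lemma khinchine_unit (k : nat) (a : nat -> R) (r : R) : 0 < r -> rsum k (fun i => a i * a i) <= 1 ->
  rsum (2 ^ k) (fun e => rpow (Rabs (rsum k (fun i => a i * rad i e))) r) <= 2 ^ k * khinchine_const r.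
Proof.
  intros Hr Ha.
  apply Rle_trans with (rsum (2 ^ k) (fun e => rpow r r *
     (exp (rsum k (fun i => a i * rad i e)) + exp (rsum k (fun i => (- a i) * rad i e))))).
  - apply rsum_le. intros e _. eapply Rle_trans; [apply rpow_le_exp; [auto|apply Rabs_pos]|].
    apply Rmult_le_compat_l; [apply rpow_nonneg|].
    rewrite (gsum_ext _ _ k (fun i => - a i * rad i e) (fun i => -1 * (a i * rad i e)))
      by (intros; ring).
    rewrite rsum_scal. set (s := rsum k (fun i => a i * rad i e)).
    pose proof (exp_pos s). pose proof (exp_pos (-1 * s)).
    unfold Rabs. destruct (Rcase_abs s); [replace (- s) with (-1 * s) by ring|]; lra.
  - rewrite rsum_scal, rsum_plus. unfold khinchine_const.
    replace (2 ^ k * (rpow r r * (2 * exp 2))) with (rpow r r * (2 ^ k * exp 2 + 2 ^ k * exp 2)) by ring.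
    apply Rmult_le_compat_l; [apply rpow_nonneg|].
    assert (Hp : 0 < 2 ^ k) by (apply pow_lt; lra).
    apply Rplus_le_compat; (eapply Rle_trans; [apply rad_exp_moment|]);
      (apply Rmult_le_compat_l; [lra|]); apply exp_le.
    + lra.
    + rewrite (gsum_ext _ _ k _ (fun i => a i * a i)) by (intros; ring). lra.
Qed.

Lemma khinchine (k : nat) (a : nat -> R) (r : R) : 0 < r ->
  rsum (2 ^ k) (fun e => rpow (Rabs (rsum k (fun i => a i * rad i e))) r)
    <= 2 ^ k * khinchine_const r * rpow (l2norm k a) r.
Proof.
  intros Hr. destruct (Req_dec (l2norm k a) 0) as [H0|H0].
  - rewrite H0, rpow_0, Rmult_0_r.
    rewrite (gsum_ext _ _ _ _ (fun _ => 0)), rsum_const; [lra|].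
    intros e _. rewrite (gsum_ext _ _ k _ (fun _ => 0)), rsum_const, Rmult_0_r, Rabs_R0, rpow_0; auto.
    intros i Hi. rewrite (l2norm_zero k a H0 i Hi). ring.
  - pose proof (l2norm_nonneg k a).
    pose proof (khinchine_unit k (fun i => a i / l2norm k a) r Hr) as K.
    cbv beta in K. rewrite l2norm_normalized in K by auto. specialize (K (Rle_refl 1)).
    apply Rmult_le_compat_r with (r := rpow (l2norm k a) r) in K; [|apply rpow_nonneg].
    eapply Rle_trans; [|apply K]. rewrite Rmult_comm, <- rsum_scal. right. apply gsum_ext.
    intros e _. rewrite <- rpow_mult by auto using Rabs_pos. f_equal.
    rewrite <- (Rabs_pos_eq (l2norm k a)) at 1 by auto. rewrite <- Rabs_mult, <- rsum_scal.
    f_equal. apply gsum_ext. intros i _. field. auto.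
Qed.

(* The bound dual to Khinchine's inequality, by Young's inequality with the parameter [lam]. *)
Lemma khinchine_dual (p : R) : 1 < p -> exists K, 0 <= K /\ forall k (F : nat -> R),
  rpow (l2norm k (fun i => rsum (2 ^ k) (fun e => F e * rad i e) / 2 ^ k)) p
    <= K * rsum (2 ^ k) (fun e => rpow (Rabs (F e)) p) / 2 ^ k.
Proof.
  intros Hp. set (q := p / (p - 1)).
  assert (Hq : 0 < q) by (apply Rmult_lt_0_compat; [lra|apply Rinv_0_lt_compat; lra]).
  assert (Hpq : / p + / q = 1) by (unfold q; field; lra).
  (* With [lam^q = c] the dual term in Young's inequality is at most half of the left side [2^k] and
     can be absorbed there. *)
  set (c := 2 * khinchine_const q / q).
  assert (Hc : 0 < c).
  { apply Rmult_lt_0_compat; [pose proof (khinchine_const_pos q Hq); lra|apply Rinv_0_lt_compat; auto]. }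
  set (lam := rpow c (/ q)).
  assert (Hlam : 0 < lam) by (apply rpow_pos; auto).
  exists (2 * rpow lam p / p). split.
  { pose proof (rpow_pos lam p Hlam). apply Rmult_le_pos; [lra|left; apply Rinv_0_lt_compat; lra]. }
  intros k F. assert (H2k : 0 < 2 ^ k) by (apply pow_lt; lra).
  set (a := fun i => rsum (2 ^ k) (fun e => F e * rad i e) / 2 ^ k).
  set (n := l2norm k a). pose proof (l2norm_nonneg k a) as Hn. fold n in Hn.
  assert (HS : 0 <= rsum (2 ^ k) (fun e => rpow (Rabs (F e)) p)).
  { apply rsum_nonneg. intros; apply rpow_nonneg. }
  destruct Hn as [Hn|Hn].
  2:{ rewrite <- Hn, rpow_0. pose proof (rpow_pos lam p Hlam).
      apply Rmult_le_pos; [|left; apply Rinv_0_lt_compat; lra].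
      apply Rmult_le_pos; auto. apply Rmult_le_pos; [lra|left; apply Rinv_0_lt_compat; lra]. }
  set (b := fun i => a i / n).
  assert (Hb : rsum k (fun i => b i * b i) = 1) by (apply l2norm_normalized; fold n; lra).
  pose proof (khinchine_unit k b q Hq ltac:(lra)) as KU.
  set (S := fun e => rsum k (fun i => b i * rad i e)) in *.
  (* Duality: [b] is the unit vector along the coefficients [a], so pairing [F / n] with its
     Rademacher sum [S] returns the norm of [a] divided by [n], which is 1, times [2^k]. *)
  assert (E1 : 2 ^ k = rsum (2 ^ k) (fun e => F e / n * S e)).
  { transitivity (2 ^ k * / n * rsum k (fun i => b i * a i)).
    - rewrite (gsum_ext _ _ k _ (fun i => n * (b i * b i))) by (intros; unfold b; field; lra).
      rewrite rsum_scal, Hb. field. lra.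
    - rewrite <- rsum_scal.
      rewrite (gsum_ext _ _ (2 ^ k) (fun e => F e / n * S e)
         (fun e => rsum k (fun i => / n * b i * (F e * rad i e)))).
      + rewrite rsum_swap. apply gsum_ext. intros i _. rewrite rsum_scal. unfold a. field. lra.
      + intros e _. unfold S. rewrite <- rsum_scal. apply gsum_ext. intros; field; lra. }
  assert (E2 : rsum (2 ^ k) (fun e => F e / n * S e) <=
     rpow lam p / p * / rpow n p * rsum (2 ^ k) (fun e => rpow (Rabs (F e)) p)
     + / (c * q) * rsum (2 ^ k) (fun e => rpow (Rabs (S e)) q)).
  { rewrite <- !rsum_scal, <- rsum_plus. apply rsum_le. intros e _.
    apply Rle_trans with ((lam * (/ n * Rabs (F e))) * (/ lam * Rabs (S e))).
    - eapply Rle_trans; [apply Rle_abs|]. rewrite Rabs_mult. unfold Rdiv. rewrite Rabs_mult.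
      rewrite (Rabs_pos_eq (/ n)) by (left; apply Rinv_0_lt_compat; auto). right. field. lra.
    - assert (0 <= / n) by (left; apply Rinv_0_lt_compat; auto).
      assert (0 <= / lam) by (left; apply Rinv_0_lt_compat; auto).
      pose proof (Rabs_pos (F e)). pose proof (Rabs_pos (S e)).
      assert (Hinv : forall z r, 0 < z -> rpow (/ z) r = / rpow z r).
      { intros z r Hz. apply Rmult_eq_reg_l with (rpow z r); [|pose proof (rpow_pos z r Hz); lra].
        rewrite Rinv_r by (pose proof (rpow_pos z r Hz); lra).
        rewrite <- rpow_mult, Rinv_r, rpow_1; auto; try lra. left; apply Rinv_0_lt_compat; auto. }
      eapply Rle_trans; [apply (Young _ _ p q); auto|].
      + apply Rmult_le_pos; [lra|]. apply Rmult_le_pos; auto.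
      + apply Rmult_le_pos; auto.
      + rewrite !rpow_mult by (try apply Rmult_le_pos; auto; lra).
        rewrite !Hinv by auto. unfold lam at 2. rewrite rpow_inv' by lra.
        right. field. pose proof (rpow_pos n p Hn). lra. }
  assert (E3 : / (c * q) * rsum (2 ^ k) (fun e => rpow (Rabs (S e)) q) <= 2 ^ k / 2).
  { pose proof (khinchine_const_pos q Hq).
    replace (2 ^ k / 2) with (/ (c * q) * (2 ^ k * khinchine_const q)) by (unfold c; field; lra).
    apply Rmult_le_compat_l; auto. left. apply Rinv_0_lt_compat. apply Rmult_lt_0_compat; auto. }
  assert (E4 : 2 ^ k / 2 <= rpow lam p / p * / rpow n p * rsum (2 ^ k) (fun e => rpow (Rabs (F e)) p)) by lra.
  pose proof (rpow_pos n p Hn) as Hnp.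
  apply Rmult_le_compat_r with (r := 2 * rpow n p / 2 ^ k) in E4.
  2:{ apply Rmult_le_pos; [lra|left; apply Rinv_0_lt_compat; auto]. }
  replace (2 ^ k / 2 * (2 * rpow n p / 2 ^ k)) with (rpow n p) in E4 by (field; lra).
  eapply Rle_trans; [apply E4|]. right. field. lra.
Qed.

Lemma rsum_fst_csum (n : nat) (F : nat -> CC) : fst (csum n F) = rsum n (fun i => fst (F i)).
Proof. apply (gsum_morph Cadd C0 Rplus 0 fst); reflexivity. Qed.
Lemma rsum_snd_csum (n : nat) (F : nat -> CC) : snd (csum n F) = rsum n (fun i => snd (F i)).
Proof. apply (gsum_morph Cadd C0 Rplus 0 snd); reflexivity. Qed.

Lemma l2norm_complex_le (k : nat) (c x y : nat -> R) (beta : R) : 0 <= beta ->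
  (forall i, (i < k)%nat -> c i * c i <= beta * beta * (x i * x i + y i * y i)) ->
  l2norm k c <= beta * (l2norm k x + l2norm k y).
Proof.
  intros Hb H. pose proof (l2norm_nonneg k x). pose proof (l2norm_nonneg k y).
  apply Rsqr_incr_0_var; [|nra]. unfold Rsqr. rewrite l2norm_sq.
  apply Rle_trans with (beta * beta * (rsum k (fun i => x i * x i) + rsum k (fun i => y i * y i))).
  - rewrite <- rsum_plus, <- rsum_scal. apply rsum_le. auto.
  - rewrite <- !l2norm_sq.
    replace (beta * (l2norm k x + l2norm k y) * (beta * (l2norm k x + l2norm k y)))
      with (beta * beta * ((l2norm k x + l2norm k y) * (l2norm k x + l2norm k y))) by ring.
    apply Rmult_le_compat_l; nra.
Qed.

(** The dual inequality bounds the l^2-norm of the Rademacher coefficients of [F], the multiplier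
    costs a factor [beta] in l^2, and Khinchine's inequality returns to L^p. Neither constant
    depends on [k]. Real and imaginary parts are treated separately. *)
Lemma rademacher_multiplier (p : R) : 1 < p -> exists K, 0 <= K /\
  forall k (F b : nat -> CC) beta, 0 <= beta -> (forall i, (i < k)%nat -> Cnorm (b i) <= beta) ->
  rsum (2 ^ k) (fun e => rpow (Cnorm (csum k (fun i => Cmul (Cmul (b i)
     (csum (2 ^ k) (fun e' => Cmul (RC (rad i e' / 2 ^ k)) (F e')))) (RC (rad i e))))) p)
  <= rpow (K * beta) p * rsum (2 ^ k) (fun e => rpow (Cnorm (F e)) p).
Proof.
  intros Hp. destruct (khinchine_dual p Hp) as (K1 & HK1 & HD).
  pose proof (khinchine_const_pos p ltac:(lra)) as HK2.
  set (D := rpow 2 p * (2 * (khinchine_const p * (rpow 2 p * (2 * K1))))).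
  pose proof (rpow_nonneg 2 p) as H2p.
  assert (HDn : 0 <= D) by (unfold D; repeat (apply Rmult_le_pos; try lra)).
  exists (rpow D (/ p)). split; [apply rpow_nonneg|].
  intros k F b beta Hb Hbi. assert (H2k : 0 < 2 ^ k) by (apply pow_lt; lra).
  rewrite rpow_mult, rpow_inv' by (auto using rpow_nonneg; lra).
  set (a := fun i => csum (2 ^ k) (fun e' => Cmul (RC (rad i e' / 2 ^ k)) (F e'))).
  set (SF := rsum (2 ^ k) (fun e => rpow (Cnorm (F e)) p)).
  assert (HSF : 0 <= SF) by (apply rsum_nonneg; intros; apply rpow_nonneg).
  assert (Ha : forall (pr : CC -> R), (pr = fst \/ pr = snd) ->
    rpow (l2norm k (fun i => pr (a i))) p <= K1 * SF / 2 ^ k).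
  { intros pr Hpr.
    assert (Epr : forall i, pr (a i) = rsum (2 ^ k) (fun e => pr (F e) * rad i e) / 2 ^ k).
    { intros i. unfold a. unfold Rdiv. rewrite Rmult_comm, <- rsum_scal.
      destruct Hpr as [-> | ->]; [rewrite rsum_fst_csum|rewrite rsum_snd_csum];
      apply gsum_ext; intros; unfold RC, Cmul, Rdiv; simpl; ring. }
    assert (Hpn : forall z, Rabs (pr z) <= Cnorm z).
    { intros z. destruct Hpr as [-> | ->]; [apply Cnorm_fst|apply Cnorm_snd]. }
    replace (fun i => pr (a i)) with
      (fun i => rsum (2 ^ k) (fun e => pr (F e) * rad i e) / 2 ^ k)
      by (apply functional_extensionality; intros; symmetry; apply Epr).
    eapply Rle_trans; [apply (HD k (fun e => pr (F e)))|].
    unfold Rdiv. apply Rmult_le_compat_r; [left; apply Rinv_0_lt_compat; auto|].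
    apply Rmult_le_compat_l; auto. apply rsum_le. intros e _.
    apply rpow_le; [lra|]. split; [apply Rabs_pos|apply Hpn]. }
  assert (Hc : forall (pr : CC -> R), (pr = fst \/ pr = snd) ->
    rsum (2 ^ k) (fun e => rpow (Rabs (pr (csum k (fun i => Cmul (Cmul (b i) (a i)) (RC (rad i e)))))) p)
      <= khinchine_const p * (rpow beta p * (rpow 2 p * (2 * K1 * SF)))).
  { intros pr Hpr.
    assert (Hpn : forall z, Rabs (pr z) <= Cnorm z).
    { intros z. destruct Hpr as [-> | ->]; [apply Cnorm_fst|apply Cnorm_snd]. }
    set (c := fun i => pr (Cmul (b i) (a i))).
    rewrite (gsum_ext _ _ _ _ (fun e => rpow (Rabs (rsum k (fun i => c i * rad i e))) p)).
    2:{ intros e _. do 2 f_equal.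
        destruct Hpr as [-> | ->]; [rewrite rsum_fst_csum|rewrite rsum_snd_csum];
        apply gsum_ext; intros; unfold c, RC, Cmul; simpl; ring. }
    eapply Rle_trans; [apply khinchine; lra|].
    assert (Hl : l2norm k c <= beta * (l2norm k (fun i => fst (a i)) + l2norm k (fun i => snd (a i)))).
    { apply l2norm_complex_le; auto. intros i Hi. rewrite <- Cnorm_sq.
      specialize (Hbi i Hi). pose proof (Cnorm_nonneg (b i)). pose proof (Cnorm_nonneg (a i)).
      assert (Hci : Rabs (c i) <= beta * Cnorm (a i)).
      { eapply Rle_trans; [apply Hpn|]. rewrite Cnorm_mul. apply Rmult_le_compat_r; auto. }
      replace (c i * c i) with (Rabs (c i) * Rabs (c i)) by (rewrite <- Rabs_mult; apply Rabs_pos_eq; nra).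
      pose proof (Rabs_pos (c i)).
      replace (beta * beta * (Cnorm (a i) * Cnorm (a i))) with ((beta * Cnorm (a i)) * (beta * Cnorm (a i))) by ring.
      apply Rmult_le_compat; auto. }
    assert (Hl2 : rpow (l2norm k c) p <= rpow beta p * (rpow 2 p * (2 * K1 * SF / 2 ^ k))).
    { eapply Rle_trans; [apply rpow_le; [lra|split; [apply l2norm_nonneg|apply Hl]]|].
      pose proof (l2norm_nonneg k (fun i => fst (a i))). pose proof (l2norm_nonneg k (fun i => snd (a i))).
      rewrite rpow_mult by lra. apply Rmult_le_compat_l; [apply rpow_nonneg|].
      eapply Rle_trans; [apply rpow_add_le; lra|]. apply Rmult_le_compat_l; auto.
      pose proof (Ha fst (or_introl eq_refl)). pose proof (Ha snd (or_intror eq_refl)).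
      unfold Rdiv in *. lra. }
    apply Rle_trans with (2 ^ k * khinchine_const p * (rpow beta p * (rpow 2 p * (2 * K1 * SF / 2 ^ k)))).
    - apply Rmult_le_compat_l; auto. apply Rmult_le_pos; lra.
    - right. field. lra. }
  apply Rle_trans with (rsum (2 ^ k) (fun e => rpow 2 p *
    (rpow (Rabs (fst (csum k (fun i => Cmul (Cmul (b i) (a i)) (RC (rad i e)))))) p
     + rpow (Rabs (snd (csum k (fun i => Cmul (Cmul (b i) (a i)) (RC (rad i e)))))) p))).
  - apply rsum_le. intros e _.
    eapply Rle_trans; [apply rpow_le with (y := Rabs (fst (csum k (fun i => Cmul (Cmul (b i) (a i)) (RC (rad i e))))) +
        Rabs (snd (csum k (fun i => Cmul (Cmul (b i) (a i)) (RC (rad i e)))))); [lra|]|].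
    + split; [apply Cnorm_nonneg|apply Cnorm_le_parts].
    + apply rpow_add_le; [lra|apply Rabs_pos|apply Rabs_pos].
  - rewrite rsum_scal, rsum_plus.
    pose proof (Hc fst (or_introl eq_refl)) as H1. pose proof (Hc snd (or_intror eq_refl)) as H2.
    apply Rle_trans with (rpow 2 p * (khinchine_const p * (rpow beta p * (rpow 2 p * (2 * K1 * SF)))
      + khinchine_const p * (rpow beta p * (rpow 2 p * (2 * K1 * SF))))).
    + apply Rmult_le_compat_l; auto. lra.
    + right. unfold D. ring.
Qed.

(** * Continuous functions and compact subsets of R^d *)

Section Continuous.
Variables (d : nat) (M : pt -> Prop).

Lemma cont_const (c : CC) : cont_on d M (fun _ => c).
Proof.
  intros x _ eps He. exists 1. split; [lra|]. intros. replace (Cadd c (Copp c)) with C0 by ring.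
  rewrite Cnorm_C0. auto.
Qed.

Lemma cont_add (f g : fn) : cont_on d M f -> cont_on d M g -> cont_on d M (fadd f g).
Proof.
  intros Hf Hg x Mx eps He. destruct (Hf x Mx (eps / 2)) as (r & Hr & H1); [lra|].
  destruct (Hg x Mx (eps / 2)) as (s & Hs & H2); [lra|].
  exists (Rmin r s). split; [apply Rmin_glb_lt; auto|]. intros y My Hy.
  pose proof (Rmin_l r s). pose proof (Rmin_r r s).
  specialize (H1 y My ltac:(lra)). specialize (H2 y My ltac:(lra)). unfold fadd.
  replace (Cadd (Cadd (f y) (g y)) (Copp (Cadd (f x) (g x)))) with
    (Cadd (Cadd (f y) (Copp (f x))) (Cadd (g y) (Copp (g x)))) by ring.
  eapply Rle_lt_trans; [apply Cnorm_add|]. lra.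
Qed.

Lemma cont_mul (f g : fn) : cont_on d M f -> cont_on d M g -> cont_on d M (fmul f g).
Proof.
  intros Hf Hg x Mx eps He.
  set (K := Cnorm (f x) + Cnorm (g x) + 1).
  pose proof (Cnorm_nonneg (f x)). pose proof (Cnorm_nonneg (g x)).
  set (e := Rmin 1 (eps / (2 * K))).
  assert (HK : 0 < eps / (2 * K)) by (apply Rmult_lt_0_compat; auto; apply Rinv_0_lt_compat; unfold K; lra).
  assert (He' : 0 < e) by (apply Rmin_glb_lt; lra).
  destruct (Hf x Mx e He') as (r1 & Hr1 & H1). destruct (Hg x Mx e He') as (r2 & Hr2 & H2).
  exists (Rmin r1 r2). split; [apply Rmin_glb_lt; auto|]. intros y My Hy.
  pose proof (Rmin_l r1 r2). pose proof (Rmin_r r1 r2).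
  specialize (H1 y My ltac:(lra)). specialize (H2 y My ltac:(lra)). unfold fmul.
  set (u := Cadd (f y) (Copp (f x))) in *. set (v := Cadd (g y) (Copp (g x))) in *.
  replace (Cadd (Cmul (f y) (g y)) (Copp (Cmul (f x) (g x)))) with
    (Cadd (Cmul u v) (Cadd (Cmul u (g x)) (Cmul (f x) v))) by (unfold u, v; ring).
  eapply Rle_lt_trans; [apply Cnorm_add|].
  eapply Rle_lt_trans; [apply Rplus_le_compat_l; apply Cnorm_add|]. rewrite !Cnorm_mul.
  assert (He1 : e <= 1) by apply Rmin_l. assert (He2 : e <= eps / (2 * K)) by apply Rmin_r.
  pose proof (Cnorm_nonneg u). pose proof (Cnorm_nonneg v).
  apply Rle_lt_trans with (e * 1 + (e * Cnorm (g x) + Cnorm (f x) * e)).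
  - repeat apply Rplus_le_compat; apply Rmult_le_compat; lra.
  - replace (e * 1 + (e * Cnorm (g x) + Cnorm (f x) * e)) with (e * K) by (unfold K; ring).
    apply Rle_lt_trans with (eps / (2 * K) * K); [apply Rmult_le_compat_r; [unfold K; lra|exact He2]|].
    replace (eps / (2 * K) * K) with (eps / 2) by (field; unfold K; lra). lra.
Qed.

Lemma cont_scale (c : CC) (f : fn) : cont_on d M f -> cont_on d M (fscale c f).
Proof. intros Hf. apply (cont_mul (fun _ => c)); auto. apply cont_const. Qed.

Definition fsum (k : nat) (F : nat -> fn) : fn := fun y => csum k (fun i => F i y).

Lemma cont_fsum (k : nat) (F : nat -> fn) :
  (forall i, (i < k)%nat -> cont_on d M (F i)) -> cont_on d M (fsum k F).
Proof.
  induction k as [|k IH]; intros H.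
  - apply cont_const.
  - apply (cont_add (fsum k F) (F k)); auto.
Qed.

End Continuous.

(** Box neighbourhoods match partitions built as products over the coordinates; they compare with
    [dist] up to the factor [d]. *)
Definition near (d : nat) (x y : pt) (r : R) : Prop :=
  forall i, (i < d)%nat -> Rabs (x i - y i) < r.

Lemma finite_max (n : nat) (F : nat -> R) : exists B, 0 <= B /\ forall i, (i < n)%nat -> Rabs (F i) <= B.
Proof.
  induction n as [|n (B & HB & H)].
  - exists 0. split; [lra|]. intros; lia.
  - exists (B + Rabs (F n)). pose proof (Rabs_pos (F n)). split; [lra|]. intros i Hi.
    destruct (Nat.eq_dec i n) as [->|Hn]; [lra|]. specialize (H i ltac:(lia)). lra.
Qed.

Section Euclid.
Variable d : nat.
Hypothesis d_pos : (1 <= d)%nat.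

Lemma dist_rsum (x y : pt) : dist d x y = sqrt (rsum d (fun i => (x i - y i) * (x i - y i))).
Proof. unfold dist. rewrite sum_f_R0_rsum. do 2 f_equal. lia. Qed.

Lemma dist_near (x y : pt) (r : R) : dist d x y < r -> near d x y r.
Proof.
  rewrite dist_rsum. intros H i Hi. eapply Rle_lt_trans; [|apply H].
  rewrite <- sqrt_Rsqr_abs. apply sqrt_le_1_alt.
  apply (rsum_ge_term d i (fun i => (x i - y i) * (x i - y i)) Hi). intros; apply Rle_0_sqr.
Qed.

Lemma near_dist (x y : pt) (r : R) : 0 <= r -> near d x y r -> dist d x y <= INR d * r.
Proof.
  intros Hr H. rewrite dist_rsum.
  assert (Hd : 1 <= INR d) by (apply (le_INR 1); auto).
  rewrite <- (sqrt_Rsqr (INR d * r)) by nra. apply sqrt_le_1_alt.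
  apply Rle_trans with (rsum d (fun _ => r * r)).
  - apply rsum_le. intros i Hi. specialize (H i Hi). pose proof (Rabs_pos (x i - y i)).
    replace ((x i - y i) * (x i - y i)) with (Rabs (x i - y i) * Rabs (x i - y i))
      by (rewrite <- Rabs_mult; apply Rabs_pos_eq; apply Rle_0_sqr).
    apply Rmult_le_compat; lra.
  - rewrite rsum_const. unfold Rsqr. assert (0 <= r * r) by nra.
    replace (INR d * r * (INR d * r)) with (INR d * (INR d * (r * r))) by ring.
    apply Rmult_le_compat_l; nra.
Qed.

Lemma box_open (x : pt) (r : R) : open_set d (fun y => near d x y r).
Proof.
  intros y Hy.
  assert (H : forall n, (n <= d)%nat -> exists r', 0 < r' /\
     forall i, (i < n)%nat -> Rabs (x i - y i) + r' <= r).
  { induction n as [|n IH]; intros Hn.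
    - exists 1. split; [lra|]. intros; lia.
    - destruct IH as (r' & Hr' & H); [lia|]. pose proof (Hy n ltac:(lia)) as Hyn.
      exists (Rmin r' (r - Rabs (x n - y n))). split; [apply Rmin_glb_lt; lra|].
      intros i Hi. destruct (Nat.eq_dec i n) as [->|Hne].
      + pose proof (Rmin_r r' (r - Rabs (x n - y n))). lra.
      + specialize (H i ltac:(lia)). pose proof (Rmin_l r' (r - Rabs (x n - y n))). lra. }
  destruct (H d (le_n d)) as (r' & Hr' & Hi). exists r'. split; auto. intros z Hz i Hid.
  specialize (Hi i Hid). pose proof (dist_near y z r' Hz i Hid).
  replace (x i - z i) with ((x i - y i) + (y i - z i)) by ring.
  pose proof (Rabs_triang (x i - y i) (y i - z i)). lra.
Qed.

Lemma near_refl (x : pt) (r : R) : 0 < r -> near d x x r.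
Proof. intros Hr i _. rewrite Rminus_diag, Rabs_R0. auto. Qed.

Variable M : pt -> Prop.
Hypothesis M_compact : compact_set d M.

Lemma compact_boxes (Q : pt -> R -> Prop) :
  (forall x, M x -> exists r, 0 < r /\ Q x r) ->
  exists l : list (pt * R), (forall x r, In (x, r) l -> 0 < r /\ Q x r) /\
    forall y, M y -> exists x r, In (x, r) l /\ near d x y r.
Proof.
  intros H.
  (* The cover is indexed by all centres with an admissible radius, so a finite subcover is itself
     the required list. *)
  destruct (M_compact {c : pt * R | 0 < snd c /\ Q (fst c) (snd c)}
    (fun c y => near d (fst (proj1_sig c)) y (snd (proj1_sig c)))) as [l Hl].
  - intros c. apply box_open.
  - intros x Hx. destruct (H x Hx) as (r & Hr & HQ). exists (exist _ (x, r) (conj Hr HQ)).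
    simpl. apply near_refl; auto.
  - exists (map (@proj1_sig _ _) l). split.
    + intros x r Hi. apply in_map_iff in Hi. destruct Hi as ([[x' r'] Hc] & Ec & _).
      simpl in *. inversion Ec; subst. auto.
    + intros y Hy. destruct (Hl y Hy) as ([[x r] Hc] & Ic & Hn). exists x, r.
      split; auto. apply in_map_iff. eexists. split; [|apply Ic]. reflexivity.
Qed.

Lemma compact_coord_bounded : exists B, 0 <= B /\ forall x, M x -> forall i, (i < d)%nat -> Rabs (x i) <= B.
Proof.
  destruct (compact_boxes (fun x r => r = 1)) as (l & Hl & Hc).
  { intros x _. exists 1. split; [lra|auto]. }
  destruct (list_bounded l (fun c B => forall i, (i < d)%nat -> Rabs (fst c i) <= B)) as (B & HB & H).
  { intros a r s Hrs Ha i Hi. specialize (Ha i Hi). lra. }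
  { intros [x r] _. apply finite_max. }
  exists (B + 1). split; [lra|]. intros y Hy i Hi.
  destruct (Hc y Hy) as (x & r & Ic & Hn). destruct (Hl x r Ic) as [_ ->].
  specialize (H _ Ic i Hi). specialize (Hn i Hi). simpl in H.
  replace (y i) with (x i - (x i - y i)) by ring.
  pose proof (Rabs_triang (x i) (- (x i - y i))). rewrite Rabs_Ropp in *. unfold Rminus at 1. lra.
Qed.

(** The factor 2 leaves room for a second point: if [x] is in the box of radius [r] and [y] is close
    to [x], both are in the doubled box. *)
Lemma cont_near (f : fn) (x : pt) (eps : R) : cont_on d M f -> M x -> 0 < eps ->
  exists r, 0 < r /\ forall y, M y -> near d x y (2 * r) -> Cnorm (Cadd (f y) (Copp (f x))) < eps.
Proof.
  intros Hf Hx He. destruct (Hf x Hx eps He) as (del & Hd & H).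
  assert (HD : 1 <= INR d) by (apply (le_INR 1); auto).
  (* The doubled box then has Euclidean radius at most [del / 2], by [near_dist]. *)
  exists (del / (4 * INR d)). assert (Hr : 0 < del / (4 * INR d)).
  { apply Rmult_lt_0_compat; auto. apply Rinv_0_lt_compat. lra. }
  split; auto. intros y Hy Hn. apply H; auto.
  eapply Rle_lt_trans; [apply near_dist; [|apply Hn]; lra|].
  replace (INR d * (2 * (del / (4 * INR d)))) with (del / 2) by (field; lra). lra.
Qed.

(** The Lebesgue number is the smallest radius of a finite cover by boxes on whose doubles [f]
    varies by less than [eps / 2] from the centre. *)
Lemma cont_uniform (f : fn) (eps : R) : cont_on d M f -> 0 < eps ->
  exists r, 0 < r /\ forall x y, M x -> M y -> near d x y r -> Cnorm (Cadd (f y) (Copp (f x))) <= eps.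
Proof.
  intros Hf He.
  destruct (compact_boxes (fun x r => forall y, M y -> near d x y (2 * r) ->
     Cnorm (Cadd (f y) (Copp (f x))) < eps / 2)) as (l & Hl & Hc).
  { intros x Hx. apply cont_near; auto. lra. }
  assert (Hr : exists r, 0 < r /\ forall x s, In (x, s) l -> r <= s).
  { clear Hc. induction l as [|[x s] l IH].
    - exists 1. split; [lra|]. intros x s [].
    - destruct IH as (r & Hr & H); [intros; apply Hl; right; auto|].
      destruct (Hl x s (or_introl eq_refl)) as [Hs _].
      exists (Rmin r s). split; [apply Rmin_glb_lt; auto|].
      intros x' s' [Ec|Ic].
      + inversion Ec; subst. apply Rmin_r.
      + specialize (H x' s' Ic). pose proof (Rmin_l r s). lra. }
  destruct Hr as (r & Hr & Hmin). exists r. split; auto. intros x y Hx Hy Hn.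
  destruct (Hc x Hx) as (c & s & Ic & Hcx). destruct (Hl c s Ic) as [Hs HQ].
  specialize (Hmin c s Ic).
  assert (H1 : Cnorm (Cadd (f x) (Copp (f c))) < eps / 2).
  { apply HQ; auto. intros i Hi. specialize (Hcx i Hi). lra. }
  assert (H2 : Cnorm (Cadd (f y) (Copp (f c))) < eps / 2).
  { apply HQ; auto. intros i Hi. specialize (Hcx i Hi). specialize (Hn i Hi).
    replace (c i - y i) with ((c i - x i) + (x i - y i)) by ring.
    pose proof (Rabs_triang (c i - x i) (x i - y i)). lra. }
  replace (Cadd (f y) (Copp (f x))) with
    (Cadd (Cadd (f y) (Copp (f c))) (Copp (Cadd (f x) (Copp (f c))))) by ring.
  pose proof (Cnorm_add (Cadd (f y) (Copp (f c))) (Copp (Cadd (f x) (Copp (f c))))) as H3.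
  rewrite Cnorm_opp in H3. lra.
Qed.

Lemma cont_bounded (f : fn) : cont_on d M f -> exists B, 0 <= B /\ sup_le M f B.
Proof.
  intros Hf.
  destruct (compact_boxes (fun x r => forall y, M y -> near d x y (2 * r) ->
     Cnorm (Cadd (f y) (Copp (f x))) < 1)) as (l & Hl & Hc).
  { intros x Hx. apply cont_near; auto. lra. }
  destruct (list_bounded l (fun c B => Cnorm (f (fst c)) <= B)) as (B & HB & H).
  { intros; lra. }
  { intros [x r] _. exists (Cnorm (f x)). split; [apply Cnorm_nonneg|simpl; lra]. }
  exists (B + 1). split; [lra|]. intros y Hy.
  destruct (Hc y Hy) as (c & s & Ic & Hcy). destruct (Hl c s Ic) as [Hs HQ].
  assert (H1 : Cnorm (Cadd (f y) (Copp (f c))) < 1).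
  { apply HQ; auto. intros i Hi. specialize (Hcy i Hi). lra. }
  specialize (H _ Ic). simpl in H.
  replace (f y) with (Cadd (f c) (Cadd (f y) (Copp (f c)))) by ring.
  eapply Rle_trans; [apply Cnorm_add|]. lra.
Qed.

(** * Partitions of unity of bounded multiplicity *)

Definition tent (s : R) : R := Rmax 0 (1 - Rabs s).

Lemma tent_nonneg (s : R) : 0 <= tent s.
Proof. apply Rmax_l. Qed.

Lemma tent_lipschitz (s t : R) : Rabs (tent s - tent t) <= Rabs (s - t).
Proof.
  unfold tent, Rmax. repeat destruct Rle_dec; unfold Rabs in *; repeat destruct Rcase_abs; lra.
Qed.

Lemma sqrt_diff (a b : R) : 0 <= a -> 0 <= b -> Rabs (sqrt a - sqrt b) <= sqrt (Rabs (a - b)).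
Proof.
  assert (H : forall a b, 0 <= b <= a -> sqrt a - sqrt b <= sqrt (a - b)).
  { intros u v Huv. apply Rplus_le_reg_l with (sqrt v).
    replace (sqrt v + (sqrt u - sqrt v)) with (sqrt u) by ring.
    pose proof (sqrt_pos v). pose proof (sqrt_pos (u - v)).
    apply Rsqr_incr_0_var; [|lra]. unfold Rsqr. rewrite sqrt_sqrt by lra.
    pose proof (sqrt_sqrt v ltac:(lra)). pose proof (sqrt_sqrt (u - v) ltac:(lra)). nra. }
  intros Ha Hb. destruct (Rle_dec b a) as [Hl|Hl].
  - rewrite (Rabs_pos_eq (a - b)) by lra. rewrite Rabs_pos_eq; auto.
    pose proof (sqrt_le_1_alt b a Hl). lra.
  - apply Rnot_le_lt in Hl. rewrite (Rabs_minus_sym a b), Rabs_minus_sym.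
    rewrite (Rabs_pos_eq (b - a)) by lra. rewrite Rabs_pos_eq; [apply H; lra|].
    pose proof (sqrt_le_1_alt a b ltac:(lra)). lra.
Qed.

(** Tents of spacing [dl] are a partition of unity of which at most two members are nonzero at a
    point. Their square roots have squares adding up to 1 and values in the unit interval, whence
    the bound 2. *)
Lemma partition_1d (B dl : R) : 0 <= B -> 0 < dl ->
  exists (m : nat) (c : nat -> R -> R), (0 < m)%nat /\
    (forall k u eps, 0 < eps -> exists r, 0 < r /\ forall v, Rabs (u - v) < r -> Rabs (c k v - c k u) < eps) /\
    (forall k u, 0 <= c k u) /\
    (forall u, Rabs u <= B -> rsum m (fun k => c k u * c k u) = 1 /\ rsum m (fun k => c k u) <= 2) /\
    (forall k u v, c k u <> 0 -> c k v <> 0 -> Rabs (u - v) < 2 * dl).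
Proof.
  (* The extra 2 ensures that both tents that meet a point of the interval have an index below
     [m]. *)
  intros HB Hd. destruct (INR_unbounded (2 * B / dl + 2)) as [m Hm].
  set (s := fun u k => (u + B) / dl - INR k).
  exists m, (fun k u => sqrt (tent (s u k))).
  assert (Hsd : forall u v k, Rabs (s u k - s v k) = Rabs (u - v) / dl).
  { intros u v k. unfold s. replace ((u + B) / dl - INR k - ((v + B) / dl - INR k)) with ((u - v) * / dl)
      by (field; lra). rewrite Rabs_mult, (Rabs_pos_eq (/ dl)); [reflexivity|].
    left; apply Rinv_0_lt_compat; auto. }
  assert (Hd' : 0 < / dl) by (apply Rinv_0_lt_compat; auto).
  assert (Hfloor : forall u, Rabs u <= B -> exists j, (S j < m)%nat /\ 0 <= s u j <= 1 /\
    forall i, i <> j -> i <> S j -> tent (s u i) = 0).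
  { intros u Hu0. assert (Hu : 0 <= (u + B) / dl).
    { apply Rmult_le_pos; [|lra]. unfold Rabs in *. destruct (Rcase_abs u); lra. }
    destruct (archimed ((u + B) / dl)) as [A1 A2].
    assert (Hz : (0 < up ((u + B) / dl))%Z) by (apply lt_IZR; simpl; lra).
    (* As [up] is the least integer strictly above its argument, this is the integer part. *)
    set (j := Z.to_nat (up ((u + B) / dl) - 1)).
    assert (Hj : INR j = IZR (up ((u + B) / dl)) - 1).
    { unfold j. rewrite INR_IZR_INZ, Z2Nat.id by lia. rewrite minus_IZR. reflexivity. }
    exists j. split; [|split].
    - apply INR_lt. rewrite S_INR. assert ((u + B) / dl <= 2 * B / dl); [|lra].
      apply Rmult_le_compat_r; [lra|]. unfold Rabs in *. destruct (Rcase_abs u); lra.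
    - unfold s. lra.
    - intros i Hi1 Hi2.
      assert (Hn : INR i <= INR j - 1 \/ INR j + 2 <= INR i).
      { destruct (le_lt_dec i j).
        - left. assert (Hij : (i + 1 <= j)%nat) by lia. apply le_INR in Hij. rewrite plus_INR in Hij.
          simpl in Hij. lra.
        - right. assert (Hij : (j + 2 <= i)%nat) by lia. apply le_INR in Hij. rewrite plus_INR in Hij.
          simpl in Hij. lra. }
      unfold s, tent, Rmax, Rabs. destruct Rcase_abs, Rle_dec; lra. }
  repeat split.
  - apply INR_lt. simpl. assert (0 <= 2 * B / dl); [|lra]. apply Rmult_le_pos; lra.
  - intros k u eps He. exists (dl * (eps * eps / 2)). split; [apply Rmult_lt_0_compat; nra|].
    intros v Hv. eapply Rle_lt_trans; [apply sqrt_diff; apply tent_nonneg|].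
    rewrite <- (sqrt_Rsqr eps) by lra. apply sqrt_lt_1_alt. split; [apply Rabs_pos|].
    eapply Rle_lt_trans; [apply tent_lipschitz|]. rewrite Hsd, Rabs_minus_sym. unfold Rsqr.
    apply Rmult_lt_reg_r with dl; auto. unfold Rdiv. rewrite Rmult_assoc, Rinv_l by lra. nra.
  - intros; apply sqrt_pos.
  - rewrite (gsum_ext _ _ m _ (fun k => tent (s u k))) by (intros; apply sqrt_sqrt, tent_nonneg).
    destruct (Hfloor u H) as (j & Hjm & Hw & Hout). rewrite (rsum_shift_two m j) by auto.
    unfold s. rewrite S_INR. replace ((u + B) / dl - (INR j + 1)) with (s u j - 1) by (unfold s; ring).
    fold (s u j). unfold tent, Rmax, Rabs. repeat destruct Rle_dec; repeat destruct Rcase_abs; lra.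
  - destruct (Hfloor u H) as (j & Hjm & Hw & Hout).
    assert (H1 : forall k, sqrt (tent (s u k)) <= 1).
    { intros k. rewrite <- sqrt_1. apply sqrt_le_1_alt. unfold tent.
      apply Rmax_lub; [lra|]. pose proof (Rabs_pos (s u k)). lra. }
    rewrite (rsum_shift_two m j); auto.
    + pose proof (H1 j). pose proof (H1 (S j)). lra.
    + intros i Hi1 Hi2. rewrite Hout by auto. apply sqrt_0.
  - intros k u v Hu Hv.
    assert (Hn : forall u, sqrt (tent (s u k)) <> 0 -> Rabs (s u k) < 1).
    { intros w Hw. apply Rnot_le_lt. intros Hl. apply Hw. rewrite <- sqrt_0. f_equal.
      unfold tent. apply Rmax_left. lra. }
    pose proof (Hn u Hu). pose proof (Hn v Hv).
    assert (Hs : Rabs (s u k - s v k) < 2).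
    { unfold Rminus. eapply Rle_lt_trans; [apply Rabs_triang|]. rewrite Rabs_Ropp. lra. }
    rewrite Hsd in Hs. apply Rmult_lt_reg_r with (/ dl); auto.
    rewrite Rmult_assoc, Rinv_r by lra. unfold Rdiv in Hs. lra.
Qed.

Lemma rsum_prod (k m : nat) (F : nat -> nat -> R) : (0 < m)%nat ->
  rsum (k * m) (fun t => F (t / m)%nat (t mod m)%nat) = rsum k (fun i => rsum m (F i)).
Proof.
  intros Hm. induction k as [|k IH]; [reflexivity|].
  replace (S k * m)%nat with (k * m + m)%nat by lia. rewrite rsum_split, IH. simpl. f_equal.
  apply gsum_ext. intros i Hi. f_equal.
  - rewrite Nat.div_add_l by lia. rewrite Nat.div_small by lia. lia.
  - rewrite Nat.add_comm, Nat.Div0.mod_add. apply Nat.mod_small. lia.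
Qed.

(** Products over the coordinates, with the pair of indices encoded by quotient and remainder. Both
    sums factorize, so every coordinate contributes a factor 2, whatever the mesh. *)
Lemma partition_nd (B dl : R) (j : nat) : 0 <= B -> 0 < dl -> (j <= d)%nat ->
  exists (k : nat) (g : nat -> pt -> R),
    (forall i, cont_on d M (fun y => RC (g i y))) /\ (forall i x, 0 <= g i x) /\
    (forall x, (forall i, (i < d)%nat -> Rabs (x i) <= B) ->
       rsum k (fun i => g i x * g i x) = 1 /\ rsum k (fun i => g i x) <= 2 ^ j) /\
    (forall i x y, g i x <> 0 -> g i y <> 0 -> forall l, (l < j)%nat -> Rabs (x l - y l) < 2 * dl).
Proof.
  intros HB Hd. induction j as [|j IH]; intros Hj.
  - exists 1%nat, (fun _ _ => 1). split; [|split; [|split]].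
    + intros i. apply cont_const.
    + intros; lra.
    + intros x Hx. simpl. lra.
    + intros; lia.
  - destruct IH as (k & g & G1 & G2 & G3 & G4); [lia|].
    destruct (partition_1d B dl HB Hd) as (m & c & Hm & A1 & A2 & A3 & A4).
    exists (k * m)%nat, (fun t x => g (t / m)%nat x * c (t mod m)%nat (x j)).
    split; [|split; [|split]].
    + intros t.
      replace (fun y => RC (g (t / m)%nat y * c (t mod m)%nat (y j))) with
        (fmul (fun y => RC (g (t / m)%nat y)) (fun y => RC (c (t mod m)%nat (y j))))
        by (apply functional_extensionality; intros; unfold fmul; rewrite RC_mul; auto).
      apply cont_mul; auto. intros x _ eps He.
      destruct (A1 (t mod m)%nat (x j) eps He) as (r & Hr & H). exists r. split; auto.
      intros y _ Hy. rewrite <- RC_opp, <- RC_add, Cnorm_RC. apply H. apply dist_near; auto.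
    + intros t x. apply Rmult_le_pos; auto.
    + intros x Hx. destruct (G3 x Hx) as [G5 G6].
      destruct (A3 (x j) (Hx j ltac:(lia))) as [A5 A6]. split.
      * rewrite (gsum_ext _ _ _ _ (fun t => (fun i l => (g i x * g i x) * (c l (x j) * c l (x j)))
           (t / m)%nat (t mod m)%nat)) by (intros; ring).
        rewrite (rsum_prod k m (fun i l => (g i x * g i x) * (c l (x j) * c l (x j)))) by auto.
        rewrite (gsum_ext _ _ k _ (fun i => g i x * g i x)); auto.
        intros i _. rewrite rsum_scal, A5. ring.
      * rewrite (rsum_prod k m (fun i l => g i x * c l (x j))) by auto.
        apply Rle_trans with (rsum k (fun i => 2 * g i x)).
        -- apply rsum_le. intros i _. rewrite rsum_scal. specialize (G2 i x). nra.
        -- rewrite rsum_scal. simpl. lra.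
    + intros t x y Hx Hy l Hl.
      assert (g (t / m)%nat x <> 0) by (intros E0; apply Hx; rewrite E0; ring).
      assert (g (t / m)%nat y <> 0) by (intros E0; apply Hy; rewrite E0; ring).
      assert (c (t mod m)%nat (x j) <> 0) by (intros E0; apply Hx; rewrite E0; ring).
      assert (c (t mod m)%nat (y j) <> 0) by (intros E0; apply Hy; rewrite E0; ring).
      destruct (Nat.eq_dec l j) as [->|Hn]; [eapply A4; eauto|].
      apply (G4 (t / m)%nat); auto. lia.
Qed.

(** The [g i] are square roots of a partition of unity. The bound [C] on their plain sum bounds
    every combination with coefficients of modulus one, in particular all sign sums. *)
Definition is_partition (dl C : R) (k : nat) (g : nat -> pt -> R) (x : nat -> pt) : Prop :=
  (forall i, M (x i)) /\ (forall i, cont_on d M (fun y => RC (g i y))) /\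
  (forall i y, 0 <= g i y) /\
  (forall y, M y -> rsum k (fun i => g i y * g i y) = 1 /\ rsum k (fun i => g i y) <= C) /\
  (forall i y, M y -> g i y <> 0 -> near d (x i) y dl).

Lemma partition_exists : (exists x, M x) ->
  forall dl, 0 < dl -> exists k g x, is_partition dl (2 ^ d) k g x.
Proof.
  intros [x0 Hx0] dl Hd. destruct compact_coord_bounded as (B & HB & HM).
  (* Two points of one support differ by less than twice the mesh in each coordinate, hence the
     half. *)
  destruct (partition_nd B (dl / 2) d HB ltac:(lra) (le_n d)) as (k & g & G1 & G2 & G3 & G4).
  (* The base point is taken in the support of [g i]; if [g i] vanishes on [M], the default [x0]
     does. *)
  assert (Hx : forall i, exists x, M x /\ ((exists y, M y /\ g i y <> 0) -> g i x <> 0)).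
  { intros i. destruct (classic (exists y, M y /\ g i y <> 0)) as [(y & My & Hy)|Hn].
    - exists y. auto.
    - exists x0. split; auto. }
  exists k, g, (fun i => proj1_sig (constructive_indefinite_description _ (Hx i))).
  split; [|split; [|split; [|split]]].
  - intros i. destruct constructive_indefinite_description as [x [H1 H2]]; auto.
  - exact G1.
  - auto.
  - intros y My. apply G3. intros l Hl. apply HM; auto.
  - intros i y My Hy. destruct constructive_indefinite_description as [x [H1 H2]]; simpl.
    intros l Hl. replace dl with (2 * (dl / 2)) by field. apply (G4 i); auto. apply H2. eauto.
Qed.

End Euclid.

(** * The decomposition of l^p as an l^p-sum of copies of l^p *)

Section Slices.
Context {E : exponent}.
Notation p := pexp.

(** Cantor's pairing identifies l^p with [l^p(N; l^p)]; [Cs n] is the [n]-th coordinate map and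
    [Js n] below the [n]-th inclusion. *)
Definition Cs (n : nat) : Bop := mkB (fun x t => lv x (to_nat (n, t))).

Lemma pair_pow_sums (x : LP) (N M : nat) :
  rsum N (fun n => rsum M (fun s => rpow (Cnorm (lv x (to_nat (n, s)))) p)) <= rpow (nrm x) p.
Proof.
  apply (pair_sum_le_seq (fun n s => rpow (Cnorm (lv x (to_nat (n, s)))) p)).
  - intros; apply rpow_nonneg.
  - intros K. rewrite (gsum_ext _ _ K _ (fun t => rpow (Cnorm (lv x t)) p)).
    + apply nrm_pow_le.
    + intros t _. destruct (of_nat t) as [n s] eqn:Et. rewrite <- Et, cancel_to_of. reflexivity.
Qed.

Lemma Cs_good (n : nat) : good_map (fun x t => lv x (to_nat (n, t))).
Proof.
  apply good_map_intro with 1; try lra; try (intros; lvs; reflexivity).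
  intros x. rewrite Rmult_1_l. apply lp_norm_le_iff. split; [apply nrm_nonneg|]. intros M.
  eapply Rle_trans; [|apply (pair_pow_sums x (S n) M)].
  apply (rsum_ge_term (S n) n (fun n => rsum M (fun s => rpow (Cnorm (lv x (to_nat (n, s)))) p))); auto.
  intros i. apply rsum_nonneg. intros; apply rpow_nonneg.
Qed.

Lemma Cs_app (n : nat) (x : LP) (t : nat) : lv (Cs n x) t = lv x (to_nat (n, t)).
Proof. unfold Cs. rewrite mkB_app; auto. apply Cs_good. Qed.

Lemma lv_slice (x : LP) (t : nat) : lv x t = lv (Cs (fst (of_nat t)) x) (snd (of_nat t)).
Proof. rewrite Cs_app, <- surjective_pairing, cancel_to_of. reflexivity. Qed.

Lemma slice_ext (x y : LP) : (forall n, Cs n x = Cs n y) -> x = y.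
Proof. intros H. apply LP_ext. intros t. rewrite (lv_slice x), (lv_slice y), H. reflexivity. Qed.

Lemma slice_ext_op (A B : Bop) : (forall n, Cs n [*] A = Cs n [*] B) -> A = B.
Proof.
  intros H. apply Bop_ext. intros x. apply slice_ext. intros n.
  change ((Cs n [*] A) x = (Cs n [*] B) x). rewrite H. reflexivity.
Qed.

(** Each norm is a supremum of truncations. The suprema are pulled out of the finite sum one slice
    at a time, since the truncations increase with [M]. *)
Lemma sum_nrm_pow_le (z : nat -> LP) (N : nat) (S : R) :
  (forall M, rsum N (fun n => rsum M (fun s => rpow (Cnorm (lv (z n) s)) p)) <= S) ->
  rsum N (fun n => rpow (nrm (z n)) p) <= S.
Proof.
  revert S. induction N as [|N IH]; intros S HS; cbn [gsum] in *; [apply (HS 0%nat)|].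
  assert (rpow (nrm (z N)) p <= S - rsum N (fun n => rpow (nrm (z n)) p)); [|lra].
  apply nrm_pow_le_of_sums. intros M'.
  assert (rsum N (fun n => rpow (nrm (z n)) p) <=
    S - rsum M' (fun s => rpow (Cnorm (lv (z N) s)) p)); [|lra].
  apply IH. intros M. specialize (HS (M + M')%nat).
  assert (rsum N (fun n => rsum M (fun s => rpow (Cnorm (lv (z n) s)) p)) <=
          rsum N (fun n => rsum (M + M') (fun s => rpow (Cnorm (lv (z n) s)) p))).
  { apply rsum_le. intros i _. apply rsum_mono; [lia|]. intros; apply rpow_nonneg. }
  assert (rsum M' (fun s => rpow (Cnorm (lv (z N) s)) p) <=
          rsum (M + M') (fun s => rpow (Cnorm (lv (z N) s)) p)).
  { apply rsum_mono; [lia|]. intros; apply rpow_nonneg. }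
  lra.
Qed.

Lemma slice_norm_ge (x : LP) (N : nat) :
  rsum N (fun n => rpow (nrm (Cs n x)) p) <= rpow (nrm x) p.
Proof.
  apply sum_nrm_pow_le. intros M. eapply Rle_trans; [|apply (pair_pow_sums x N M)].
  right. apply gsum_ext. intros n _. apply gsum_ext. intros s _. rewrite Cs_app. reflexivity.
Qed.

Lemma glue_sums (z : nat -> LP) (S : R) :
  (forall N, rsum N (fun n => rpow (nrm (z n)) p) <= S) ->
  forall N, rsum N (fun t => rpow (Cnorm (let '(n, s) := of_nat t in lv (z n) s)) p) <= S.
Proof.
  intros H N.
  rewrite (gsum_ext _ _ N _ (fun t => let '(n, s) := of_nat t in rpow (Cnorm (lv (z n) s)) p))
    by (intros t _; destruct (of_nat t); reflexivity).
  apply (pair_sum_seq_le (fun n s => rpow (Cnorm (lv (z n) s)) p)).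
  - intros; apply rpow_nonneg.
  - intros N' M. eapply Rle_trans; [|apply (H N')]. apply rsum_le. intros n _. apply nrm_pow_le.
Qed.

Lemma slice_norm_le (x : LP) (S : R) :
  (forall N, rsum N (fun n => rpow (nrm (Cs n x)) p) <= S) -> rpow (nrm x) p <= S.
Proof.
  intros H. apply nrm_pow_le_of_sums. intros N.
  rewrite (gsum_ext _ _ N _ (fun t => rpow (Cnorm (let '(n, s) := of_nat t in lv (Cs n x) s)) p)).
  - apply (glue_sums (fun n => Cs n x)). auto.
  - intros t _. destruct (of_nat t) as [n s] eqn:Et. rewrite Cs_app, <- Et, cancel_to_of. reflexivity.
Qed.

(** * Columns and block-diagonal operators *)

Definition col (V : nat -> Bop) : Bop := mkB (fun x t => let '(n, s) := of_nat t in lv (V n x) s).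

Definition col_bound (V : nat -> Bop) (B : R) : Prop :=
  0 <= B /\ forall x N, rsum N (fun n => rpow (nrm (V n x)) p) <= rpow (B * nrm x) p.

Lemma col_lp (V : nat -> Bop) (B : R) : col_bound V B ->
  forall x, lp_norm_le p (fun t => let '(n, s) := of_nat t in lv (V n x) s) (B * nrm x).
Proof.
  intros [HB H] x. apply lp_norm_le_iff. split; [apply Rmult_le_pos; auto using nrm_nonneg|].
  apply (glue_sums (fun n => V n x)). apply H.
Qed.

Lemma col_good (V : nat -> Bop) (B : R) : col_bound V B ->
  good_map (fun x t => let '(n, s) := of_nat t in lv (V n x) s).
Proof.
  intros H. apply good_map_intro with B; try apply H; try apply (col_lp V B H).
  - intros x y t. destruct (of_nat t). rewrite b_add. lvs. reflexivity.
  - intros c x t. destruct (of_nat t). rewrite b_scale. lvs. reflexivity.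
Qed.

Lemma ob_col (V : nat -> Bop) (B : R) : col_bound V B -> ob (col V) B.
Proof. intros H. apply ob_mkB; [eapply col_good; eauto|apply H|apply col_lp; auto]. Qed.

Lemma Cs_col (V : nat -> Bop) (B : R) (n : nat) : col_bound V B -> Cs n [*] col V = V n.
Proof.
  intros H. apply Bop_ext. intros x. apply LP_ext. intros t. bapps. rewrite Cs_app.
  unfold col. rewrite mkB_app by (eapply col_good; eauto). rewrite cancel_of_to. reflexivity.
Qed.

Definition Js (n : nat) : Bop := col (fun m => if (m =? n)%nat then bid else bzero).

Lemma Js_bound (n : nat) : col_bound (fun m => if (m =? n)%nat then bid else bzero) 1.
Proof.
  split; [lra|]. intros x N. rewrite Rmult_1_l.
  destruct (le_lt_dec N n) as [H|H].
  - rewrite (gsum_ext _ _ N _ (fun _ => 0)), rsum_const.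
    + pose proof (rpow_nonneg (nrm x) p). lra.
    + intros i Hi. destruct (Nat.eqb_spec i n); [lia|]. simpl. rewrite nrm_zero, rpow_0; auto.
  - rewrite (rsum_single N n); auto.
    + rewrite Nat.eqb_refl. simpl. lra.
    + intros i Hi Hn. destruct (Nat.eqb_spec i n); [lia|]. simpl. rewrite nrm_zero, rpow_0; auto.
Qed.

Lemma ob_Js (n : nat) : ob (Js n) 1.
Proof. apply ob_col, Js_bound. Qed.

Lemma ob_Cs (n : nat) : ob (Cs n) 1.
Proof.
  split; [lra|]. intros x. rewrite Rmult_1_l. apply rpow_le_inv with p; auto using pexp_pos, nrm_nonneg.
  eapply Rle_trans; [|apply (slice_norm_ge x (S n))].
  apply (rsum_ge_term (S n) n (fun n => rpow (nrm (Cs n x)) p)); auto. intros; apply rpow_nonneg.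
Qed.

Lemma Cs_Js (m n : nat) : Cs m [*] Js n = if (m =? n)%nat then bid else bzero.
Proof. exact (Cs_col _ 1 m (Js_bound n)). Qed.

Lemma Cs_Js_same (n : nat) : Cs n [*] Js n = bid.
Proof. rewrite Cs_Js, Nat.eqb_refl. reflexivity. Qed.

Definition BD (A : nat -> Bop) : Bop := col (fun n => A n [*] Cs n).

Lemma BD_bound (A : nat -> Bop) (B : R) : (forall n, ob (A n) B) ->
  col_bound (fun n => A n [*] Cs n) B.
Proof.
  intros H. assert (HB : 0 <= B) by apply (H 0%nat). split; auto. intros x N.
  rewrite rpow_mult by auto using nrm_nonneg.
  eapply Rle_trans; [|apply Rmult_le_compat_l; [apply rpow_nonneg|apply (slice_norm_ge x N)]].
  rewrite <- rsum_scal. apply rsum_le. intros n _. rewrite <- rpow_mult by auto using nrm_nonneg.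
  apply rpow_le; [apply pexp_nonneg|]. split; [apply nrm_nonneg|]. apply (proj2 (H n)).
Qed.

Lemma ob_BD (A : nat -> Bop) (B : R) : (forall n, ob (A n) B) -> ob (BD A) B.
Proof. intros H. apply ob_col, BD_bound; auto. Qed.

Lemma Cs_BD (A : nat -> Bop) (B : R) (n : nat) : (forall n, ob (A n) B) -> Cs n [*] BD A = A n [*] Cs n.
Proof. intros H. exact (Cs_col _ B n (BD_bound A B H)). Qed.

Lemma BD_Js (A : nat -> Bop) (B : R) (n : nat) : (forall n, ob (A n) B) -> BD A [*] Js n = Js n [*] A n.
Proof.
  intros H. apply slice_ext_op. intros m.
  rewrite <- !bcompA, (Cs_BD A B), bcompA, !Cs_Js by auto.
  destruct (Nat.eqb_spec m n) as [->|]; [rewrite bcomp1r, bcomp1l|rewrite bcomp0r, bcomp0l]; reflexivity.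
Qed.

(** * Compactness criteria along the slices *)

Definition Rn (N : nat) : Bop := bsum N (fun n => Js n [*] Cs n).

Lemma Cs_bsum_Js (m N : nat) (F : nat -> Bop) :
  Cs m [*] bsum N (fun n => Js n [*] F n) = if (m <? N)%nat then F m else bzero.
Proof.
  rewrite bsum_comp_l. destruct (Nat.ltb_spec m N).
  - rewrite (bsum_single N m); auto.
    + rewrite <- bcompA, Cs_Js_same, bcomp1l. reflexivity.
    + intros i Hi Hn. rewrite <- bcompA, Cs_Js. destruct (Nat.eqb_spec m i); [lia|]. apply bcomp0l.
  - apply bsum_zero. intros i Hi. rewrite <- bcompA, Cs_Js.
    destruct (Nat.eqb_spec m i); [lia|]. apply bcomp0l.
Qed.

(** The coordinate [t] belongs to a slice of index at most [t], so the first [N] slices contain all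
    coordinates below [N]. *)
Lemma Rn_tail (x : LP) (N : nat) : nrm (lsub x (Rn N x)) <= nrm (Qm N x).
Proof.
  apply nrm_dom. intros t. unfold lsub. lvs. rewrite (lv_slice (Rn N x)).
  assert (EC : Cs (fst (of_nat t)) (Rn N x) =
    (if (fst (of_nat t) <? N)%nat then Cs (fst (of_nat t)) else bzero) x).
  { rewrite <- (Cs_bsum_Js _ N Cs). reflexivity. }
  rewrite EC, Qm_app. pose proof (fst_of_nat_le t).
  destruct (Nat.ltb_spec (fst (of_nat t)) N).
  - rewrite <- lv_slice. replace (Cadd (lv x t) (Cmul (Copp C1) (lv x t))) with C0 by ring.
    rewrite Cnorm_C0. apply Cnorm_nonneg.
  - destruct (Nat.ltb_spec t N); [lia|]. cbn [bapp bzero]. rewrite lv_zero.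
    replace (Cadd (lv x t) (Cmul (Copp C1) C0)) with (lv x t) by ring. lra.
Qed.

Lemma geometric_tail (N k : nat) : rsum k (fun i => (/ 2) ^ (N + i)) <= 2 * (/ 2) ^ N.
Proof.
  assert (H : rsum k (fun i => (/ 2) ^ (N + i)) = 2 * (/ 2) ^ N - 2 * (/ 2) ^ (N + k)).
  { induction k as [|k IH]; simpl.
    - rewrite Nat.add_0_r. ring.
    - rewrite IH, Nat.add_succ_r. simpl. field. }
  rewrite H. assert (0 < (/ 2) ^ (N + k)) by (apply pow_lt; lra). lra.
Qed.

Lemma pow_half_small (c eps : R) (n0 : nat) : 0 < eps -> exists N, (n0 <= N)%nat /\ c * (/ 2) ^ N <= eps.
Proof.
  intros He. destruct (pow_lt_1_zero (/ 2)) with (y := eps / (Rabs c + 1)) as [N HN].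
  - rewrite Rabs_pos_eq; lra.
  - pose proof (Rabs_pos c). apply Rmult_lt_0_compat; auto. apply Rinv_0_lt_compat; lra.
  - exists (Nat.max n0 N). split; [lia|]. specialize (HN (Nat.max n0 N) ltac:(lia)).
    assert (Hp : 0 < (/ 2) ^ Nat.max n0 N) by (apply pow_lt; lra).
    rewrite Rabs_pos_eq in HN by lra. pose proof (Rabs_pos c). pose proof (Rle_abs c).
    apply Rle_trans with ((Rabs c + 1) * (eps / (Rabs c + 1))); [|right; field; lra].
    apply Rle_trans with ((Rabs c + 1) * (/ 2) ^ Nat.max n0 N); nra.
Qed.

Lemma Rn_split (N k : nat) : Rn (N + k) = Rn N [+] bsum k (fun i => Js (N + i) [*] Cs (N + i)).
Proof.
  unfold Rn. induction k as [|k IH]; simpl.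
  - rewrite Nat.add_0_r. bop.
  - rewrite Nat.add_succ_r. simpl. rewrite IH. bop.
Qed.

Lemma nrm_limit_Rn (A : Bop) (x : LP) (b : R) (N0 : nat) :
  (forall N, (N0 <= N)%nat -> nrm (A (Rn N x)) <= b) -> nrm (A x) <= b.
Proof.
  intros H. apply le_epsilon. intros eps He.
  destruct (ob_exists A) as (r & Hr & HA).
  destruct (Qm_tail x (eps / (r + 1))) as [m0 Hm0].
  { apply Rmult_lt_0_compat; auto. apply Rinv_0_lt_compat; lra. }
  set (N := Nat.max N0 m0). specialize (H N ltac:(lia)). specialize (Hm0 N ltac:(lia)).
  pose proof (Rn_tail x N) as Ht.
  pose proof (nrm_triangle (A x) (A (Rn N x))) as T. rewrite <- b_sub in T.
  assert (nrm (A (lsub x (Rn N x))) <= eps); [|lra].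
  eapply Rle_trans; [apply HA|].
  apply Rle_trans with ((r + 1) * (eps / (r + 1))); [|right; field; lra].
  apply Rmult_le_compat; try lra. apply nrm_nonneg.
Qed.

(** The operators [D [*] Rn N] are compact, and the geometric decay of the rows makes them converge
    to [D] in norm; only the tail from [n0] on matters for this. *)
Lemma cpt_rows (D : Bop) (c : R) (n0 : nat) : (forall n, cpt (D [*] Js n)) ->
  (forall n, (n0 <= n)%nat -> ob (D [*] Js n) (c * (/ 2) ^ n)) -> cpt D.
Proof.
  intros HK HD. apply cpt_limit. intros eps He.
  destruct (pow_half_small (2 * c) eps n0 He) as (N & HN & Hs).
  exists (D [*] Rn N). split.
  { unfold Rn. rewrite bsum_comp_l. apply cpt_bsum. intros i _. rewrite <- bcompA. apply cpt_comp_r; auto. }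
  split; [lra|]. intros x. apply nrm_limit_Rn with N. intros N' HN'.
  replace ((D [-] D [*] Rn N) (Rn N' x)) with (bsum (N' - N) (fun i => D [*] Js (N + i) [*] Cs (N + i)) x).
  - assert (HO : ob (bsum (N' - N) (fun i => D [*] Js (N + i) [*] Cs (N + i)))
       (rsum (N' - N) (fun i => c * (/ 2) ^ (N + i)))).
    { apply ob_bsum. intros i _. rewrite <- (Rmult_1_r (c * _)). apply ob_comp; [apply HD; lia|apply ob_Cs]. }
    destruct HO as [_ HO]. eapply Rle_trans; [apply HO|].
    apply Rmult_le_compat_r; [apply nrm_nonneg|]. rewrite rsum_scal.
    assert (Hc : 0 <= c).
    { destruct (HD N HN) as [Hc _]. assert (0 < (/ 2) ^ N) by (apply pow_lt; lra). nra. }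
    eapply Rle_trans; [apply Rmult_le_compat_l; [auto|apply geometric_tail]|]. lra.
  - assert (HR : Rn N [*] Rn N' = Rn N).
    { unfold Rn at 1. rewrite bsum_comp_r. apply gsum_ext. intros i Hi. rewrite bcompA.
      unfold Rn. rewrite Cs_bsum_Js. destruct (Nat.ltb_spec i N'); [reflexivity|lia]. }
    change ((D [-] D [*] Rn N) (Rn N' x)) with (((D [-] D [*] Rn N) [*] Rn N') x).
    f_equal. transitivity (D [*] (Rn N' [-] Rn N [*] Rn N')); [|bop].
    rewrite HR. replace N' with (N + (N' - N))%nat at 2 by lia. rewrite Rn_split.
    transitivity (D [*] bsum (N' - N) (fun i => Js (N + i) [*] Cs (N + i))); [|bop].
    rewrite bsum_comp_l. apply gsum_ext. intros. rewrite bcompA. reflexivity.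
Qed.

Lemma cpt_cols (D : Bop) (c : R) (n0 : nat) : (forall n, cpt (Cs n [*] D)) ->
  (forall n, (n0 <= n)%nat -> ob (Cs n [*] D) (c * (/ 2) ^ n)) -> cpt D.
Proof.
  intros HK HD. apply cpt_limit. intros eps He.
  destruct (pow_half_small (2 * c) eps n0 He) as (N & HN & Hs).
  exists (Rn N [*] D). split.
  { unfold Rn. rewrite bsum_comp_r. apply cpt_bsum. intros i _. rewrite bcompA. apply cpt_comp_l; auto. }
  split; [lra|]. intros x.
  replace ((D [-] Rn N [*] D) x) with ((bid [-] Rn N) (D x)) by
    (change ((bid [-] Rn N) (D x)) with (((bid [-] Rn N) [*] D) x); f_equal; bop).
  apply nrm_limit_Rn with N. intros N' HN'.
  replace ((bid [-] Rn N) (Rn N' (D x))) with (bsum (N' - N) (fun i => Js (N + i) [*] (Cs (N + i) [*] D)) x).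
  - assert (HO : ob (bsum (N' - N) (fun i => Js (N + i) [*] (Cs (N + i) [*] D)))
       (rsum (N' - N) (fun i => c * (/ 2) ^ (N + i)))).
    { apply ob_bsum. intros i _. rewrite <- (Rmult_1_l (c * _)). apply ob_comp; [apply ob_Js|apply HD; lia]. }
    destruct HO as [_ HO]. eapply Rle_trans; [apply HO|].
    apply Rmult_le_compat_r; [apply nrm_nonneg|]. rewrite rsum_scal.
    assert (Hc : 0 <= c).
    { destruct (HD N HN) as [Hc _]. assert (0 < (/ 2) ^ N) by (apply pow_lt; lra). nra. }
    eapply Rle_trans; [apply Rmult_le_compat_l; [auto|apply geometric_tail]|]. lra.
  - assert (HR : Rn N [*] Rn N' = Rn N).
    { unfold Rn at 1. rewrite bsum_comp_r. apply gsum_ext. intros i Hi. rewrite bcompA.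
      unfold Rn. rewrite Cs_bsum_Js. destruct (Nat.ltb_spec i N'); [reflexivity|lia]. }
    change ((bid [-] Rn N) (Rn N' (D x))) with (((bid [-] Rn N) [*] Rn N' [*] D) x).
    f_equal. transitivity ((Rn N' [-] Rn N [*] Rn N') [*] D); [|bop].
    rewrite HR. replace N' with (N + (N' - N))%nat at 2 by lia. rewrite Rn_split.
    transitivity (bsum (N' - N) (fun i => Js (N + i) [*] Cs (N + i)) [*] D); [|bop].
    rewrite bsum_comp_r. apply gsum_ext. intros. rewrite bcompA. reflexivity.
Qed.

(* The sum is finite because [W n] is required not to reach the coordinates [t] with [t + 2 <= n]. *)
Definition row (W : nat -> Bop) : Bop :=
  mkB (fun y t => csum (t + 2) (fun n => lv (W n (Cs n y)) t)).

(** The first condition makes the defining sum of [row] finite. The second says that at most four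
    operators meet at a coordinate, which is the overlap of the nested cutoffs used later, and keeps
    the row bounded. *)
Definition row_local (W : nat -> Bop) : Prop :=
  (forall n t x, (t + 2 <= n)%nat -> lv (W n x) t = C0) /\
  (forall t, exists n0, forall n x, lv (W n x) t <> C0 -> (n0 <= n < n0 + 4)%nat).

(** A sum with at most four nonzero terms is at most four times its largest term. *)
Lemma window_sum_le (N n0 : nat) (a : nat -> R) : (forall n, 0 <= a n) ->
  (forall n, a n <> 0 -> (n0 <= n < n0 + 4)%nat) ->
  rpow (rsum N a) p <= rpow 4 p * rsum N (fun n => rpow (a n) p).
Proof.
  intros Ha Hw. set (S := rsum N (fun n => rpow (a n) p)).
  assert (HS : 0 <= S) by (apply rsum_nonneg; intros; apply rpow_nonneg).
  set (m := rpow S (/ p)). assert (Hm : 0 <= m) by apply rpow_nonneg.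
  assert (Ham : forall n, (n < N)%nat -> a n <= m).
  { intros n Hn. apply rpow_le_inv with p; auto using pexp_pos.
    unfold m. rewrite rpow_inv' by auto using pexp_pos.
    apply (rsum_ge_term N n (fun n => rpow (a n) p)); auto. intros; apply rpow_nonneg. }
  set (ind := fun n => if andb (n0 <=? n)%nat (n <? n0 + 4)%nat then 1 else 0).
  assert (Hi : forall n, 0 <= ind n) by (intros; unfold ind; destruct (andb _ _); lra).
  assert (H1 : rsum N a <= m * rsum N ind).
  { rewrite <- rsum_scal. apply rsum_le. intros n Hn. unfold ind.
    destruct (Nat.leb_spec n0 n); [destruct (Nat.ltb_spec n (n0 + 4))|]; simpl.
    - rewrite Rmult_1_r. auto.
    - rewrite Rmult_0_r. destruct (Req_dec (a n) 0) as [E0|E0]; [lra|]. apply Hw in E0. lia.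
    - rewrite Rmult_0_r. destruct (Req_dec (a n) 0) as [E0|E0]; [lra|]. apply Hw in E0. lia. }
  assert (H2 : rsum N ind <= 4).
  { apply Rle_trans with (rsum (n0 + (4 + N)) ind); [apply rsum_mono; [lia|auto]|].
    rewrite !rsum_split.
    rewrite (gsum_ext _ _ n0 _ (fun _ => 0)), rsum_const.
    2:{ intros i Hi'. unfold ind. destruct (Nat.leb_spec n0 i); [lia|reflexivity]. }
    rewrite (gsum_ext _ _ 4 _ (fun _ => 1)), rsum_const.
    2:{ intros i Hi'. unfold ind. destruct (Nat.leb_spec n0 (n0 + i)); [|lia].
        destruct (Nat.ltb_spec (n0 + i) (n0 + 4)); [reflexivity|lia]. }
    rewrite (gsum_ext _ _ N _ (fun _ => 0)), rsum_const.
    2:{ intros i Hi'. unfold ind. destruct (Nat.ltb_spec (n0 + (4 + i)) (n0 + 4)); [lia|].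
        rewrite Bool.andb_false_r. reflexivity. }
    simpl. lra. }
  apply Rle_trans with (rpow (4 * m) p).
  - apply rpow_le; [apply pexp_nonneg|]. split; [apply rsum_nonneg; auto|].
    eapply Rle_trans; [apply H1|]. rewrite Rmult_comm. apply Rmult_le_compat_r; auto.
  - rewrite rpow_mult by lra. unfold m. rewrite rpow_inv' by auto using pexp_pos. lra.
Qed.

Lemma row_lp (W : nat -> Bop) (B : R) : row_local W -> (forall n, ob (W n) B) ->
  forall y, lp_norm_le p (fun t => csum (t + 2) (fun n => lv (W n (Cs n y)) t)) (4 * B * nrm y).
Proof.
  intros [HL HW] HB y. assert (HB0 : 0 <= B) by apply (HB 0%nat).
  pose proof (nrm_nonneg y) as Hy.
  apply lp_norm_le_iff. split; [apply Rmult_le_pos; lra|]. intros T.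
  apply Rle_trans with (rsum T (fun t => rpow 4 p * rsum (T + 2) (fun n => rpow (Cnorm (lv (W n (Cs n y)) t)) p))).
  - apply rsum_le. intros t Ht.
    destruct (HW t) as [n0 Hn0].
    apply Rle_trans with (rpow 4 p * rsum (t + 2) (fun n => rpow (Cnorm (lv (W n (Cs n y)) t)) p)).
    + eapply Rle_trans; [apply rpow_le; [apply pexp_nonneg|split; [apply Cnorm_nonneg|apply csum_norm]]|].
      apply window_sum_le with n0; [intros; apply Cnorm_nonneg|].
      intros n Hn. apply (Hn0 n (Cs n y)). intros E0. apply Hn. rewrite E0. apply Cnorm_C0.
    + apply Rmult_le_compat_l; [apply rpow_nonneg|]. apply rsum_mono; [lia|]. intros; apply rpow_nonneg.
  - rewrite rsum_scal, rsum_swap, Rmult_assoc, rpow_mult by (try apply Rmult_le_pos; lra).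
    apply Rmult_le_compat_l; [apply rpow_nonneg|].
    apply Rle_trans with (rsum (T + 2) (fun n => rpow (nrm (W n (Cs n y))) p)).
    + apply rsum_le. intros n _. apply nrm_pow_le.
    + rewrite rpow_mult by auto.
      eapply Rle_trans; [|apply Rmult_le_compat_l; [apply rpow_nonneg|apply (slice_norm_ge y (T + 2))]].
      rewrite <- rsum_scal. apply rsum_le. intros n _. rewrite <- rpow_mult by auto using nrm_nonneg.
      apply rpow_le; [apply pexp_nonneg|]. split; [apply nrm_nonneg|apply HB].
Qed.

Lemma row_good (W : nat -> Bop) (B : R) : row_local W -> (forall n, ob (W n) B) ->
  good_map (fun y t => csum (t + 2) (fun n => lv (W n (Cs n y)) t)).
Proof.
  intros HL HB. assert (HB0 : 0 <= B) by apply (HB 0%nat).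
  apply good_map_intro with (4 * B); [| |lra|apply row_lp; auto].
  - intros x y t. rewrite <- csum_add. apply gsum_ext. intros. lin. lvs. reflexivity.
  - intros c x t. rewrite <- csum_scal. apply gsum_ext. intros. lin. lvs. reflexivity.
Qed.

Lemma row_app (W : nat -> Bop) (B : R) (y : LP) (t : nat) : row_local W -> (forall n, ob (W n) B) ->
  lv (row W y) t = csum (t + 2) (fun n => lv (W n (Cs n y)) t).
Proof. intros HL HB. unfold row. rewrite mkB_app; auto. eapply row_good; eauto. Qed.

Lemma csum_single (n k : nat) (F : nat -> CC) :
  (k < n)%nat -> (forall i, (i < n)%nat -> i <> k -> F i = C0) -> csum n F = F k.
Proof.
  induction n as [|n IH]; intros Hk H; [lia|]. simpl.
  destruct (Nat.eq_dec k n) as [->|Hn].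
  - rewrite csum_zero by (intros; apply H; lia). ring.
  - rewrite IH, (H n) by (auto; lia). ring.
Qed.

Lemma row_Js (W : nat -> Bop) (B : R) (n : nat) : row_local W -> (forall n, ob (W n) B) ->
  row W [*] Js n = W n.
Proof.
  intros HL HB. apply Bop_ext. intros x. apply LP_ext. intros t. bapps.
  rewrite (row_app W B) by auto.
  assert (HC : forall m, Cs m (Js n x) = if (m =? n)%nat then x else lzero).
  { intros m. change ((Cs m [*] Js n) x = if (m =? n)%nat then x else lzero). rewrite Cs_Js.
    destruct (m =? n)%nat; reflexivity. }
  destruct (le_lt_dec (t + 2) n) as [H|H].
  - rewrite (proj1 HL) by auto. apply csum_zero. intros m Hm. rewrite HC.
    destruct (Nat.eqb_spec m n); [lia|]. rewrite b_zero. reflexivity.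
  - rewrite (csum_single _ n); auto.
    + rewrite HC, Nat.eqb_refl. reflexivity.
    + intros m Hm Hn. rewrite HC. destruct (Nat.eqb_spec m n); [lia|]. rewrite b_zero. reflexivity.
Qed.

(** * Even and odd coordinates *)

(** The pairs [Ev], [Ie] and [Od], [Io] identify l^p with the sum of two copies in the way
    prescribed by [interleave]. *)
Definition Ev : Bop := mkB (fun x n => lv x (2 * n)%nat).
Definition Od : Bop := mkB (fun x n => lv x (2 * n + 1)%nat).
Definition Ie : Bop := mkB (fun x n => if Nat.even n then lv x (Nat.div2 n) else C0).
Definition Io : Bop := mkB (fun x n => if Nat.even n then C0 else lv x (Nat.div2 n)).

Lemma even_2n (n : nat) : Nat.even (2 * n) = true.
Proof. rewrite Nat.even_mul. reflexivity. Qed.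
Lemma even_2n1 (n : nat) : Nat.even (2 * n + 1) = false.
Proof. rewrite Nat.even_add, even_2n. reflexivity. Qed.
Lemma div2_2n (n : nat) : Nat.div2 (2 * n) = n.
Proof. apply Nat.div2_double. Qed.
Lemma div2_2n1 (n : nat) : Nat.div2 (2 * n + 1) = n.
Proof. rewrite Nat.add_1_r. apply Nat.div2_succ_double. Qed.

Lemma Ev_bound (x : LP) : lp_norm_le p (fun n => lv x (2 * n)%nat) (1 * nrm x).
Proof.
  rewrite Rmult_1_l. apply lp_norm_le_iff. split; [apply nrm_nonneg|]. intros N.
  eapply Rle_trans; [|apply (nrm_pow_le x (2 * N))]. rewrite rsum_double. apply rsum_le.
  intros i _. pose proof (rpow_nonneg (Cnorm (lv x (2 * i + 1)%nat)) p). lra.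
Qed.

Lemma Od_bound (x : LP) : lp_norm_le p (fun n => lv x (2 * n + 1)%nat) (1 * nrm x).
Proof.
  rewrite Rmult_1_l. apply lp_norm_le_iff. split; [apply nrm_nonneg|]. intros N.
  eapply Rle_trans; [|apply (nrm_pow_le x (2 * N))]. rewrite rsum_double. apply rsum_le.
  intros i _. pose proof (rpow_nonneg (Cnorm (lv x (2 * i)%nat)) p). lra.
Qed.

Lemma Ie_bound (x : LP) : lp_norm_le p (fun n => if Nat.even n then lv x (Nat.div2 n) else C0) (1 * nrm x).
Proof.
  rewrite Rmult_1_l. apply lp_norm_le_iff. split; [apply nrm_nonneg|]. intros N.
  eapply Rle_trans; [apply (rsum_mono N (2 * N)); [lia|intros; apply rpow_nonneg]|].
  rewrite rsum_double. eapply Rle_trans; [|apply (nrm_pow_le x N)]. apply rsum_le.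
  intros i _. rewrite even_2n, even_2n1, div2_2n, Cnorm_C0, rpow_0. lra.
Qed.

Lemma Io_bound (x : LP) : lp_norm_le p (fun n => if Nat.even n then C0 else lv x (Nat.div2 n)) (1 * nrm x).
Proof.
  rewrite Rmult_1_l. apply lp_norm_le_iff. split; [apply nrm_nonneg|]. intros N.
  eapply Rle_trans; [apply (rsum_mono N (2 * N)); [lia|intros; apply rpow_nonneg]|].
  rewrite rsum_double. eapply Rle_trans; [|apply (nrm_pow_le x N)]. apply rsum_le.
  intros i _. rewrite even_2n, even_2n1, div2_2n1, Cnorm_C0, rpow_0. lra.
Qed.

Lemma Ev_good : good_map (fun x n => lv x (2 * n)%nat).
Proof. apply good_map_intro with 1; [| |lra|apply Ev_bound]; (intros; lvs; reflexivity). Qed.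

Lemma Od_good : good_map (fun x n => lv x (2 * n + 1)%nat).
Proof. apply good_map_intro with 1; [| |lra|apply Od_bound]; (intros; lvs; reflexivity). Qed.

Lemma Ie_good : good_map (fun x n => if Nat.even n then lv x (Nat.div2 n) else C0).
Proof. apply good_map_intro with 1; [| |lra|apply Ie_bound]; (intros; destruct (Nat.even n); lvs; ring). Qed.

Lemma Io_good : good_map (fun x n => if Nat.even n then C0 else lv x (Nat.div2 n)).
Proof. apply good_map_intro with 1; [| |lra|apply Io_bound]; (intros; destruct (Nat.even n); lvs; ring). Qed.

Lemma Ev_app (x : LP) (n : nat) : lv (Ev x) n = lv x (2 * n)%nat.
Proof. unfold Ev. rewrite mkB_app; auto using Ev_good. Qed.
Lemma Od_app (x : LP) (n : nat) : lv (Od x) n = lv x (2 * n + 1)%nat.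
Proof. unfold Od. rewrite mkB_app; auto using Od_good. Qed.
Lemma Ie_app (x : LP) (n : nat) : lv (Ie x) n = if Nat.even n then lv x (Nat.div2 n) else C0.
Proof. unfold Ie. rewrite mkB_app; auto using Ie_good. Qed.
Lemma Io_app (x : LP) (n : nat) : lv (Io x) n = if Nat.even n then C0 else lv x (Nat.div2 n).
Proof. unfold Io. rewrite mkB_app; auto using Io_good. Qed.

Lemma Ev_Ie : Ev [*] Ie = bid.
Proof.
  apply Bop_ext; intros x; apply LP_ext; intros n. bapps.
  rewrite Ev_app, Ie_app, even_2n, div2_2n. reflexivity.
Qed.
Lemma Ev_Io : Ev [*] Io = bzero.
Proof.
  apply Bop_ext; intros x; apply LP_ext; intros n. bapps.
  rewrite Ev_app, Io_app, even_2n. reflexivity.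
Qed.
Lemma Od_Ie : Od [*] Ie = bzero.
Proof.
  apply Bop_ext; intros x; apply LP_ext; intros n. bapps.
  rewrite Od_app, Ie_app, even_2n1. reflexivity.
Qed.
Lemma Od_Io : Od [*] Io = bid.
Proof.
  apply Bop_ext; intros x; apply LP_ext; intros n. bapps.
  rewrite Od_app, Io_app, even_2n1, div2_2n1. reflexivity.
Qed.
Lemma IeEv_IoOd : Ie [*] Ev [+] Io [*] Od = bid.
Proof.
  apply Bop_ext; intros x; apply LP_ext; intros n. bapps. lvs.
  rewrite Ie_app, Io_app, Ev_app, Od_app.
  destruct (Nat.even n) eqn:En.
  - replace (2 * Nat.div2 n)%nat with n; [ring|].
    rewrite (Nat.div2_odd n) at 1. rewrite <- Nat.negb_even, En. simpl; lia.
  - replace (2 * Nat.div2 n + 1)%nat with n; [ring|].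
    rewrite (Nat.div2_odd n) at 1. rewrite <- Nat.negb_even, En. simpl; lia.
Qed.

Lemma ob_Od : ob Od 1.
Proof. apply ob_mkB; [apply Od_good|lra|apply Od_bound]. Qed.

Lemma ob_Io : ob Io 1.
Proof. apply ob_mkB; [apply Io_good|lra|apply Io_bound]. Qed.

End Slices.

(** * Rademacher functions as operators *)

Section Rademacher.
Context {E : exponent}.
Notation p := pexp.

(* On l^p(N; l^p) the first [2^k] slices form L^p({-1,1}^k; l^p): [rc k i] is tensoring with
   the i-th Rademacher function and [rr k i] is pairing with it. *)
Definition rc (k i : nat) : Bop := bsum (2 ^ k) (fun e => RC (rad i e) [.] Js e).
Definition rr (k i : nat) : Bop := bsum (2 ^ k) (fun e => RC (rad i e / 2 ^ k) [.] Cs e).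
(** With [b = 1] this is the Rademacher projection. It vanishes on the complement and on all slices
    from [2^k] on. *)
Definition Mb (k : nat) (b : nat -> CC) : Bop := bsum k (fun i => b i [.] (rc k i [*] rr k i)).

Lemma pow2_pos (k : nat) : 0 < 2 ^ k.
Proof. apply pow_lt; lra. Qed.

Lemma Cs_rc (k i e : nat) : Cs e [*] rc k i = if (e <? 2 ^ k)%nat then RC (rad i e) [.] bid else bzero.
Proof.
  unfold rc. rewrite (gsum_ext _ _ _ _ (fun e => Js e [*] (RC (rad i e) [.] bid))) by (intros; bop).
  exact (Cs_bsum_Js e (2 ^ k) (fun e => RC (rad i e) [.] bid)).
Qed.

Lemma rr_rc (k i j : nat) : (i < k)%nat -> (j < k)%nat ->
  rr k i [*] rc k j = if (i =? j)%nat then bid else bzero.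
Proof.
  intros Hi Hj. unfold rr. rewrite bsum_comp_r.
  rewrite (gsum_ext _ _ _ _ (fun e => RC (rad i e * rad j e * / 2 ^ k) [.] bid)).
  - rewrite bsum_csum, csum_RC.
    rewrite (gsum_ext _ _ _ _ (fun e => / 2 ^ k * (rad i e * rad j e))) by (intros; ring).
    rewrite rsum_scal, rad_orthogonal by auto. destruct (i =? j)%nat.
    + rewrite Rinv_l by (pose proof (pow2_pos k); lra). rewrite RC_1. apply bscale_1.
    + rewrite Rmult_0_r, RC_0. apply bscale_0.
  - intros e He. rewrite bscale_comp_l, Cs_rc. destruct (Nat.ltb_spec e (2 ^ k)); [|lia].
    rewrite bscale_scale, <- RC_mul. f_equal. f_equal. unfold Rdiv. ring.
Qed.

(** The slice [2^k] is the first one that is not a sign vector. It does not meet the Rademacher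
    functions and is kept free for the correction terms of [VV] and [WW]. *)
Lemma Cs_rc_out (k i : nat) : Cs (2 ^ k) [*] rc k i = bzero.
Proof. rewrite Cs_rc. rewrite Nat.ltb_irrefl. reflexivity. Qed.

Lemma rr_Js_out (k i : nat) : rr k i [*] Js (2 ^ k) = bzero.
Proof.
  unfold rr. rewrite bsum_comp_r. apply bsum_zero. intros e He.
  rewrite bscale_comp_l, Cs_Js. destruct (Nat.eqb_spec e (2 ^ k)); [lia|]. bop.
Qed.

Lemma Mb_rc (k : nat) (b : nat -> CC) (j : nat) : (j < k)%nat -> Mb k b [*] rc k j = b j [.] rc k j.
Proof.
  intros Hj. unfold Mb. rewrite bsum_comp_r, (bsum_single k j); auto.
  - rewrite bscale_comp_l, bcompA, rr_rc, Nat.eqb_refl, bcomp1r by auto. reflexivity.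
  - intros i Hi Hn. rewrite bscale_comp_l, bcompA, rr_rc by auto.
    destruct (Nat.eqb_spec i j); [lia|]. bop.
Qed.

Lemma rr_Mb (k : nat) (b : nat -> CC) (j : nat) : (j < k)%nat -> rr k j [*] Mb k b = b j [.] rr k j.
Proof.
  intros Hj. unfold Mb. rewrite bsum_comp_l, (bsum_single k j); auto.
  - rewrite bscale_comp_r, <- bcompA, rr_rc, Nat.eqb_refl, bcomp1l by auto. reflexivity.
  - intros i Hi Hn. rewrite bscale_comp_r, <- bcompA, rr_rc by auto.
    destruct (Nat.eqb_spec j i); [lia|]. bop.
Qed.

Lemma Mb_Js_out (k : nat) (b : nat -> CC) : Mb k b [*] Js (2 ^ k) = bzero.
Proof.
  unfold Mb. rewrite bsum_comp_r. apply bsum_zero. intros i Hi.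
  rewrite bscale_comp_l, bcompA, rr_Js_out. bop.
Qed.

Lemma Cs_Mb_out (k : nat) (b : nat -> CC) : Cs (2 ^ k) [*] Mb k b = bzero.
Proof.
  unfold Mb. rewrite bsum_comp_l. apply bsum_zero. intros i Hi.
  rewrite bscale_comp_r, <- bcompA, Cs_rc_out. bop.
Qed.

Lemma Mb_mul (k : nat) (b c : nat -> CC) : Mb k b [*] Mb k c = Mb k (fun i => Cmul (b i) (c i)).
Proof.
  unfold Mb at 2 3. rewrite bsum_comp_l. apply gsum_ext. intros i Hi.
  rewrite bscale_comp_r, <- bcompA, Mb_rc by auto. bop.
Qed.

Lemma Mb_add (k : nat) (b c : nat -> CC) : Mb k (fun i => Cadd (b i) (c i)) = Mb k b [+] Mb k c.
Proof. unfold Mb. rewrite <- bsum_add. apply gsum_ext. intros; bop. Qed.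

Lemma Mb_scale (k : nat) (c : CC) (b : nat -> CC) : Mb k (fun i => Cmul c (b i)) = c [.] Mb k b.
Proof. unfold Mb. rewrite bsum_scale. apply gsum_ext. intros; bop. Qed.

Lemma rr_lv (k i : nat) (y : LP) (s : nat) :
  lv (rr k i y) s = csum (2 ^ k) (fun e => Cmul (RC (rad i e / 2 ^ k)) (lv y (to_nat (e, s)))).
Proof.
  unfold rr. rewrite bsum_lv. apply gsum_ext. intros e _. bapps. lvs. rewrite Cs_app. reflexivity.
Qed.

Lemma Mb_lv (k : nat) (b : nat -> CC) (y : LP) (e s : nat) :
  lv (Mb k b y) (to_nat (e, s)) = if (e <? 2 ^ k)%nat then
    csum k (fun i => Cmul (Cmul (b i) (csum (2 ^ k) (fun e' => Cmul (RC (rad i e' / 2 ^ k)) (lv y (to_nat (e', s))))))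
      (RC (rad i e))) else C0.
Proof.
  rewrite <- Cs_app. unfold Mb.
  change (Cs e (bsum k (fun i => b i [.] (rc k i [*] rr k i)) y)) with
    ((Cs e [*] bsum k (fun i => b i [.] (rc k i [*] rr k i))) y).
  rewrite bsum_comp_l, bsum_lv.
  rewrite (gsum_ext _ _ k _ (fun i => lv ((b i [.] ((Cs e [*] rc k i) [*] rr k i)) y) s))
    by (intros; do 2 f_equal; bop).
  destruct (Nat.ltb_spec e (2 ^ k)) as [He|He].
  - apply gsum_ext. intros i _. rewrite Cs_rc. destruct (Nat.ltb_spec e (2 ^ k)); [|lia].
    bapps. lvs. rewrite rr_lv. ring.
  - apply csum_zero. intros i _. rewrite Cs_rc. destruct (Nat.ltb_spec e (2 ^ k)); [lia|].
    bapps. lvs. ring.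
Qed.

(** The multiplier acts on the sign variable alone, so the scalar inequality holds at every
    coordinate [s], and the p-th powers are summed over [s]. *)
Lemma Mb_bounded : exists K, 0 <= K /\ forall k b beta, 0 <= beta ->
  (forall i, (i < k)%nat -> Cnorm (b i) <= beta) -> ob (Mb k b) (K * beta).
Proof.
  destruct (rademacher_multiplier p pexp_gt1) as (K & HK & H). exists K. split; auto.
  intros k b beta Hb Hbi. split; [apply Rmult_le_pos; auto|]. intros y.
  assert (HKb : 0 <= K * beta) by (apply Rmult_le_pos; auto).
  apply nrm_le_of_sums; [apply Rmult_le_pos; auto using nrm_nonneg|]. intros N.
  rewrite rpow_mult by auto using nrm_nonneg.
  rewrite (gsum_ext _ _ N _ (fun t => let '(e, s) := of_nat t in rpow (Cnorm (lv (Mb k b y) (to_nat (e, s)))) p)).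
  2:{ intros t _. destruct (of_nat t) as [e s] eqn:Et. rewrite <- Et, cancel_to_of. reflexivity. }
  apply (pair_sum_seq_le (fun e s => rpow (Cnorm (lv (Mb k b y) (to_nat (e, s)))) p)).
  { intros; apply rpow_nonneg. }
  intros N' M. rewrite rsum_swap.
  apply Rle_trans with (rpow (K * beta) p *
    rsum (2 ^ k) (fun e => rsum M (fun s => rpow (Cnorm (lv y (to_nat (e, s)))) p))).
  2:{ apply Rmult_le_compat_l; [apply rpow_nonneg|apply pair_pow_sums]. }
  rewrite (rsum_swap (2 ^ k) M), <- rsum_scal. apply rsum_le. intros s _.
  eapply Rle_trans; [|apply (H k (fun e => lv y (to_nat (e, s))) b beta Hb Hbi)].
  apply Rle_trans with (rsum (2 ^ k + N') (fun e => rpow (Cnorm (lv (Mb k b y) (to_nat (e, s)))) p)).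
  - apply rsum_mono; [lia|]. intros; apply rpow_nonneg.
  - rewrite rsum_split. rewrite (gsum_ext _ _ N' _ (fun _ => 0)), rsum_const.
    + rewrite Rmult_0_r, Rplus_0_r. apply rsum_le. intros e He. rewrite Mb_lv.
      destruct (Nat.ltb_spec e (2 ^ k)); [lra|lia].
    + intros e _. rewrite Mb_lv. destruct (Nat.ltb_spec (2 ^ k + e) (2 ^ k)); [lia|].
      rewrite Cnorm_C0, rpow_0. reflexivity.
Qed.

Definition sgn_sum (k : nat) (A : nat -> Bop) (e : nat) : Bop := bsum k (fun i => RC (rad i e) [.] A i).

(** The slice [e] of the image of [x] is the sign sum for [e] applied to [x]. There are [2^k] such
    slices, whence the p-th root of [2^k]. *)
Lemma ob_rc_sum (k : nat) (A : nat -> Bop) (B : R) :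
  (forall e, (e < 2 ^ k)%nat -> ob (sgn_sum k A e) B) ->
  ob (bsum k (fun i => rc k i [*] A i)) (rpow (2 ^ k) (/ p) * B).
Proof.
  intros H. pose proof (pow2_pos k) as H2.
  assert (HB : 0 <= B).
  { apply (H 0%nat). clear. induction k; simpl; lia. }
  pose proof (rpow_nonneg (2 ^ k) (/ p)).
  split; [apply Rmult_le_pos; auto|]. intros x.
  apply rpow_le_inv with p; auto using pexp_pos, nrm_nonneg.
  { apply Rmult_le_pos; [apply Rmult_le_pos; auto|apply nrm_nonneg]. }
  rewrite Rmult_assoc, rpow_mult, rpow_inv' by
    (auto using pexp_pos; try apply Rmult_le_pos; auto using nrm_nonneg; lra).
  apply slice_norm_le. intros N.
  assert (HC : forall e, Cs e (bsum k (fun i => rc k i [*] A i) x) =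
    if (e <? 2 ^ k)%nat then sgn_sum k A e x else lzero).
  { intros e. change (Cs e (bsum k (fun i => rc k i [*] A i) x)) with
      ((Cs e [*] bsum k (fun i => rc k i [*] A i)) x).
    rewrite bsum_comp_l.
    rewrite (gsum_ext _ _ k _ (fun i => (Cs e [*] rc k i) [*] A i)) by (intros; rewrite bcompA; auto).
    destruct (e <? 2 ^ k)%nat eqn:He.
    - unfold sgn_sum. do 2 f_equal. apply functional_extensionality. intros i.
      rewrite Cs_rc, He. bop.
    - rewrite bsum_zero; auto. intros i _. rewrite Cs_rc, He. bop. }
  apply Rle_trans with (rsum (2 ^ k + N) (fun n => rpow (nrm (Cs n (bsum k (fun i => rc k i [*] A i) x))) p)).
  - apply rsum_mono; [lia|]. intros; apply rpow_nonneg.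
  - rewrite rsum_split. rewrite (gsum_ext _ _ N _ (fun _ => 0)), rsum_const.
    + rewrite Rmult_0_r, Rplus_0_r. rewrite <- INR_pow2, <- rsum_const. apply rsum_le. intros e He. rewrite HC.
      destruct (Nat.ltb_spec e (2 ^ k)); [|lia].
      apply rpow_le; [apply pexp_nonneg|]. split; [apply nrm_nonneg|]. apply H; auto.
    + intros e _. rewrite HC. destruct (Nat.ltb_spec (2 ^ k + e) (2 ^ k)); [lia|].
      rewrite nrm_zero, rpow_0. reflexivity.
Qed.

(** The operator is the mean over [e] of the sign sum for [e] applied to the slice [e]. The mean of
    the norms of the slices is bounded through their p-th powers, by convexity. *)
Lemma ob_rr_sum (k : nat) (A : nat -> Bop) (B : R) :
  (forall e, (e < 2 ^ k)%nat -> ob (sgn_sum k A e) B) ->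
  ob (bsum k (fun i => A i [*] rr k i)) (/ rpow (2 ^ k) (/ p) * B).
Proof.
  intros H. pose proof (pow2_pos k) as H2.
  assert (Hk0 : (0 < 2 ^ k)%nat) by (clear; induction k; simpl; lia).
  assert (HB : 0 <= B) by (apply (H 0%nat); auto).
  pose proof (rpow_pos (2 ^ k) (/ p) H2) as Hr.
  assert (Hri : 0 < / rpow (2 ^ k) (/ p)) by (apply Rinv_0_lt_compat; auto).
  split; [apply Rmult_le_pos; lra|]. intros y.
  assert (ES : bsum k (fun i => A i [*] rr k i) =
    RC (/ 2 ^ k) [.] bsum (2 ^ k) (fun e => sgn_sum k A e [*] Cs e)).
  { unfold rr, sgn_sum.
    rewrite (gsum_ext _ _ k _ (fun i => bsum (2 ^ k) (fun e => RC (/ 2 ^ k) [.] (RC (rad i e) [.] A i [*] Cs e)))).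
    - rewrite bsum_swap, bsum_scale. apply gsum_ext. intros e _. rewrite bsum_comp_r, bsum_scale.
      reflexivity.
    - intros i _. rewrite bsum_comp_l. apply gsum_ext. intros e _. unfold Rdiv. rewrite RC_mul. bop. }
  rewrite ES. set (S := bsum (2 ^ k) (fun e => sgn_sum k A e [*] Cs e)).
  assert (H1 : nrm (S y) <= B * rsum (2 ^ k) (fun e => nrm (Cs e y))).
  { unfold S. rewrite bsum_app. rewrite <- rsum_scal.
    assert (G : forall n, (n <= 2 ^ k)%nat -> nrm (gsum ladd lzero n (fun e => (sgn_sum k A e [*] Cs e) y))
      <= rsum n (fun e => B * nrm (Cs e y))).
    { induction n as [|n IH]; intros Hn; cbn [gsum].
      - rewrite nrm_zero. lra.
      - eapply Rle_trans; [apply nrm_add|]. apply Rplus_le_compat; [apply IH; lia|].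
        apply (H n). lia. }
    apply G. lia. }
  assert (H3 : rsum (2 ^ k) (fun e => nrm (Cs e y)) <= 2 ^ k * (/ rpow (2 ^ k) (/ p) * nrm y)).
  { pose proof (rpow_mean (2 ^ k) (fun e => nrm (Cs e y)) p pexp_ge1 Hk0 ltac:(intros; apply nrm_nonneg)) as Hm.
    rewrite INR_pow2 in Hm.
    assert (Hm2 : rsum (2 ^ k) (fun e => nrm (Cs e y)) / 2 ^ k <= / rpow (2 ^ k) (/ p) * nrm y).
    { apply rpow_le_inv with p; auto using pexp_pos.
      - apply Rmult_le_pos; [apply rsum_nonneg; intros; apply nrm_nonneg|left; apply Rinv_0_lt_compat; auto].
      - apply Rmult_le_pos; [lra|apply nrm_nonneg].
      - eapply Rle_trans; [apply Hm|]. rewrite rpow_mult by (auto using nrm_nonneg; lra).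
        assert (Ei : rpow (/ rpow (2 ^ k) (/ p)) p = / 2 ^ k).
        { apply Rmult_eq_reg_l with (2 ^ k); [|lra]. rewrite Rinv_r by lra.
          rewrite <- (rpow_inv' (2 ^ k) p) at 1 by (auto using pexp_pos; lra).
          rewrite <- rpow_mult, Rinv_r, rpow_1; auto; lra. }
        rewrite Ei. unfold Rdiv. rewrite Rmult_comm. apply Rmult_le_compat_l.
        + left; apply Rinv_0_lt_compat; auto.
        + apply slice_norm_ge. }
    apply Rmult_le_compat_l with (r := 2 ^ k) in Hm2; [|lra].
    replace (2 ^ k * (rsum (2 ^ k) (fun e => nrm (Cs e y)) / 2 ^ k)) with
      (rsum (2 ^ k) (fun e => nrm (Cs e y))) in Hm2 by (field; lra). auto. }
  cbn [bapp bscale]. eapply Rle_trans; [apply nrm_scale_le|].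
  rewrite Cnorm_RC, Rabs_pos_eq by (left; apply Rinv_0_lt_compat; auto).
  apply Rle_trans with (/ 2 ^ k * (B * (2 ^ k * (/ rpow (2 ^ k) (/ p) * nrm y)))).
  - apply Rmult_le_compat_l; [left; apply Rinv_0_lt_compat; auto|].
    eapply Rle_trans; [apply H1|]. apply Rmult_le_compat_l; auto.
  - right. field. lra.
Qed.

End Rademacher.

(** * Homomorphisms modulo the compacts *)

Section Homomorphisms.
Context {E : exponent}.
Notation p := pexp.
Variables (d : nat) (M : pt -> Prop).

Definition calk_le (A : Bop) (r : R) : Prop :=
  forall eps, 0 < eps -> exists K, cpt K /\ ob (A [+] K) (r + eps).

(** Lifts of bounded unital homomorphisms into the Calkin algebra. Lower norm bounds are carried
    separately, because the compression [psi] below is only shown to be bounded above. *)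
Record hommod (T : fn -> Bop) : Prop := {
  hm_ext : forall f g, cont_on d M f -> cont_on d M g -> feq M f g -> ceq (T f) (T g);
  hm_add : forall f g, cont_on d M f -> cont_on d M g -> ceq (T (fadd f g)) (T f [+] T g);
  hm_scale : forall c f, cont_on d M f -> ceq (T (fscale c f)) (c [.] T f);
  hm_mul : forall f g, cont_on d M f -> cont_on d M g -> ceq (T (fmul f g)) (T f [*] T g);
  hm_one : ceq (T fone) bid;
  hm_bd : exists C, 0 <= C /\ forall f s, cont_on d M f -> sup_le M f s -> calk_le (T f) (C * s) }.

Arguments hm_ext {T} _ _ _ _ _ _.
Arguments hm_add {T} _ _ _ _ _.
Arguments hm_scale {T} _ _ _ _.
Arguments hm_mul {T} _ _ _ _ _.
Arguments hm_one {T} _.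
Arguments hm_bd {T} _.

Lemma calk_le_ceq (A B : Bop) (r : R) : ceq A B -> calk_le A r -> calk_le B r.
Proof.
  intros H HA eps He. destruct (HA eps He) as (K & HK & HO).
  exists ((A [-] B) [+] K). split; [apply cpt_add; auto|].
  replace (B [+] (A [-] B [+] K)) with (A [+] K) by bop. auto.
Qed.

(** This turns a bound in the Calkin algebra into a bound in norm far out: the compact correction is
    small on the tail. *)
Lemma calk_le_tail_r (A : Bop) (r eps : R) : calk_le A r -> 0 < eps ->
  exists m0, forall m, (m0 <= m)%nat -> ob (A [*] Qm m) (r + eps).
Proof.
  intros HA He. destruct (HA (eps / 2)) as (K & HK & HO); [lra|].
  destruct (cpt_tail_r K (eps / 2) HK) as [m0 H0]; [lra|]. exists m0. intros m Hm.
  replace (A [*] Qm m) with ((A [+] K) [*] Qm m [-] K [*] Qm m) by bop.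
  replace (r + eps) with ((r + eps / 2) * 1 + eps / 2) by field.
  apply ob_sub; auto. apply ob_comp; auto. apply ob_diag.
Qed.

Lemma calk_le_tail_l (A : Bop) (r eps : R) : calk_le A r -> 0 < eps ->
  exists m0, forall m, (m0 <= m)%nat -> ob (Qm m [*] A) (r + eps).
Proof.
  intros HA He. destruct (HA (eps / 2)) as (K & HK & HO); [lra|].
  destruct (cpt_tail_l K (eps / 2) HK) as [m0 H0]; [lra|]. exists m0. intros m Hm.
  replace (Qm m [*] A) with (Qm m [*] (A [+] K) [-] Qm m [*] K) by bop.
  replace (r + eps) with (1 * (r + eps / 2) + eps / 2) by field.
  apply ob_sub; auto. apply ob_comp; auto. apply ob_diag.
Qed.

Lemma calk_le_of_ob (A : Bop) (r : R) : ob A r -> calk_le A r.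
Proof.
  intros H eps He. exists bzero. split; [apply cpt_zero|]. rewrite badd0r.
  apply ob_mono with r; auto. lra.
Qed.

Lemma calk_le_sandwich (A X Y : Bop) (r a b : R) : ob X a -> ob Y b -> calk_le A r ->
  calk_le (X [*] A [*] Y) (a * r * b).
Proof.
  intros HX HY HA eps He.
  assert (Ha : 0 <= a) by apply HX. assert (Hb : 0 <= b) by apply HY.
  destruct (HA (eps / (a * b + 1))) as (K & HK & HO).
  { apply Rmult_lt_0_compat; auto. apply Rinv_0_lt_compat. nra. }
  exists (X [*] K [*] Y). split; [apply cpt_comp_r, cpt_comp_l; auto|].
  replace (X [*] A [*] Y [+] X [*] K [*] Y) with (X [*] (A [+] K) [*] Y) by bop.
  apply ob_mono with (a * (r + eps / (a * b + 1)) * b).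
  - assert (a * b * (eps / (a * b + 1)) <= eps); [|nra].
    apply Rle_trans with ((a * b + 1) * (eps / (a * b + 1))); [|right; field; nra].
    apply Rmult_le_compat_r; [|lra]. apply Rmult_le_pos; [lra|]. left; apply Rinv_0_lt_compat. nra.
  - repeat apply ob_comp; auto.
Qed.

Section Lifts.
Variable T : fn -> Bop.
Hypothesis HT : hommod T.

Lemma hm_zero (f : fn) : cont_on d M f -> feq M f (fun _ => C0) -> cpt (T f).
Proof.
  intros Hf H. rewrite (hm_ext HT f (fscale C0 f)); auto using cont_scale.
  - rewrite (hm_scale HT), bscale_0; auto. apply cpt_zero.
  - intros x Mx. rewrite H by auto. unfold fscale. ring.
Qed.

Lemma hm_fsum (k : nat) (F : nat -> fn) : (forall i, (i < k)%nat -> cont_on d M (F i)) ->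
  ceq (T (fsum k F)) (bsum k (fun i => T (F i))).
Proof.
  induction k as [|k IH]; intros H.
  - simpl. apply ceq_zero. apply hm_zero; [apply cont_const|]. intros x _. reflexivity.
  - change (fsum (S k) F) with (fadd (fsum k F) (F k)).
    rewrite (hm_add HT) by (auto using cont_fsum). simpl. rewrite IH by auto. reflexivity.
Qed.

Lemma hm_lincomb (k : nat) (c : nat -> CC) (F : nat -> fn) : (forall i, (i < k)%nat -> cont_on d M (F i)) ->
  ceq (T (fsum k (fun i => fscale (c i) (F i)))) (bsum k (fun i => c i [.] T (F i))).
Proof.
  intros H. rewrite hm_fsum by (auto using cont_scale). apply ceq_bsum. intros i Hi.
  apply (hm_scale HT); auto.
Qed.

End Lifts.
End Homomorphisms.

Arguments hm_ext {E d M T} _ _ _ _ _ _.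
Arguments hm_add {E d M T} _ _ _ _ _.
Arguments hm_scale {E d M T} _ _ _ _.
Arguments hm_mul {E d M T} _ _ _ _ _.
Arguments hm_one {E d M T} _.
Arguments hm_bd {E d M T} _.
Arguments hm_fsum {E d M T} _ _ _ _.
Arguments hm_lincomb {E d M T} _ _ _ _ _.

(** * The model representation *)

Section Model.
Context {E : exponent}.
Notation p := pexp.
Variables (d : nat) (M : pt -> Prop) (x0 : pt) (kk : nat -> nat) (xx : nat -> nat -> pt).
Hypothesis Mx0 : M x0.
Hypothesis Mxx : forall n i, M (xx n i).

(** A scalar plus a multiplier of the differences: on the [i]-th Rademacher function the terms
    [f x0] cancel, and multiplicativity follows from that of [Mb] without a complementary
    projection. *)
Definition rhon (n : nat) (f : fn) : Bop :=
  f x0 [.] bid [+] Mb (kk n) (fun i => Cadd (f (xx n i)) (Copp (f x0))).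
Definition rho (f : fn) : Bop := BD (fun n => rhon n f).

Lemma rhon_bounded : exists K, 0 <= K /\ forall f s, sup_le M f s -> forall n, ob (rhon n f) (K * s).
Proof.
  destruct Mb_bounded as (K & HK & H). exists (1 + K * 2). split; [lra|].
  intros f s Hs n. assert (Hs0 : 0 <= s).
  { pose proof (Hs x0 Mx0). pose proof (Cnorm_nonneg (f x0)). lra. }
  replace ((1 + K * 2) * s) with (s + K * (2 * s)) by ring. apply ob_add.
  - apply ob_mono with (Cnorm (f x0) * 1); [rewrite Rmult_1_r; auto|]. apply ob_scale, ob_id.
  - apply H; [lra|]. intros i _. eapply Rle_trans; [apply Cnorm_add|]. rewrite Cnorm_opp.
    pose proof (Hs x0 Mx0). pose proof (Hs _ (Mxx n i)). lra.
Qed.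

Lemma rho_bounded : exists K, 0 <= K /\ forall f s, sup_le M f s -> ob (rho f) (K * s).
Proof.
  destruct rhon_bounded as (K & HK & H). exists K. split; auto. intros f s Hs.
  apply ob_BD. intros n. apply H; auto.
Qed.

Lemma Cs_rho (f : fn) (s : R) (n : nat) : sup_le M f s -> Cs n [*] rho f = rhon n f [*] Cs n.
Proof. intros Hs. destruct rhon_bounded as (K & HK & H). exact (Cs_BD _ (K * s) n (H f s Hs)). Qed.

Lemma rho_Js (f : fn) (s : R) (n : nat) : sup_le M f s -> rho f [*] Js n = Js n [*] rhon n f.
Proof. intros Hs. destruct rhon_bounded as (K & HK & H). exact (BD_Js _ (K * s) n (H f s Hs)). Qed.

Lemma sup_add (f g : fn) (s t : R) : sup_le M f s -> sup_le M g t -> sup_le M (fadd f g) (s + t).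
Proof.
  intros Hf Hg x Mx. unfold fadd. eapply Rle_trans; [apply Cnorm_add|].
  specialize (Hf x Mx). specialize (Hg x Mx). lra.
Qed.

Lemma sup_mul (f g : fn) (s t : R) : sup_le M f s -> sup_le M g t -> sup_le M (fmul f g) (s * t).
Proof.
  intros Hf Hg x Mx. unfold fmul. rewrite Cnorm_mul. specialize (Hf x Mx). specialize (Hg x Mx).
  apply Rmult_le_compat; auto using Cnorm_nonneg.
Qed.

Lemma sup_scale (c : CC) (f : fn) (s : R) : sup_le M f s -> sup_le M (fscale c f) (Cnorm c * s).
Proof.
  intros Hf x Mx. unfold fscale. rewrite Cnorm_mul. apply Rmult_le_compat_l; auto using Cnorm_nonneg.
Qed.

Lemma rho_add (f g : fn) (s t : R) : sup_le M f s -> sup_le M g t -> rho (fadd f g) = rho f [+] rho g.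
Proof.
  intros Hf Hg. apply slice_ext_op. intros n.
  rewrite (Cs_rho _ _ n (sup_add f g s t Hf Hg)), bcompDr, (Cs_rho f s), (Cs_rho g t), <- bcompDl by auto.
  f_equal. unfold rhon.
  replace (fun i => Cadd (fadd f g (xx n i)) (Copp (fadd f g x0))) with
    (fun i => Cadd (Cadd (f (xx n i)) (Copp (f x0))) (Cadd (g (xx n i)) (Copp (g x0))))
    by (apply functional_extensionality; intros; unfold fadd; ring).
  rewrite Mb_add. unfold fadd. bop.
Qed.

Lemma rho_scale (c : CC) (f : fn) (s : R) : sup_le M f s -> rho (fscale c f) = c [.] rho f.
Proof.
  intros Hf. apply slice_ext_op. intros n.
  rewrite (Cs_rho _ _ n (sup_scale c f s Hf)), bscale_comp_r, (Cs_rho f s), <- bscale_comp_l by auto.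
  f_equal. unfold rhon.
  replace (fun i => Cadd (fscale c f (xx n i)) (Copp (fscale c f x0))) with
    (fun i => Cmul c (Cadd (f (xx n i)) (Copp (f x0))))
    by (apply functional_extensionality; intros; unfold fscale; ring).
  rewrite Mb_scale. unfold fscale. bop.
Qed.

Lemma rho_mul (f g : fn) (s t : R) : sup_le M f s -> sup_le M g t -> rho (fmul f g) = rho f [*] rho g.
Proof.
  intros Hf Hg. apply slice_ext_op. intros n.
  rewrite (Cs_rho _ _ n (sup_mul f g s t Hf Hg)), <- bcompA, (Cs_rho f s), bcompA, (Cs_rho g t), <- bcompA by auto.
  f_equal. unfold rhon.
  set (b := fun i => Cadd (f (xx n i)) (Copp (f x0))). set (c := fun i => Cadd (g (xx n i)) (Copp (g x0))).
  replace (fun i => Cadd (fmul f g (xx n i)) (Copp (fmul f g x0))) with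
    (fun i => Cadd (Cadd (Cmul (f x0) (c i)) (Cmul (g x0) (b i))) (Cmul (b i) (c i)))
    by (apply functional_extensionality; intros; unfold fmul, b, c; ring).
  rewrite !Mb_add, !Mb_scale, <- Mb_mul. unfold fmul. bop.
Qed.

Lemma rho_ext (f g : fn) : feq M f g -> rho f = rho g.
Proof.
  intros H. unfold rho, rhon. f_equal. apply functional_extensionality. intros n.
  rewrite (H x0 Mx0). f_equal. f_equal. apply functional_extensionality. intros i.
  rewrite (H _ (Mxx n i)). reflexivity.
Qed.

Lemma sup_one : sup_le M fone 1.
Proof. intros x _. unfold fone. rewrite Cnorm_C1. lra. Qed.

Lemma rho_one : rho fone = bid.
Proof.
  apply slice_ext_op. intros n. rewrite (Cs_rho fone 1) by apply sup_one.
  unfold rhon, Mb. rewrite bsum_zero.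
  - unfold fone. bop.
  - intros i _. replace (Cadd (fone (xx n i)) (Copp (fone x0))) with C0 by (unfold fone; ring).
    apply bscale_0.
Qed.

Lemma rhon_rc (n : nat) (f : fn) (i : nat) : (i < kk n)%nat ->
  rhon n f [*] rc (kk n) i = f (xx n i) [.] rc (kk n) i.
Proof. intros Hi. unfold rhon. rewrite bcompDl, Mb_rc by auto. bop. Qed.

Lemma rr_rhon (n : nat) (f : fn) (i : nat) : (i < kk n)%nat ->
  rr (kk n) i [*] rhon n f = f (xx n i) [.] rr (kk n) i.
Proof. intros Hi. unfold rhon. rewrite bcompDr, rr_Mb by auto. bop. Qed.

Lemma rhon_Js_out (n : nat) (f : fn) : rhon n f [*] Js (2 ^ kk n) = f x0 [.] Js (2 ^ kk n).
Proof. unfold rhon. rewrite bcompDl, Mb_Js_out. bop. Qed.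

Lemma Cs_out_rhon (n : nat) (f : fn) : Cs (2 ^ kk n) [*] rhon n f = f x0 [.] Cs (2 ^ kk n).
Proof. unfold rhon. rewrite bcompDr, Cs_Mb_out. bop. Qed.

(** [J] embeds l^p into the eigenvectors of [rho f] for the value at [xx n i], with left inverse
    [L]. An eigenvalue of infinite multiplicity cannot be removed by a compact perturbation. *)
Lemma rho_essential_point (f : fn) (t s : R) (n i : nat) : sup_le M f t -> (i < kk n)%nat ->
  calk_le (rho f) s -> Cnorm (f (xx n i)) <= s.
Proof.
  intros Ht Hi Hs.
  set (J := Js n [*] rc (kk n) i). set (L := rr (kk n) i [*] Cs n).
  assert (HLJ : L [*] J = bid).
  { unfold L, J. rewrite bcompA, <- (bcompA (Cs n)), Cs_Js_same, bcomp1l, rr_rc, Nat.eqb_refl by auto.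
    reflexivity. }
  assert (HrJ : rho f [*] J = f (xx n i) [.] J).
  { unfold J. rewrite <- bcompA, (rho_Js f t), bcompA, rhon_rc by auto. bop. }
  destruct (ob_exists L) as (l & Hl & HL).
  apply le_epsilon. intros eps He.
  set (e := eps / (2 * (l + 1))).
  assert (He' : 0 < e) by (apply Rmult_lt_0_compat; auto; apply Rinv_0_lt_compat; lra).
  destruct (Hs (eps / 2)) as (K & HK & HO); [lra|].
  (* A unit vector far out gives an eigenvector [w] that [K] nearly kills, while [L] keeps its norm
     at least [1 / l]; the choice of [e] makes the loss at most [eps / 2] times that norm. *)
  destruct (cpt_tail_r (K [*] J) e) as [m0 Hm0]; [apply cpt_comp_r; auto|auto|].
  set (v := delta m0). set (w := J v).
  assert (Hw : 1 <= l * nrm w).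
  { rewrite <- (nrm_delta m0). replace (delta m0) with (L w); [apply HL|].
    change ((L [*] J) v = v). rewrite HLJ. reflexivity. }
  assert (HKw : nrm (K w) <= e).
  { destruct (Hm0 m0 (le_n m0)) as [_ H]. specialize (H v). unfold v at 2 in H. rewrite nrm_delta in H.
    rewrite Rmult_1_r in H. replace (K w) with ((K [*] J [*] Qm m0) v); auto.
    change (K (J (Qm m0 v)) = K (J v)). do 2 f_equal. apply LP_ext. intros u. rewrite Qm_app.
    unfold v. rewrite delta_app. destruct (Nat.ltb_spec u m0), (Nat.eqb_spec u m0); auto; lia. }
  destruct HO as [_ HO]. specialize (HO w).
  assert (Ew : lscale (f (xx n i)) w = lsub ((rho f [+] K) w) (K w)).
  { transitivity ((f (xx n i) [.] J) v); [reflexivity|]. rewrite <- HrJ.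
    apply LP_ext; intros; bapps; lvs. unfold w. ring. }
  assert (H1 : Cnorm (f (xx n i)) * nrm w <= (s + eps / 2) * nrm w + e).
  { apply Rle_trans with (nrm (lscale (f (xx n i)) w)).
    - destruct (Req_dec (Cnorm (f (xx n i))) 0) as [E0|E0]; [rewrite E0, Rmult_0_l; apply nrm_nonneg|].
      set (z := f (xx n i)) in *. set (c := Cnorm z) in *. assert (Hc : 0 < c) by (pose proof (Cnorm_nonneg z); unfold c in *; lra).
      (* The inverse of [z], by which the norm of [lscale z w] is bounded below. *)
      set (zi := Cmul (RC (/ (c * c))) (fst z, - snd z)).
      assert (Ez : Cmul zi z = C1).
      { unfold zi, Cmul, RC, C1. simpl. pose proof (Cnorm_sq z) as Hz. fold c in Hz. f_equal.
        - replace ((/ (c * c) * fst z - 0 * - snd z) * fst z - (/ (c * c) * - snd z + 0 * fst z) * snd z)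
            with (/ (c * c) * (fst z * fst z + snd z * snd z)) by ring.
          rewrite <- Hz. field. lra.
        - ring. }
      assert (Nz : Cnorm zi = / c).
      { apply Rmult_eq_reg_r with c; [|lra]. rewrite Rinv_l by lra. unfold c. rewrite <- Cnorm_mul, Ez.
        apply Cnorm_C1. }
      pose proof (nrm_scale_le zi (lscale z w)) as Hn. rewrite lscale_lscale, Ez, lscale_1, Nz in Hn.
      apply Rmult_le_compat_l with (r := c) in Hn; [|lra].
      rewrite <- Rmult_assoc, Rinv_r, Rmult_1_l in Hn; lra.
    - rewrite Ew. eapply Rle_trans; [apply nrm_sub|]. lra. }
  assert (Hwp : 0 < nrm w).
  { pose proof (nrm_nonneg w). destruct (Req_dec (nrm w) 0) as [E0|E0]; [rewrite E0 in Hw; lra|lra]. }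
  apply Rmult_le_reg_r with (nrm w); auto.
  assert (e <= eps / 2 * nrm w); [|nra].
  unfold e. apply Rmult_le_reg_r with (2 * (l + 1)); [lra|].
  replace (eps / (2 * (l + 1)) * (2 * (l + 1))) with eps by (field; lra).
  assert (1 <= (l + 1) * nrm w) by nra.
  replace (eps / 2 * nrm w * (2 * (l + 1))) with (eps * ((l + 1) * nrm w)) by field. nra.
Qed.

End Model.

Arguments rho_bounded {E M x0} kk {xx} _ _.
Arguments rho_one {E M x0 kk xx} _ _.
Arguments Cs_rho {E M x0 kk xx} _ _ _ _ _ _.
Arguments rho_Js {E M x0 kk xx} _ _ _ _ _ _.
Arguments rho_add {E M x0 kk xx} _ _ _ _ _ _ _ _.
Arguments rho_scale {E M x0 kk xx} _ _ _ _ _ _.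
Arguments rho_mul {E M x0 kk xx} _ _ _ _ _ _ _ _.
Arguments rho_ext {E M x0 kk xx} _ _ _ _ _.
Arguments rho_essential_point {E M x0 kk xx} _ _ _ _ _ _ _ _ _ _.

(** * Quasicentral partitions of the identity *)

Section Cutoffs.
Context {E : exponent}.
Notation p := pexp.

(** Nesting confines the interaction of differences of cutoffs to neighbouring indices. The numbers
    [Rs] push the [m]-th step beyond a prescribed coordinate, and [tau] prescribes how well it
    commutes with [l m]. *)
Record cutoffs (l : nat -> list Bop) (tau : nat -> R) (Rs : nat -> nat) (w : nat -> nat -> R) : Prop := {
  co_zero : forall t, w 0%nat t = 0;
  co_range : forall m t, 0 <= w m t <= 1;
  co_reach : forall m t, (1 <= m)%nat -> (t < Rs m)%nat -> w m t = 1;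
  co_exhaust : forall m t, (t < m)%nat -> w m t = 1;
  co_nested : forall m t, w m t <> 0 -> w (S m) t = 1;
  co_finite : forall m, exists s, forall t, (s <= t)%nat -> w m t = 0;
  co_comm : forall m A, In A (l m) -> ob (diag (w m) [*] A [-] A [*] diag (w m)) (tau m) }.

Arguments co_zero {l tau Rs w} _.
Arguments co_range {l tau Rs w} _.
Arguments co_reach {l tau Rs w} _.
Arguments co_exhaust {l tau Rs w} _.
Arguments co_nested {l tau Rs w} _.
Arguments co_finite {l tau Rs w} _.
Arguments co_comm {l tau Rs w} _.

Lemma cutoffs_exist (l : nat -> list Bop) (tau : nat -> R) (Rs : nat -> nat) :
  (forall m, 0 < tau m) -> exists w, cutoffs l tau Rs w.
Proof.
  intros Ht.
  assert (Hst : forall m s, exists c : (nat -> R) * nat,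
    (forall t, 0 <= fst c t <= 1) /\ (forall t, (t < Nat.max s (Nat.max (Rs m) m))%nat -> fst c t = 1) /\
    (forall t, (snd c <= t)%nat -> fst c t = 0) /\
    forall A, In A (l m) -> ob (diag (fst c) [*] A [-] A [*] diag (fst c)) (tau m)).
  { intros m s. destruct (quasicentral_cutoff (l m) (Nat.max s (Nat.max (Rs m) m)) (tau m) (Ht m))
      as (w & H1 & H2 & (s' & H3) & H4). exists (w, s'). auto. }
  set (nx := fun m s => proj1_sig (constructive_indefinite_description _ (Hst m s))).
  assert (Hnx : forall m s, (forall t, 0 <= fst (nx m s) t <= 1) /\
    (forall t, (t < Nat.max s (Nat.max (Rs m) m))%nat -> fst (nx m s) t = 1) /\
    (forall t, (snd (nx m s) <= t)%nat -> fst (nx m s) t = 0) /\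
    forall A, In A (l m) -> ob (diag (fst (nx m s)) [*] A [-] A [*] diag (fst (nx m s))) (tau m)).
  { intros m s. unfold nx. destruct constructive_indefinite_description. auto. }
  (* The state carries a bound for the support along with the weight, so that the next weight can be
     made 1 there. *)
  set (st := fix st m : (nat -> R) * nat :=
    match m with O => (fun _ => 0, 0%nat) | S m' => nx (S m') (snd (st m')) end).
  assert (Hs : forall m t, (snd (st m) <= t)%nat -> fst (st m) t = 0).
  { intros [|m] t H; [reflexivity|]. apply (Hnx (S m)); auto. }
  exists (fun m => fst (st m)). split.
  - reflexivity.
  - intros [|m] t; [simpl; lra|]. apply (Hnx (S m)).
  - intros [|m] t Hm H; [lia|]. apply (Hnx (S m)). lia.
  - intros [|m] t H; [lia|]. apply (Hnx (S m)). lia.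
  - intros m t H. apply (proj1 (proj2 (Hnx (S m) (snd (st m))))). destruct (le_lt_dec (snd (st m)) t) as [Hl|Hl]; [|lia].
    exfalso. apply H. apply Hs. auto.
  - intros m. exists (snd (st m)). auto.
  - intros [|m] A HA.
    + simpl. replace (diag (fun _ => 0)) with bzero.
      * replace (bzero [*] A [-] A [*] bzero) with bzero by bop.
        apply ob_mono with 0; [left; apply Ht|apply ob_zero].
      * apply Bop_ext; intros x; apply LP_ext; intros t. rewrite diag_app, clip_id, RC_0 by lra.
        bapps. lvs. ring.
    + apply (Hnx (S m)); auto.
Qed.

Section UseCutoffs.
Variables (l : nat -> list Bop) (tau : nat -> R) (Rs : nat -> nat) (w : nat -> nat -> R).
Hypothesis Hw : cutoffs l tau Rs w.

Definition Gd (n : nat) : Bop := diag (fun t => w (n + 1)%nat t - w n t).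
(* For [n = 0] the truncated [n - 1] is [0], and [w 0 = 0]. *)
Definition Gw (n : nat) : Bop := diag (fun t => w (n + 2)%nat t - w (n - 1)%nat t).

Lemma co_mono1 (m t : nat) : w m t <= w (S m) t.
Proof.
  destruct (Req_dec (w m t) 0) as [E0|E0].
  - rewrite E0. apply (co_range Hw).
  - rewrite (co_nested Hw m t E0). apply (co_range Hw).
Qed.

Lemma co_mono (m n t : nat) : (m <= n)%nat -> w m t <= w n t.
Proof. intros H. induction H; [lra|]. eapply Rle_trans; [eauto|apply co_mono1]. Qed.

Lemma co_one_up (m n t : nat) : (m <= n)%nat -> w m t = 1 -> w n t = 1.
Proof.
  intros H H1. pose proof (co_mono m n t H). pose proof (co_range Hw n t). lra.
Qed.

Lemma Gd_clip (n t : nat) : clip (w (n + 1)%nat t - w n t) = w (n + 1)%nat t - w n t.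
Proof.
  apply clip_id. pose proof (co_mono n (n + 1) t ltac:(lia)).
  pose proof (co_range Hw n t). pose proof (co_range Hw (n + 1)%nat t). lra.
Qed.

Lemma Gw_clip (n t : nat) : clip (w (n + 2)%nat t - w (n - 1)%nat t) = w (n + 2)%nat t - w (n - 1)%nat t.
Proof.
  apply clip_id. pose proof (co_mono (n - 1) (n + 2) t ltac:(lia)).
  pose proof (co_range Hw (n - 1)%nat t). pose proof (co_range Hw (n + 2)%nat t). lra.
Qed.

Lemma diag_diff (a b : nat) : (a <= b)%nat ->
  diag (fun t => w b t - w a t) = diag (w b) [-] diag (w a).
Proof.
  intros H. apply Bop_ext; intros x; apply LP_ext; intros t. bapps. lvs. rewrite !diag_app.
  pose proof (co_mono a b t H). pose proof (co_range Hw a t). pose proof (co_range Hw b t).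
  rewrite !clip_id by lra. unfold Rminus. rewrite RC_add, RC_opp. ring.
Qed.

(** Where [Gd n] does not vanish, nesting forces [w (n + 2) = 1] and [w (n - 1) = 0]. The wider
    weight can therefore stand on the left of [WW n] without changing the composite. *)
Lemma Gw_Gd (n : nat) : Gw n [*] Gd n = Gd n.
Proof.
  apply diag_comp. intros t. rewrite Gd_clip, Gw_clip.
  destruct (Req_dec (w (n + 1)%nat t - w n t) 0) as [E0|E0]; [rewrite E0; ring|].
  assert (H1 : w (n + 2)%nat t = 1).
  { replace (n + 2)%nat with (S (n + 1)) by lia. apply (co_nested Hw).
    intros E1. pose proof (co_mono n (n + 1) t ltac:(lia)). pose proof (co_range Hw n t). lra. }
  assert (H2 : w (n - 1)%nat t = 0).
  { destruct n as [|n]; [apply (co_zero Hw)|]. simpl. rewrite Nat.sub_0_r.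
    apply NNPP. intros E1. apply E0.
    rewrite (co_one_up (S n) (S n + 1) t), (co_nested Hw n t E1); [ring|lia|].
    apply (co_nested Hw n t E1). }
  rewrite H1, H2. ring.
Qed.

(** Below [Rs (n - 1)] both cutoffs in the difference are already 1. As [w 0 = 0], this needs
    [n - 1] to be positive. *)
Lemma Qm_Gw (n : nat) : (2 <= n)%nat -> Qm (Rs (n - 1)) [*] Gw n = Gw n.
Proof.
  intros Hn. apply diag_comp. intros t. rewrite Gw_clip, low_clip'. unfold low.
  destruct (Nat.ltb_spec t (Rs (n - 1))) as [H|H]; [|ring].
  rewrite (co_reach Hw (n - 1)%nat t), (co_one_up (n - 1) (n + 2) t);
    try lia; try (apply (co_reach Hw); lia); ring.
Qed.

Lemma Gw_Qm (n : nat) : (2 <= n)%nat -> Gw n [*] Qm (Rs (n - 1)) = Gw n.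
Proof.
  intros Hn. rewrite <- (Qm_Gw n Hn) at 2. apply diag_comm.
Qed.

Lemma Qm_Gd (n : nat) : (2 <= n)%nat -> Qm (Rs (n - 1)) [*] Gd n = Gd n.
Proof. intros Hn. rewrite <- (Gw_Gd n), <- bcompA, Qm_Gw; auto. Qed.

Lemma cpt_diag (v : nat -> R) (s : nat) : (forall t, (s <= t)%nat -> clip (v t) = 0) -> cpt (diag v).
Proof.
  intros H. replace (diag v) with (diag v [*] Pm s); [apply cpt_comp_l, cpt_Pm|].
  apply diag_comp. intros t. rewrite low_clip. unfold low.
  destruct (Nat.ltb_spec t s); [ring|]. rewrite H by auto. ring.
Qed.

Lemma cpt_Gd (n : nat) : cpt (Gd n).
Proof.
  destruct (co_finite Hw (n + 1)) as [s Hs]. apply cpt_diag with s. intros t Ht.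
  rewrite Gd_clip. pose proof (co_mono n (n + 1) t ltac:(lia)). pose proof (co_range Hw n t).
  rewrite Hs in * by auto. lra.
Qed.

Lemma cpt_Gw (n : nat) : cpt (Gw n).
Proof.
  destruct (co_finite Hw (n + 2)) as [s Hs]. apply cpt_diag with s. intros t Ht.
  rewrite Gw_clip. pose proof (co_mono (n - 1) (n + 2) t ltac:(lia)). pose proof (co_range Hw (n - 1)%nat t).
  rewrite Hs in * by auto. lra.
Qed.

Lemma Gd_telescope (N t : nat) : rsum N (fun n => w (n + 1)%nat t - w n t) = w N t.
Proof.
  induction N as [|N IH]; cbn [gsum]; [rewrite (co_zero Hw); auto|].
  rewrite IH. replace (N + 1)%nat with (S N) by lia. ring.
Qed.

Lemma Gd_sum (x : LP) (t : nat) : csum (t + 2) (fun n => lv (Gd n x) t) = lv x t.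
Proof.
  rewrite (gsum_ext _ _ _ _ (fun n => Cmul (lv x t) (RC (w (n + 1)%nat t - w n t)))).
  - rewrite csum_scal, csum_RC, Gd_telescope, (co_exhaust Hw) by lia. rewrite RC_1. ring.
  - intros n _. unfold Gd. rewrite diag_app, Gd_clip. ring.
Qed.

(** At each coordinate the weights lie in the unit interval and add up to at most 1; as [p >= 1], so
    do their p-th powers. *)
Lemma Gd_norm_sum (x : LP) (N : nat) : rsum N (fun n => rpow (nrm (Gd n x)) p) <= rpow (nrm x) p.
Proof.
  apply (sum_nrm_pow_le (fun n => Gd n x)). intros K. rewrite rsum_swap.
  eapply Rle_trans; [|apply (nrm_pow_le x K)]. apply rsum_le. intros t _.
  set (a := rpow (Cnorm (lv x t)) p).
  apply Rle_trans with (rsum N (fun n => a * (w (n + 1)%nat t - w n t))).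
  - apply rsum_le. intros n _. unfold Gd. rewrite diag_app, Gd_clip, Cnorm_mul, Cnorm_RC.
    pose proof (co_mono n (n + 1) t ltac:(lia)). pose proof (co_range Hw n t).
    pose proof (co_range Hw (n + 1)%nat t).
    rewrite Rabs_pos_eq by lra. rewrite rpow_mult by (auto using Cnorm_nonneg; lra).
    rewrite Rmult_comm. apply Rmult_le_compat_l; [apply rpow_nonneg|].
    apply rpow_le_self; [apply pexp_ge1|lra].
  - rewrite rsum_scal, Gd_telescope. pose proof (co_range Hw N t).
    assert (0 <= a) by apply rpow_nonneg. nra.
Qed.

Lemma Gw_local (A : nat -> Bop) : row_local (fun n => Gw n [*] A n).
Proof.
  split.
  - intros n t x H. bapps. unfold Gw. rewrite diag_app, Gw_clip.
    rewrite !(co_exhaust Hw) by lia. rewrite Rminus_diag, RC_0. ring.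
  - intros t.
    (* With the least such [v], an active [n] satisfies [v <= n + 3] by nesting and [n - 1 < v] by
       monotonicity: a window of four indices. *)
    assert (Hv : exists v, w v t = 1 /\ forall m, w m t = 1 -> (v <= m)%nat).
    { assert (Hn : forall k m, (m <= k)%nat -> w m t = 1 -> exists v, w v t = 1 /\ forall m, w m t = 1 -> (v <= m)%nat).
      { induction k as [|k IH]; intros m Hm H1.
        - exists m. split; auto. intros; lia.
        - destruct (classic (exists m', (m' < m)%nat /\ w m' t = 1)) as [(m' & Hm' & H')|Hno].
          + apply (IH m'); auto. lia.
          + exists m. split; auto. intros m'' H''. apply Nat.nlt_ge. intros Hl. apply Hno. eauto. }
      apply (Hn (S t) (S t)); auto. apply (co_exhaust Hw). lia. }
    destruct Hv as (v & Hv1 & Hv2). exists (v - 3)%nat. intros n x Hx.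
    assert (Hne : w (n + 2)%nat t - w (n - 1)%nat t <> 0).
    { intros E0. apply Hx. bapps. unfold Gw. rewrite diag_app, Gw_clip, E0, RC_0. ring. }
    split.
    + assert (w (n + 2)%nat t <> 0).
      { intros E0. pose proof (co_mono (n - 1) (n + 2) t ltac:(lia)).
        pose proof (co_range Hw (n - 1)%nat t). lra. }
      pose proof (co_nested Hw _ _ H) as H1. apply Hv2 in H1. lia.
    + destruct (le_lt_dec v (n - 1)) as [Hl|Hl]; [|lia]. exfalso. apply Hne.
      rewrite (co_one_up v (n - 1) t), (co_one_up v (n + 2) t) by (auto; lia). ring.
Qed.

Lemma Gd_comm (n : nat) (A : Bop) : In A (l n) -> In A (l (n + 1)%nat) ->
  ob (Gd n [*] A [-] A [*] Gd n) (tau (n + 1)%nat + tau n).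
Proof.
  intros H1 H2. unfold Gd. rewrite (diag_diff n (n + 1)) by lia.
  replace ((diag (w (n + 1)) [-] diag (w n)) [*] A [-] A [*] (diag (w (n + 1)) [-] diag (w n)))
    with ((diag (w (n + 1)) [*] A [-] A [*] diag (w (n + 1))) [-] (diag (w n) [*] A [-] A [*] diag (w n))) by bop.
  apply ob_sub; apply (co_comm Hw); auto.
Qed.

Lemma Gw_comm (n : nat) (A : Bop) : In A (l (n - 1)%nat) -> In A (l (n + 2)%nat) ->
  ob (Gw n [*] A [-] A [*] Gw n) (tau (n + 2)%nat + tau (n - 1)%nat).
Proof.
  intros H1 H2. unfold Gw. rewrite (diag_diff (n - 1) (n + 2)) by lia.
  replace ((diag (w (n + 2)) [-] diag (w (n - 1))) [*] A [-] A [*] (diag (w (n + 2)) [-] diag (w (n - 1))))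
    with ((diag (w (n + 2)) [*] A [-] A [*] diag (w (n + 2))) [-] (diag (w (n - 1)) [*] A [-] A [*] diag (w (n - 1)))) by bop.
  apply ob_sub; apply (co_comm Hw); auto.
Qed.

End UseCutoffs.
End Cutoffs.

Arguments Gw_Gd {E l tau Rs w} _.
Arguments Qm_Gd {E l tau Rs w} _.
Arguments Gw_Qm {E l tau Rs w} _.
Arguments cpt_Gd {E l tau Rs w} _.
Arguments cpt_Gw {E l tau Rs w} _.
Arguments Gd_sum {E l tau Rs w} _.
Arguments Gd_norm_sum {E l tau Rs w} _.
Arguments Gw_local {E l tau Rs w} _.
Arguments Gd_comm {E l tau Rs w} _.
Arguments Gw_comm {E l tau Rs w} _.

(** * Dilation of an extension to the model representation *)

Section Dilation.
Context {E : exponent}.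
Notation p := pexp.
Variables (d : nat) (M : pt -> Prop) (x0 : pt) (kk : nat -> nat) (gg : nat -> nat -> pt -> R)
  (xx : nat -> nat -> pt) (dls : nat -> R) (us : nat -> list fn).
Hypothesis Mx0 : M x0.
Hypothesis Hpart : forall n, is_partition d M (dls n) (2 ^ d) (kk n) (gg n) (xx n).
Hypothesis Hus : forall n f, In f (us n) -> cont_on d M f.
Hypothesis Hus_incl : forall m n f, (m <= n)%nat -> In f (us m) -> In f (us n).
Hypothesis Hosc : forall n f x y, In f (us n) -> M x -> M y -> near d x y (dls n) ->
  Cnorm (Cadd (f y) (Copp (f x))) <= (/ 2) ^ n.
Variable T : fn -> Bop.
Hypothesis HT : hommod d M T.
Variable C : R.
Hypothesis C_nonneg : 0 <= C.
Hypothesis HC : forall f s, cont_on d M f -> sup_le M f s -> calk_le (T f) (C * s).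

Definition hh (n i : nat) : fn := fun y => RC (gg n i y).
Definition Ti (n i : nat) : Bop := T (hh n i).
Definition Se (n e : nat) : Bop := sgn_sum (kk n) (Ti n) e.
Definition Kn (n : nat) : Bop := bsum (kk n) (fun i => Ti n i [*] Ti n i) [-] bid.
Definition Ys (n : nat) (f : fn) (e : nat) : Bop :=
  bsum (kk n) (fun i => RC (rad i e) [.] f (xx n i) [.] Ti n i).
(** [Yr] and [Yl] lift the signed sum of the functions [h_i (f - f(x_i))], with [T f] on the right
    and on the left. They measure how far the sign sums are from intertwining [f] with its values at
    the grid points. *)
Definition Yr (n : nat) (f : fn) (e : nat) : Bop := Se n e [*] T f [-] Ys n f e.
Definition Yl (n : nat) (f : fn) (e : nat) : Bop := T f [*] Se n e [-] Ys n f e.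

Lemma hh_cont (n i : nat) : cont_on d M (hh n i).
Proof. apply (Hpart n). Qed.

Lemma rad_abs (i e : nat) : Rabs (rad i e) = 1.
Proof. unfold rad. destruct (Nat.testbit e i); [rewrite Rabs_left; lra|apply Rabs_R1]. Qed.

(** The bound is that of one function, the signed sum of the [h_i], whose modulus is at most their
    plain sum; the number of functions and the signs drop out. *)
Lemma Se_calk (n e : nat) : calk_le (Se n e) (C * 2 ^ d).
Proof.
  apply calk_le_ceq with (T (fsum (kk n) (fun i => fscale (RC (rad i e)) (hh n i)))).
  - apply (hm_lincomb HT (kk n) (fun i => RC (rad i e)) (hh n)). intros; apply hh_cont.
  - apply HC.
    + apply cont_fsum. intros. apply cont_scale, hh_cont.
    + intros y My. unfold fsum. eapply Rle_trans; [apply csum_norm|].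
      destruct (Hpart n) as (_ & _ & Hg & Hs & _).
      eapply Rle_trans; [|apply (Hs y My)]. apply rsum_le. intros i _. unfold fscale, hh.
      rewrite Cnorm_mul, !Cnorm_RC, rad_abs, (Rabs_pos_eq (gg n i y)) by auto. lra.
Qed.

Lemma Kn_cpt (n : nat) : cpt (Kn n).
Proof.
  change (ceq (bsum (kk n) (fun i => Ti n i [*] Ti n i)) bid).
  rewrite <- (hm_one HT).
  transitivity (T (fsum (kk n) (fun i => fmul (hh n i) (hh n i)))).
  - rewrite (hm_fsum HT) by (intros; apply cont_mul; apply hh_cont).
    apply ceq_bsum. intros i _. symmetry. apply (hm_mul HT); apply hh_cont.
  - apply (hm_ext HT).
    + apply cont_fsum. intros. apply cont_mul; apply hh_cont.
    + apply cont_const.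
    + intros y My. unfold fsum, fone, fmul, hh.
      rewrite (gsum_ext _ _ _ _ (fun i => RC (gg n i y * gg n i y))) by (intros; rewrite RC_mul; auto).
      rewrite csum_RC. destruct (Hpart n) as (_ & _ & _ & Hs & _). rewrite (proj1 (Hs y My)).
      apply RC_1.
Qed.

Lemma shift_ceq (f : fn) (c : CC) : cont_on d M f ->
  ceq (T (fadd f (fscale c fone))) (T f [+] c [.] bid).
Proof.
  intros Hf. assert (cont_on d M fone) by apply cont_const.
  rewrite (hm_add HT), (hm_scale HT), (hm_one HT) by auto using cont_scale. reflexivity.
Qed.

(** Where [gg n i] does not vanish, the point is within the mesh of [xx n i], and there [f] varies
    by at most [(1/2)^n]. *)
Lemma osc_sup (n : nat) (f : fn) (e : nat) (F : nat -> fn) : In f (us n) ->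
  (forall i y, M y -> F i y = Cmul (RC (rad i e)) (Cmul (RC (gg n i y)) (Cadd (f y) (Copp (f (xx n i)))))) ->
  sup_le M (fsum (kk n) F) (2 ^ d * (/ 2) ^ n).
Proof.
  intros Hf HF y My. destruct (Hpart n) as (Hx & _ & Hg & Hs & Hn).
  assert (H2 : 0 < (/ 2) ^ n) by (apply pow_lt; lra).
  unfold fsum. eapply Rle_trans; [apply csum_norm|].
  apply Rle_trans with (rsum (kk n) (fun i => (/ 2) ^ n * gg n i y)).
  - apply rsum_le. intros i _. rewrite HF, !Cnorm_mul, !Cnorm_RC, rad_abs, (Rabs_pos_eq (gg n i y)) by auto.
    destruct (Req_dec (gg n i y) 0) as [E0|E0]; [rewrite E0; lra|].
    specialize (Hn i y My E0). pose proof (Hosc n f _ _ Hf (Hx i) My Hn). pose proof (Hg i y). nra.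
  - rewrite rsum_scal, Rmult_comm. apply Rmult_le_compat_r; [lra|]. apply (Hs y My).
Qed.

Lemma Yr_calk (n : nat) (f : fn) (e : nat) : In f (us n) -> calk_le (Yr n f e) (C * (2 ^ d * (/ 2) ^ n)).
Proof.
  intros Hf. pose proof (Hus _ _ Hf) as Cf. assert (C1' : cont_on d M fone) by apply cont_const.
  set (F := fun i => fmul (hh n i) (fadd f (fscale (Copp (f (xx n i))) fone))).
  assert (CF : forall i, cont_on d M (F i)).
  { intros i. apply cont_mul; [apply hh_cont|]. auto using cont_add, cont_scale. }
  apply calk_le_ceq with (T (fsum (kk n) (fun i => fscale (RC (rad i e)) (F i)))).
  - rewrite (hm_lincomb HT) by auto. unfold Yr, Se, Ys, sgn_sum.
    rewrite bsum_comp_r, <- bsum_sub. apply ceq_bsum. intros i _. unfold F.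
    rewrite (hm_mul HT), shift_ceq by (auto using hh_cont, cont_add, cont_scale).
    apply ceq_eq. unfold Ti. bop.
  - apply HC; [apply cont_fsum; auto using cont_scale|]. apply (osc_sup n f e); auto.
    intros i y My. unfold fscale, F, fmul, fadd, hh, fscale, fone. ring.
Qed.

Lemma Yl_calk (n : nat) (f : fn) (e : nat) : In f (us n) -> calk_le (Yl n f e) (C * (2 ^ d * (/ 2) ^ n)).
Proof.
  intros Hf. pose proof (Hus _ _ Hf) as Cf. assert (C1' : cont_on d M fone) by apply cont_const.
  set (F := fun i => fmul (fadd f (fscale (Copp (f (xx n i))) fone)) (hh n i)).
  assert (CF : forall i, cont_on d M (F i)).
  { intros i. apply cont_mul; [|apply hh_cont]. auto using cont_add, cont_scale. }
  apply calk_le_ceq with (T (fsum (kk n) (fun i => fscale (RC (rad i e)) (F i)))).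
  - rewrite (hm_lincomb HT) by auto. unfold Yl, Se, Ys, sgn_sum.
    rewrite bsum_comp_l, <- bsum_sub. apply ceq_bsum. intros i _. unfold F.
    rewrite (hm_mul HT), shift_ceq by (auto using hh_cont, cont_add, cont_scale).
    apply ceq_eq. unfold Ti. bop.
  - apply HC; [apply cont_fsum; auto using cont_scale|]. apply (osc_sup n f e); auto.
    intros i y My. unfold fscale, F, fmul, fadd, hh, fscale, fone. ring.
Qed.

(** The Calkin-norm bound of the sign sums, plus 1 as slack for the passage to norm bounds on
    tails. *)
Definition B0 : R := C * 2 ^ d + 1.

Lemma B0_ge1 : 1 <= B0.
Proof. unfold B0. assert (0 < 2 ^ d) by apply pow2_pos. nra. Qed.

(** Beyond the coordinate [m] all Calkin-norm bounds of scale [n] hold in norm. [Kn] has to be below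
    [(1/4)^n] because [VV] amplifies it by [2^n], which still leaves [(1/2)^n]. *)
Definition stage (n m : nat) : Prop :=
  (forall e, (e < 2 ^ kk n)%nat -> ob (Se n e [*] Qm m) B0) /\
  (forall e, (e < 2 ^ kk n)%nat -> ob (Qm m [*] Se n e) B0) /\
  ob (Kn n [*] Qm m) ((/ 4) ^ n) /\
  (forall f, In f (us n) -> forall e, (e < 2 ^ kk n)%nat -> ob (Yr n f e [*] Qm m) (B0 * (/ 2) ^ n)) /\
  (forall f, In f (us n) -> forall e, (e < 2 ^ kk n)%nat -> ob (Qm m [*] Yl n f e) (B0 * (/ 2) ^ n)).

Lemma all_below_eventually (N : nat) (Q : nat -> nat -> Prop) :
  (forall e, exists m0, forall m, (m0 <= m)%nat -> Q e m) ->
  exists m0, forall m, (m0 <= m)%nat -> forall e, (e < N)%nat -> Q e m.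
Proof.
  intros H. destruct (list_eventually (seq 0 N) Q) as [m0 H0]; [auto|].
  exists m0. intros m Hm e He. apply H0; auto. apply in_seq. lia.
Qed.

Lemma stage_exists (n : nat) : exists m, stage n m.
Proof.
  assert (H2 : 0 < (/ 2) ^ n) by (apply pow_lt; lra).
  assert (Hd : 0 < 2 ^ d) by apply pow2_pos.
  destruct (all_below_eventually (2 ^ kk n) (fun e m => ob (Se n e [*] Qm m) B0)) as [m1 H1].
  { intros e. apply calk_le_tail_r; [apply Se_calk|lra]. }
  destruct (all_below_eventually (2 ^ kk n) (fun e m => ob (Qm m [*] Se n e) B0)) as [m2 H2'].
  { intros e. apply calk_le_tail_l; [apply Se_calk|lra]. }
  destruct (cpt_tail_r (Kn n) ((/ 4) ^ n)) as [m3 H3]; [apply Kn_cpt|apply pow_lt; lra|].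
  assert (HBE : B0 * (/ 2) ^ n = C * (2 ^ d * (/ 2) ^ n) + (/ 2) ^ n) by (unfold B0; ring).
  destruct (list_eventually (us n) (fun f m => forall e, (e < 2 ^ kk n)%nat ->
    ob (Yr n f e [*] Qm m) (B0 * (/ 2) ^ n))) as [m4 H4].
  { intros f Hf. apply (all_below_eventually (2 ^ kk n) (fun e m => ob (Yr n f e [*] Qm m) (B0 * (/ 2) ^ n))).
    intros e. rewrite HBE. apply calk_le_tail_r; [apply Yr_calk; auto|lra]. }
  destruct (list_eventually (us n) (fun f m => forall e, (e < 2 ^ kk n)%nat ->
    ob (Qm m [*] Yl n f e) (B0 * (/ 2) ^ n))) as [m5 H5].
  { intros f Hf. apply (all_below_eventually (2 ^ kk n) (fun e m => ob (Qm m [*] Yl n f e) (B0 * (/ 2) ^ n))).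
    intros e. rewrite HBE. apply calk_le_tail_l; [apply Yl_calk; auto|lra]. }
  set (m := (m1 + m2 + m3 + m4 + m5)%nat). exists m.
  split; [|split; [|split; [|split]]].
  - apply H1. unfold m; lia.
  - apply H2'. unfold m; lia.
  - apply H3. unfold m; lia.
  - apply H4. unfold m; lia.
  - apply H5. unfold m; lia.
Qed.

(** The norm of the constant 1 on the sign vectors for the counting measure. Dividing columns and
    multiplying rows by it passes to the normalized measure and removes [k] from the bounds. *)
Definition ck (n : nat) : R := rpow (2 ^ kk n) (/ p).
Lemma ck_pos (n : nat) : 0 < ck n.
Proof. apply rpow_pos, pow2_pos. Qed.

(* The summands on the slice [2 ^ k], where the model acts by scalars, correct
   [WW n [*] VV n] from [sum T_i^2] to the identity exactly. *)
Definition VV (n : nat) : Bop :=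
  RC (/ ck n) [.] bsum (kk n) (fun i => rc (kk n) i [*] Ti n i)
  [+] RC (2 ^ n) [.] (Js (2 ^ kk n) [*] Kn n).
Definition WW (n : nat) : Bop :=
  RC (ck n) [.] bsum (kk n) (fun i => Ti n i [*] rr (kk n) i)
  [-] RC ((/ 2) ^ n) [.] Cs (2 ^ kk n).

Lemma pow_half_double (n : nat) : (/ 2) ^ n * 2 ^ n = 1.
Proof. rewrite <- Rpow_mult_distr, Rinv_l, pow1; lra. Qed.

Lemma pow_double_quarter (n : nat) : 2 ^ n * (/ 4) ^ n = (/ 2) ^ n.
Proof. rewrite <- Rpow_mult_distr. f_equal. lra. Qed.

Lemma WW_VV (n : nat) : WW n [*] VV n = bid.
Proof.
  unfold WW, VV. set (A := bsum (kk n) (fun i => Ti n i [*] rr (kk n) i)).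
  set (B := bsum (kk n) (fun i => rc (kk n) i [*] Ti n i)).
  assert (HAB : A [*] B = bsum (kk n) (fun i => Ti n i [*] Ti n i)).
  { unfold A. rewrite bsum_comp_r. apply gsum_ext. intros i Hi. unfold B.
    rewrite bsum_comp_l, (bsum_single _ i); auto.
    - rewrite bcompA, <- (bcompA (rr _ _)), rr_rc, Nat.eqb_refl, bcomp1l by auto. reflexivity.
    - intros j Hj Hn. rewrite bcompA, <- (bcompA (rr _ _)), rr_rc by auto.
      destruct (Nat.eqb_spec i j); [lia|]. bop. }
  assert (HAJ : A [*] Js (2 ^ kk n) = bzero).
  { unfold A. rewrite bsum_comp_r. apply bsum_zero. intros i Hi. rewrite bcompA, rr_Js_out. bop. }
  assert (HCB : Cs (2 ^ kk n) [*] B = bzero).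
  { unfold B. rewrite bsum_comp_l. apply bsum_zero. intros i Hi. rewrite <- bcompA, Cs_rc_out. bop. }
  transitivity (Cmul (RC (ck n)) (RC (/ ck n)) [.] (A [*] B)
    [+] Cmul (RC (ck n)) (RC (2 ^ n)) [.] ((A [*] Js (2 ^ kk n)) [*] Kn n)
    [-] Cmul (RC ((/ 2) ^ n)) (RC (/ ck n)) [.] (Cs (2 ^ kk n) [*] B)
    [-] Cmul (RC ((/ 2) ^ n)) (RC (2 ^ n)) [.] ((Cs (2 ^ kk n) [*] Js (2 ^ kk n)) [*] Kn n)); [bop|].
  rewrite HAB, HAJ, HCB, Cs_Js_same, <- !RC_mul, pow_half_double, Rinv_r by (pose proof (ck_pos n); lra).
  unfold Kn. rewrite RC_1. bop.
Qed.

Lemma sgn_sum_comp_r (k : nat) (F : nat -> Bop) (e : nat) (A : Bop) :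
  sgn_sum k (fun i => F i [*] A) e = sgn_sum k F e [*] A.
Proof. unfold sgn_sum. rewrite bsum_comp_r. apply gsum_ext. intros; bop. Qed.

Lemma sgn_sum_comp_l (k : nat) (F : nat -> Bop) (e : nat) (A : Bop) :
  sgn_sum k (fun i => A [*] F i) e = A [*] sgn_sum k F e.
Proof. unfold sgn_sum. rewrite bsum_comp_l. apply gsum_ext. intros; bop. Qed.

Lemma sgn_sum_sub (k : nat) (F G : nat -> Bop) (e : nat) :
  sgn_sum k (fun i => F i [-] G i) e = sgn_sum k F e [-] sgn_sum k G e.
Proof. unfold sgn_sum. rewrite <- bsum_sub. apply gsum_ext. intros; bop. Qed.

Lemma ob_scaled_rc_sum (n : nat) (A : nat -> Bop) (B : R) :
  (forall e, (e < 2 ^ kk n)%nat -> ob (sgn_sum (kk n) A e) B) ->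
  ob (RC (/ ck n) [.] bsum (kk n) (fun i => rc (kk n) i [*] A i)) B.
Proof.
  intros H. pose proof (ck_pos n) as Hc.
  replace B with (Cnorm (RC (/ ck n)) * (ck n * B)).
  - apply ob_scale. apply ob_rc_sum. auto.
  - rewrite Cnorm_RC, Rabs_pos_eq by (left; apply Rinv_0_lt_compat; auto). field. lra.
Qed.

Lemma ob_scaled_rr_sum (n : nat) (A : nat -> Bop) (B : R) :
  (forall e, (e < 2 ^ kk n)%nat -> ob (sgn_sum (kk n) A e) B) ->
  ob (RC (ck n) [.] bsum (kk n) (fun i => A i [*] rr (kk n) i)) B.
Proof.
  intros H. pose proof (ck_pos n) as Hc.
  replace B with (Cnorm (RC (ck n)) * (/ ck n * B)).
  - apply ob_scale. apply ob_rr_sum. auto.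
  - rewrite Cnorm_RC, Rabs_pos_eq by lra. field. lra.
Qed.

Lemma pow_half_le1 (n : nat) : (/ 2) ^ n <= 1.
Proof. rewrite <- (pow1 n). apply pow_incr. lra. Qed.

Lemma ob_VV (n m : nat) : stage n m -> ob (VV n [*] Qm m) (B0 + 1).
Proof.
  intros (H1 & _ & H3 & _).
  replace (VV n [*] Qm m) with (RC (/ ck n) [.] bsum (kk n) (fun i => rc (kk n) i [*] (Ti n i [*] Qm m))
    [+] RC (2 ^ n) [.] (Js (2 ^ kk n) [*] (Kn n [*] Qm m))).
  - apply ob_add.
    + apply ob_scaled_rc_sum. intros e He. rewrite sgn_sum_comp_r. apply H1; auto.
    + apply ob_mono with (Cnorm (RC (2 ^ n)) * (1 * (/ 4) ^ n)).
      * rewrite Cnorm_RC, Rabs_pos_eq by (left; apply pow2_pos). rewrite Rmult_1_l, pow_double_quarter.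
        apply pow_half_le1.
      * apply ob_scale, ob_comp; [apply ob_Js|auto].
  - unfold VV. rewrite bcompDl, !bscale_comp_l, bsum_comp_r, bcompA. do 2 f_equal.
    apply gsum_ext. intros. rewrite bcompA. reflexivity.
Qed.

Lemma ob_WW (n m : nat) : stage n m -> ob (Qm m [*] WW n) (B0 + 1).
Proof.
  intros (_ & H2 & _).
  replace (Qm m [*] WW n) with (RC (ck n) [.] bsum (kk n) (fun i => Qm m [*] Ti n i [*] rr (kk n) i)
    [-] RC ((/ 2) ^ n) [.] (Qm m [*] Cs (2 ^ kk n))).
  - apply ob_sub.
    + apply ob_scaled_rr_sum. intros e He. rewrite sgn_sum_comp_l. apply H2; auto.
    + apply ob_mono with (Cnorm (RC ((/ 2) ^ n)) * (1 * 1)).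
      * rewrite Cnorm_RC, Rabs_pos_eq by (left; apply pow_lt; lra). pose proof (pow_half_le1 n). lra.
      * apply ob_scale, ob_comp; [apply ob_diag|apply ob_Cs].
  - unfold WW. transitivity (RC (ck n) [.] (Qm m [*] bsum (kk n) (fun i => Ti n i [*] rr (kk n) i))
      [-] RC ((/ 2) ^ n) [.] (Qm m [*] Cs (2 ^ kk n))); [|bop].
    rewrite bsum_comp_l. do 2 f_equal. apply gsum_ext. intros. rewrite bcompA. reflexivity.
Qed.

Notation rhon' := (rhon x0 kk xx).

Lemma rhon_VV (n : nat) (f : fn) : rhon' n f [*] VV n =
  RC (/ ck n) [.] bsum (kk n) (fun i => rc (kk n) i [*] (f (xx n i) [.] Ti n i))
  [+] RC (2 ^ n) [.] (Js (2 ^ kk n) [*] (f x0 [.] Kn n)).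
Proof.
  unfold VV. rewrite bcompDr, !bscale_comp_r, bsum_comp_l, <- bcompA, rhon_Js_out. f_equal; [|bop].
  f_equal. apply gsum_ext. intros i Hi. rewrite <- bcompA, rhon_rc by auto. bop.
Qed.

Lemma WW_rhon (n : nat) (f : fn) : WW n [*] rhon' n f =
  RC (ck n) [.] bsum (kk n) (fun i => (f (xx n i) [.] Ti n i) [*] rr (kk n) i)
  [-] RC ((/ 2) ^ n) [.] (f x0 [.] Cs (2 ^ kk n)).
Proof.
  unfold WW. transitivity (RC (ck n) [.] (bsum (kk n) (fun i => Ti n i [*] rr (kk n) i) [*] rhon' n f)
    [-] RC ((/ 2) ^ n) [.] (Cs (2 ^ kk n) [*] rhon' n f)); [bop|].
  rewrite Cs_out_rhon, bsum_comp_r. do 2 f_equal. apply gsum_ext. intros i Hi.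
  rewrite bcompA, rr_rhon by auto. bop.
Qed.

(** Three errors add up: the commutator of the cutoff with [T f], amplified by the sign sums; the
    oscillation of [f] on the cells; and the spare slice, where the model knows only [f x0] but the
    defect [Kn] is tiny. *)
Lemma ob_VV_intertwine (n m : nat) (f : fn) (G : Bop) (b eta tf : R) :
  stage n m -> In f (us n) -> Qm m [*] G = G -> ob G 1 -> ob (T f) tf ->
  (forall e, (e < 2 ^ kk n)%nat -> ob (Se n e) b) ->
  ob (G [*] T f [-] T f [*] G) eta ->
  ob (VV n [*] G [*] T f [-] rhon' n f [*] (VV n [*] G))
     (b * eta + B0 * (/ 2) ^ n + (/ 2) ^ n * (tf + Cnorm (f x0))).
Proof.
  intros Hst Hf HG G1 Htf Hb Heta. destruct Hst as (_ & _ & H3 & H4 & _).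
  rewrite <- bcompA, rhon_VV.
  replace (VV n [*] G [*] T f [-]
    (RC (/ ck n) [.] bsum (kk n) (fun i => rc (kk n) i [*] (f (xx n i) [.] Ti n i))
     [+] RC (2 ^ n) [.] (Js (2 ^ kk n) [*] (f x0 [.] Kn n))) [*] G)
  with (RC (/ ck n) [.] bsum (kk n) (fun i => rc (kk n) i [*]
      (Ti n i [*] (G [*] T f) [-] (f (xx n i) [.] Ti n i) [*] G))
    [+] RC (2 ^ n) [.] (Js (2 ^ kk n) [*] ((Kn n [*] G) [*] T f [-] f x0 [.] (Kn n [*] G)))).
  - apply ob_add.
    + apply ob_scaled_rc_sum. intros e He.
      rewrite (sgn_sum_sub _ (fun i => Ti n i [*] (G [*] T f)) (fun i => (f (xx n i) [.] Ti n i) [*] G)).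
      rewrite !sgn_sum_comp_r. fold (Se n e).
      change (sgn_sum (kk n) (fun i => f (xx n i) [.] Ti n i) e) with (Ys n f e).
      replace (Se n e [*] (G [*] T f) [-] Ys n f e [*] G) with
        (Se n e [*] (G [*] T f [-] T f [*] G) [+] Yr n f e [*] G) by (unfold Yr; bop).
      apply ob_add; [apply ob_comp; auto|].
      rewrite <- HG, <- bcompA, <- (Rmult_1_r (B0 * _)). apply ob_comp; auto.
    + replace ((/ 2) ^ n * (tf + Cnorm (f x0))) with
        (Cnorm (RC (2 ^ n)) * (1 * ((/ 4) ^ n * 1 * tf + Cnorm (f x0) * ((/ 4) ^ n * 1)))).
      * assert (HK : ob (Kn n [*] G) ((/ 4) ^ n * 1)).
        { rewrite <- HG, <- bcompA. apply ob_comp; auto. }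
        apply ob_scale, ob_comp; [apply ob_Js|]. apply ob_sub; [apply ob_comp; auto|apply ob_scale; auto].
      * rewrite Cnorm_RC, Rabs_pos_eq by (left; apply pow2_pos). rewrite <- pow_double_quarter. ring.
  - rewrite (gsum_ext _ _ _ _ (fun i => (rc (kk n) i [*] Ti n i) [*] (G [*] T f) [-]
        (rc (kk n) i [*] (f (xx n i) [.] Ti n i)) [*] G)) by (intros; bop).
    rewrite bsum_sub, <- !bsum_comp_r. unfold VV. bop.
Qed.

Lemma ob_WW_intertwine (n m : nat) (f : fn) (G : Bop) (b eta tf : R) :
  stage n m -> In f (us n) -> G [*] Qm m = G -> ob G 1 -> ob (T f) tf ->
  (forall e, (e < 2 ^ kk n)%nat -> ob (Se n e) b) ->
  ob (G [*] T f [-] T f [*] G) eta ->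
  ob (T f [*] (G [*] WW n) [-] G [*] WW n [*] rhon' n f)
     (eta * b + B0 * (/ 2) ^ n + (/ 2) ^ n * (tf + Cnorm (f x0))).
Proof.
  intros Hst Hf HG G1 Htf Hb Heta. destruct Hst as (_ & _ & _ & _ & H5).
  rewrite (bcompA G), WW_rhon.
  replace (T f [*] (G [*] WW n) [-]
    G [*] (RC (ck n) [.] bsum (kk n) (fun i => (f (xx n i) [.] Ti n i) [*] rr (kk n) i)
     [-] RC ((/ 2) ^ n) [.] (f x0 [.] Cs (2 ^ kk n))))
  with (RC (ck n) [.] bsum (kk n) (fun i => ((T f [*] G) [*] Ti n i [-] G [*] (f (xx n i) [.] Ti n i)) [*] rr (kk n) i)
    [-] RC ((/ 2) ^ n) [.] ((T f [*] G [-] f x0 [.] G) [*] Cs (2 ^ kk n))).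
  - apply ob_sub.
    + apply ob_scaled_rr_sum. intros e He.
      rewrite (sgn_sum_sub _ (fun i => (T f [*] G) [*] Ti n i) (fun i => G [*] (f (xx n i) [.] Ti n i))).
      rewrite !sgn_sum_comp_l. fold (Se n e).
      change (sgn_sum (kk n) (fun i => f (xx n i) [.] Ti n i) e) with (Ys n f e).
      replace ((T f [*] G) [*] Se n e [-] G [*] Ys n f e) with
        ((Copp C1 [.] (G [*] T f [-] T f [*] G)) [*] Se n e [+] G [*] Yl n f e) by (unfold Yl; bop).
      apply ob_add.
      * apply ob_comp; auto. replace eta with (Cnorm (Copp C1) * eta) by (rewrite Cnorm_opp, Cnorm_C1; ring).
        apply ob_scale; auto.
      * rewrite <- HG, bcompA, <- (Rmult_1_l (B0 * _)). apply ob_comp; auto.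
    + replace ((/ 2) ^ n * (tf + Cnorm (f x0))) with
        (Cnorm (RC ((/ 2) ^ n)) * ((tf * 1 + Cnorm (f x0) * 1) * 1)).
      * apply ob_scale, ob_comp; [|apply ob_Cs]. apply ob_sub; [apply ob_comp; auto|apply ob_scale; auto].
      * rewrite Cnorm_RC, Rabs_pos_eq by (left; apply pow_lt; lra). ring.
  - rewrite (gsum_ext _ _ _ _ (fun i => (T f [*] G) [*] (Ti n i [*] rr (kk n) i) [-]
        G [*] ((f (xx n i) [.] Ti n i) [*] rr (kk n) i))) by (intros; bop).
    rewrite bsum_sub, <- !bsum_comp_l. unfold WW. bop.
Qed.

Hypothesis Hbdd : forall f, cont_on d M f -> exists s, 0 <= s /\ sup_le M f s.

(** On the slice [n] the error is compact, as the cutoffs have finite support, and decays like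
    [(1/2)^n] once [f] belongs to the family; the criteria along slices then make the whole error
    compact. *)
Lemma dilation_on_family : exists V W : Bop, W [*] V = bid /\
  forall n f, In f (us n) -> ceq (V [*] T f) (rho x0 kk xx f [*] V) /\ ceq (T f [*] W) (W [*] rho x0 kk xx f).
Proof.
  assert (Mxx : forall n i, M (xx n i)) by (intros; apply (Hpart n)).
  destruct (choice stage stage_exists) as [Rst HRst].
  assert (Hb : forall n, exists b, 0 <= b /\ forall e, (e < 2 ^ kk n)%nat -> ob (Se n e) b).
  { intros n. destruct (list_bounded (seq 0 (2 ^ kk n)) (fun e => ob (Se n e))) as (b & Hb & H).
    - intros a r s Hrs. apply ob_mono; auto.
    - intros e _. destruct (ob_exists (Se n e)) as (r & Hr). exists r. split; auto. apply Hr.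
    - exists b. split; auto. intros e He. apply H. apply in_seq. lia. }
  destruct (choice _ Hb) as [b Hb'].
  (* The slice [n] multiplies commutators of the cutoffs of index [n - 1] to [n + 2] by [b n]. Hence
     [tau m] has to absorb every [b n] with [n <= m + 1] and still leave a geometric factor. *)
  set (tau := fun m => (/ 2) ^ (m + 1) / (1 + rsum (m + 2) b)).
  assert (Hbs : forall m, 0 <= rsum m b) by (intros; apply rsum_nonneg; intros; apply Hb').
  assert (Htau : forall m, 0 < tau m).
  { intros m. apply Rmult_lt_0_compat; [apply pow_lt; lra|]. apply Rinv_0_lt_compat. specialize (Hbs (m + 2)%nat). lra. }
  assert (Hhalf : forall a c, (a <= c)%nat -> (/ 2) ^ c <= (/ 2) ^ a).
  { intros a c Hac. induction Hac as [|c Hac IH]; [lra|]. simpl. assert (0 < (/ 2) ^ c) by (apply pow_lt; lra). lra. }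
  assert (Hbt : forall n m, (n <= m + 1)%nat -> b n * tau m <= (/ 2) ^ n).
  { intros n m Hnm. apply Rle_trans with ((/ 2) ^ (m + 1)); [|apply Hhalf; auto].
    assert (b n <= rsum (m + 2) b) by (apply rsum_ge_term; [lia|intros; apply Hb']).
    assert (Hp : 0 < (/ 2) ^ (m + 1)) by (apply pow_lt; lra). pose proof (Hbs (m + 2)%nat).
    unfold tau. apply Rmult_le_reg_r with (1 + rsum (m + 2) b); [lra|].
    replace (b n * ((/ 2) ^ (m + 1) / (1 + rsum (m + 2) b)) * (1 + rsum (m + 2) b))
      with ((/ 2) ^ (m + 1) * b n) by (field; lra).
    apply Rmult_le_compat_l; lra. }
  set (l := fun m => map T (us m)).
  (* The weights of slice [n] live where the cutoff [n - 1] is not yet 1 or beyond; the shift by one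
     places this beyond [Rst n]. *)
  destruct (cutoffs_exist l tau (fun m => Rst (m + 1)%nat) Htau) as [w Hw].
  assert (HRs : forall n, (2 <= n)%nat -> stage n (Rst (n - 1 + 1)%nat)).
  { intros n Hn. replace (n - 1 + 1)%nat with n by lia. auto. }
  pose proof B0_ge1 as HB0.
  (* The slices 0 and 1 are not pushed beyond their stage and are bounded by their own norms. *)
  assert (HV : exists B, 0 <= B /\ forall n x, nrm (VV n (Gd w n x)) <= B * nrm (Gd w n x)).
  { destruct (ob_exists (VV 0)) as (r0 & Hr0 & H0). destruct (ob_exists (VV 1)) as (r1 & Hr1 & H1).
    exists (B0 + 1 + r0 + r1). split; [lra|]. intros n x. pose proof (nrm_nonneg (Gd w n x)).
    destruct (le_lt_dec 2 n) as [Hn|Hn].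
    - destruct (ob_VV n _ (HRs n Hn)) as [_ HO]. specialize (HO (Gd w n x)).
      replace (VV n (Gd w n x)) with ((VV n [*] Qm (Rst (n - 1 + 1)%nat)) (Gd w n x)); [nra|].
      change ((VV n [*] Qm (Rst (n - 1 + 1)%nat) [*] Gd w n) x = (VV n [*] Gd w n) x).
      rewrite bcompA, (Qm_Gd Hw n Hn). reflexivity.
    - assert (Hn' : n = 0%nat \/ n = 1%nat) by lia.
      destruct Hn' as [-> | ->]; [specialize (H0 (Gd w 0 x))|specialize (H1 (Gd w 1 x))]; nra. }
  destruct HV as (BV & HBV & HV).
  assert (HW : exists B, forall n, ob (Gw w n [*] WW n) B).
  { destruct (ob_exists (Gw w 0 [*] WW 0)) as (r0 & H0). destruct (ob_exists (Gw w 1 [*] WW 1)) as (r1 & H1).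
    assert (0 <= r0) by apply H0. assert (0 <= r1) by apply H1.
    exists (B0 + 1 + r0 + r1). intros n.
    destruct (le_lt_dec 2 n) as [Hn|Hn].
    - apply ob_mono with (1 * (B0 + 1)); [lra|].
      rewrite <- (Gw_Qm Hw n Hn), bcompA. apply ob_comp; [apply ob_diag|]. apply ob_WW; auto.
    - assert (Hn' : n = 0%nat \/ n = 1%nat) by lia.
      destruct Hn' as [-> | ->]; [apply ob_mono with r0|apply ob_mono with r1]; auto; lra. }
  destruct HW as (BW & HW).
  set (Vn := fun n => VV n [*] Gd w n). set (Wn := fun n => Gw w n [*] WW n).
  assert (HVb : col_bound Vn BV).
  { split; auto. intros x N. rewrite rpow_mult by auto using nrm_nonneg.
    eapply Rle_trans; [|apply Rmult_le_compat_l; [apply rpow_nonneg|apply (Gd_norm_sum Hw x N)]].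
    rewrite <- rsum_scal. apply rsum_le. intros n _. rewrite <- rpow_mult by auto using nrm_nonneg.
    apply rpow_le; [apply pexp_nonneg|]. split; [apply nrm_nonneg|apply HV]. }
  assert (HWl : row_local Wn) by apply (Gw_local Hw).
  exists (col Vn), (row Wn). split.
  (* The [n]-th term is [Gw WW VV Gd = Gw Gd = Gd], and at the coordinate [t] the first [t + 2] of
     the [Gd] add up to 1. *)
  - apply Bop_ext. intros x. apply LP_ext. intros t. bapps.
    rewrite (row_app Wn BW) by auto.
    rewrite <- (Gd_sum Hw x t). apply gsum_ext. intros n _.
    change (lv ((Wn n [*] (Cs n [*] col Vn)) x) t = lv (Gd w n x) t).
    rewrite (Cs_col Vn BV) by auto. unfold Wn, Vn.
    rewrite bcompA, <- (bcompA (WW n)), WW_VV, bcomp1l, (Gw_Gd Hw). reflexivity.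
  - intros j f Hf. destruct (ob_exists (T f)) as (tf & Htf).
    destruct (Hbdd f (Hus j f Hf)) as (s & _ & Hs).
    (* In units of [(1/2)^n]: one for each of the two cutoffs in a commutator, [B0] for the
       oscillation, and the rest for the spare slice. *)
    set (cc := 2 + B0 + (tf + Cnorm (f x0))).
    assert (Hin : forall n, (j <= n)%nat -> In f (us n)) by (intros n Hn; apply (Hus_incl j); auto).
    assert (HinT : forall n, (j <= n)%nat -> In (T f) (l n)) by (intros n Hn; apply in_map; auto).
    split.
    + apply (cpt_cols _ cc (j + 2)).
      * intros n.
        replace (Cs n [*] (col Vn [*] T f [-] rho x0 kk xx f [*] col Vn)) with
          (Vn n [*] T f [-] rhon' n f [*] Vn n).
        -- apply cpt_sub; [apply cpt_comp_r|apply cpt_comp_l]; apply cpt_comp_l; apply (cpt_Gd Hw).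
        -- transitivity ((Cs n [*] col Vn) [*] T f [-] (Cs n [*] rho x0 kk xx f) [*] col Vn); [|bop].
           rewrite (Cs_rho Mx0 Mxx f s) by auto. rewrite (bcompA (rhon' n f)), !(Cs_col Vn BV) by auto. reflexivity.
      * intros n Hn.
        replace (Cs n [*] (col Vn [*] T f [-] rho x0 kk xx f [*] col Vn)) with
          (VV n [*] Gd w n [*] T f [-] rhon' n f [*] (VV n [*] Gd w n)).
        -- eapply ob_mono; [|apply (ob_VV_intertwine n (Rst (n - 1 + 1)%nat) f (Gd w n) (b n)
              (tau (n + 1)%nat + tau n) tf)]; auto.
           ++ pose proof (Hbt n (n + 1)%nat ltac:(lia)). pose proof (Hbt n n ltac:(lia)).
              unfold cc. lra.
           ++ apply HRs. lia.
           ++ apply Hin. lia.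
           ++ apply (Qm_Gd Hw). lia.
           ++ apply ob_diag.
           ++ apply Hb'.
           ++ apply (Gd_comm Hw); apply HinT; lia.
        -- change (VV n [*] Gd w n) with (Vn n).
           transitivity ((Cs n [*] col Vn) [*] T f [-] (Cs n [*] rho x0 kk xx f) [*] col Vn); [|bop].
           rewrite (Cs_rho Mx0 Mxx f s) by auto. rewrite (bcompA (rhon' n f)), !(Cs_col Vn BV) by auto. reflexivity.
    + apply (cpt_rows _ cc (j + 2)).
      * intros n.
        replace ((T f [*] row Wn [-] row Wn [*] rho x0 kk xx f) [*] Js n) with
          (T f [*] Wn n [-] Wn n [*] rhon' n f).
        -- apply cpt_sub; [apply cpt_comp_l; apply cpt_comp_r|apply cpt_comp_r, cpt_comp_r]; apply (cpt_Gw Hw).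
        -- transitivity (T f [*] (row Wn [*] Js n) [-] row Wn [*] (rho x0 kk xx f [*] Js n)); [|bop].
           rewrite (rho_Js Mx0 Mxx f s) by auto. rewrite <- (bcompA (row Wn)), !(row_Js Wn BW) by auto. reflexivity.
      * intros n Hn.
        replace ((T f [*] row Wn [-] row Wn [*] rho x0 kk xx f) [*] Js n) with
          (T f [*] (Gw w n [*] WW n) [-] Gw w n [*] WW n [*] rhon' n f).
        -- eapply ob_mono; [|apply (ob_WW_intertwine n (Rst (n - 1 + 1)%nat) f (Gw w n) (b n)
              (tau (n + 2)%nat + tau (n - 1)%nat) tf)]; auto.
           ++ pose proof (Hbt n (n + 2)%nat ltac:(lia)). pose proof (Hbt n (n - 1)%nat ltac:(lia)).
              unfold cc. lra.
           ++ apply HRs. lia.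
           ++ apply Hin. lia.
           ++ apply (Gw_Qm Hw). lia.
           ++ apply ob_diag.
           ++ apply Hb'.
           ++ apply (Gw_comm Hw); apply HinT; lia.
        -- change (Gw w n [*] WW n) with (Wn n).
           transitivity (T f [*] (row Wn [*] Js n) [-] row Wn [*] (rho x0 kk xx f [*] Js n)); [|bop].
           rewrite (rho_Js Mx0 Mxx f s) by auto. rewrite <- (bcompA (row Wn)), !(row_Js Wn BW) by auto. reflexivity.
Qed.

Hypothesis Hdense : forall f eps, cont_on d M f -> 0 < eps -> exists n k (u : nat -> fn) (c : nat -> CC),
  (forall i, (i < k)%nat -> In (u i) (us n)) /\
  sup_le M (fadd f (fscale (Copp C1) (fsum k (fun i => fscale (c i) (u i))))) eps.

Lemma rho_lincomb (k n : nat) (c : nat -> CC) (u : nat -> fn) : (forall i, (i < k)%nat -> In (u i) (us n)) ->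
  rho x0 kk xx (fsum k (fun i => fscale (c i) (u i))) = bsum k (fun i => c i [.] rho x0 kk xx (u i)).
Proof.
  assert (Mxx : forall n i, M (xx n i)) by (intros; apply (Hpart n0)).
  induction k as [|k IH]; intros H.
  - simpl. rewrite (rho_ext Mx0 Mxx _ (fscale C0 fone)).
    + rewrite (rho_scale Mx0 Mxx C0 fone 1) by apply sup_one. apply bscale_0.
    + intros y _. unfold fsum, fscale. simpl. ring.
  - change (fsum (S k) (fun i => fscale (c i) (u i))) with
      (fadd (fsum k (fun i => fscale (c i) (u i))) (fscale (c k) (u k))).
    assert (Cu : forall i, (i < S k)%nat -> cont_on d M (u i)) by (intros; apply (Hus n); auto).
    destruct (Hbdd (fsum k (fun i => fscale (c i) (u i)))) as (s & _ & Hs).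
    { apply cont_fsum. intros; apply cont_scale; auto. }
    destruct (Hbdd (u k)) as (t & _ & Ht); [auto|].
    rewrite (rho_add Mx0 Mxx _ _ s (Cnorm (c k) * t)) by auto using sup_scale.
    rewrite (rho_scale Mx0 Mxx (c k) (u k) t), IH by auto. reflexivity.
Qed.

(** Both sides of the intertwining relations are linear and bounded in [f], so they extend from the
    span of the family: the defect for [f] is a norm limit of compact operators. *)
Lemma dilation : exists V W : Bop, W [*] V = bid /\
  forall f, cont_on d M f -> ceq (V [*] T f) (rho x0 kk xx f [*] V) /\ ceq (T f [*] W) (W [*] rho x0 kk xx f).
Proof.
  assert (Mxx : forall n i, M (xx n i)) by (intros; apply (Hpart n)).
  destruct dilation_on_family as (V & W & HWV & HVW). exists V, W. split; auto.
  destruct (rho_bounded kk Mx0 Mxx) as (Kr & HKr & Hrho).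
  destruct (ob_exists V) as (v & HV). destruct (ob_exists W) as (ww & HW).
  assert (Hv : 0 <= v) by apply HV. assert (Hww : 0 <= ww) by apply HW.
  intros f Hf.
  assert (Happ : forall eps, 0 < eps -> exists f1, exists A B, cont_on d M f1 /\
     ob A (C * eps + eps) /\ ceq (T f) (T f1 [+] A) /\ ob B (Kr * eps) /\
     rho x0 kk xx f = rho x0 kk xx f1 [+] B /\
     ceq (V [*] T f1) (rho x0 kk xx f1 [*] V) /\ ceq (T f1 [*] W) (W [*] rho x0 kk xx f1)).
  { intros eps He. destruct (Hdense f eps Hf He) as (n & k & u & c & Hu & Hsup).
    set (f1 := fsum k (fun i => fscale (c i) (u i))) in *.
    set (g := fadd f (fscale (Copp C1) f1)) in *.
    assert (Cu : forall i, (i < k)%nat -> cont_on d M (u i)) by (intros; apply (Hus n); auto).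
    assert (Cf1 : cont_on d M f1) by (apply cont_fsum; auto using cont_scale).
    assert (Cg : cont_on d M g) by (apply cont_add; auto using cont_scale).
    assert (Efg : feq M f (fadd f1 g)) by (intros y _; unfold g, fadd, fscale; ring).
    destruct (Hbdd f1 Cf1) as (s1 & _ & Hs1).
    destruct (HC g eps Cg Hsup eps He) as (K & HK & HO).
    exists f1, (T g [+] K), (rho x0 kk xx g).
    split; [exact Cf1|]. split; [exact HO|]. split; [|split; [|split; [|split]]].
    - rewrite (hm_ext HT f (fadd f1 g)), (hm_add HT) by auto using cont_add.
      assert (EK : ceq K bzero) by (apply ceq_zero; auto). rewrite EK, badd0r. reflexivity.
    - apply Hrho; auto.
    - rewrite (rho_ext Mx0 Mxx f (fadd f1 g)) by auto.
      apply (rho_add Mx0 Mxx f1 g s1 eps); auto.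
    - assert (ET : ceq (T f1) (bsum k (fun i => c i [.] T (u i)))) by (apply (hm_lincomb HT); auto).
      rewrite ET. unfold f1. rewrite (rho_lincomb k n c u) by auto. rewrite bsum_comp_l, bsum_comp_r. apply ceq_bsum.
      intros i Hi. destruct (HVW n (u i) (Hu i Hi)) as [H1 _].
      rewrite bscale_comp_l, bscale_comp_r, H1. reflexivity.
    - assert (ET : ceq (T f1) (bsum k (fun i => c i [.] T (u i)))) by (apply (hm_lincomb HT); auto).
      rewrite ET. unfold f1. rewrite (rho_lincomb k n c u) by auto. rewrite bsum_comp_l, bsum_comp_r. apply ceq_bsum.
      intros i Hi. destruct (HVW n (u i) (Hu i Hi)) as [_ H1].
      rewrite bscale_comp_l, bscale_comp_r, H1. reflexivity. }
  assert (Hsmall : forall a eps0, 0 <= a -> 0 < eps0 ->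
    exists eps, 0 < eps /\ a * (C * eps + eps) + Kr * eps * a <= eps0).
  { intros a eps0 Ha He0. assert (Hq : 0 <= a * (C + 1 + Kr)) by (apply Rmult_le_pos; lra).
    exists (eps0 / (a * (C + 1 + Kr) + 1)).
    assert (He : 0 < eps0 / (a * (C + 1 + Kr) + 1))
      by (apply Rmult_lt_0_compat; auto; apply Rinv_0_lt_compat; lra).
    split; auto. set (eps := eps0 / (a * (C + 1 + Kr) + 1)) in *.
    replace (a * (C * eps + eps) + Kr * eps * a) with (a * (C + 1 + Kr) * eps) by ring.
    apply Rle_trans with ((a * (C + 1 + Kr) + 1) * eps); [nra|]. right. unfold eps. field. lra. }
  split; apply cpt_limit; intros eps0 He0.
  - destruct (Hsmall v eps0 Hv He0) as (eps & He & Hle).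
    destruct (Happ eps He) as (f1 & A & B & Cf1 & HA & EA & HB & EB & H1 & _).
    (* The witness is the defect of [f] less the small part due to [f - f1]. Modulo the compacts it
       is the defect of [f1], which vanishes there. *)
    exists (V [*] T f [-] rho x0 kk xx f [*] V [-] (V [*] A [-] B [*] V)). split.
    + apply (proj1 (ceq_zero _)). rewrite EB, EA.
      transitivity (V [*] T f1 [-] rho x0 kk xx f1 [*] V); [apply ceq_eq; bop|].
      rewrite H1. apply ceq_eq. bop.
    + replace (V [*] T f [-] rho x0 kk xx f [*] V [-] (V [*] T f [-] rho x0 kk xx f [*] V [-] (V [*] A [-] B [*] V)))
        with (V [*] A [-] B [*] V) by bop.
      apply ob_mono with (v * (C * eps + eps) + Kr * eps * v); auto. apply ob_sub; apply ob_comp; auto.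
  - destruct (Hsmall ww eps0 Hww He0) as (eps & He & Hle).
    destruct (Happ eps He) as (f1 & A & B & Cf1 & HA & EA & HB & EB & _ & H1).
    exists (T f [*] W [-] W [*] rho x0 kk xx f [-] (A [*] W [-] W [*] B)). split.
    + apply (proj1 (ceq_zero _)). rewrite EB, EA.
      transitivity (T f1 [*] W [-] W [*] rho x0 kk xx f1); [apply ceq_eq; bop|].
      rewrite H1. apply ceq_eq. bop.
    + replace (T f [*] W [-] W [*] rho x0 kk xx f [-] (T f [*] W [-] W [*] rho x0 kk xx f [-] (A [*] W [-] W [*] B)))
        with (A [*] W [-] W [*] B) by bop.
      apply ob_mono with ((C * eps + eps) * ww + ww * (Kr * eps)); [lra|]. apply ob_sub; apply ob_comp; auto.
Qed.

End Dilation.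

(** * Direct sums and equivalence of extensions *)

Section Sums.
Context {E : exponent}.

Lemma EvIe (x : LP) : Ev (Ie x) = x.
Proof. change ((Ev [*] Ie) x = x). rewrite Ev_Ie. reflexivity. Qed.
Lemma EvIo (x : LP) : Ev (Io x) = lzero.
Proof. change ((Ev [*] Io) x = lzero). rewrite Ev_Io. reflexivity. Qed.
Lemma OdIe (x : LP) : Od (Ie x) = lzero.
Proof. change ((Od [*] Ie) x = lzero). rewrite Od_Ie. reflexivity. Qed.
Lemma OdIo (x : LP) : Od (Io x) = x.
Proof. change ((Od [*] Io) x = x). rewrite Od_Io. reflexivity. Qed.
Lemma eo_ext (A B : Bop) : Ev [*] A = Ev [*] B -> Od [*] A = Od [*] B -> A = B.
Proof.
  intros H1 H2. rewrite <- (bcomp1l A), <- (bcomp1l B), <- IeEv_IoOd, !bcompDl, !bcompA, H1, H2.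
  reflexivity.
Qed.

(** Two-by-two operator matrices under the identification of l^p with two copies of itself; [dsum]
    is what [sum_ext] becomes for bounded operators. *)
Definition mat (a b c d : Bop) : Bop :=
  Ie [*] (a [*] Ev [+] b [*] Od) [+] Io [*] (c [*] Ev [+] d [*] Od).
Definition dsum (A B : Bop) : Bop := mat A bzero bzero B.

End Sums.

(** Reduces words in [Ev], [Od], [Ie], [Io] by the four relations for composites such as [Ev [*]
    Ie]. The relation [IeEv_IoOd] is not a reduction and is brought in separately, directly or
    through [eo_ext]. *)
Ltac cuntz := intros; unfold dsum, mat; apply Bop_ext; let x := fresh "x" in intro x; bapps;
  repeat first [rewrite b_add | rewrite b_scale | rewrite b_zero
               | rewrite EvIe | rewrite EvIo | rewrite OdIe | rewrite OdIo];
  apply LP_ext; let n := fresh "n" in intro n; lvs; ring.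

Section Equivalence.
Context {E : exponent}.

Lemma mat_mul (a b c d a' b' c' d' : Bop) : mat a b c d [*] mat a' b' c' d' =
  mat (a [*] a' [+] b [*] c') (a [*] b' [+] b [*] d') (c [*] a' [+] d [*] c') (c [*] b' [+] d [*] d').
Proof. cuntz. Qed.

Lemma mat_id : mat bid bzero bzero bid = bid.
Proof. transitivity (Ie [*] Ev [+] Io [*] Od); [cuntz|apply IeEv_IoOd]. Qed.

#[global] Instance mat_ceq : Proper (ceq ==> ceq ==> ceq ==> ceq ==> ceq) mat.
Proof. intros a a' Ha b b' Hb c c' Hc d d' Hd. unfold mat. rewrite Ha, Hb, Hc, Hd. reflexivity. Qed.

#[global] Instance dsum_ceq : Proper (ceq ==> ceq ==> ceq) dsum.
Proof. intros a a' Ha b b' Hb. unfold dsum. rewrite Ha, Hb. reflexivity. Qed.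

Lemma dsum_mul (a b a' b' : Bop) : dsum a b [*] dsum a' b' = dsum (a [*] a') (b [*] b').
Proof. cuntz. Qed.
Lemma dsum_add (a b a' b' : Bop) : dsum (a [+] a') (b [+] b') = dsum a b [+] dsum a' b'.
Proof. cuntz. Qed.
Lemma dsum_scale (c : CC) (a b : Bop) : dsum (c [.] a) (c [.] b) = c [.] dsum a b.
Proof. cuntz. Qed.
Lemma dsum_id : dsum bid bid = bid.
Proof. apply mat_id. Qed.
Lemma dsum_corner (a b : Bop) : Od [*] dsum a b [*] Io = b.
Proof. cuntz. Qed.

Lemma ob_dsum : exists K, 0 <= K /\ forall a b r s, ob a r -> ob b s -> ob (dsum a b) (K * (r + s)).
Proof.
  destruct (ob_exists Ie) as (i & HIe). destruct (ob_exists Io) as (j & HIo).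
  destruct (ob_exists Ev) as (e & HEv). destruct (ob_exists Od) as (o & HOd).
  assert (0 <= i) by apply HIe. assert (0 <= j) by apply HIo.
  assert (0 <= e) by apply HEv. assert (0 <= o) by apply HOd.
  assert (0 <= i * e) by (apply Rmult_le_pos; auto). assert (0 <= j * o) by (apply Rmult_le_pos; auto).
  exists (i * e + j * o). split; [lra|]. intros a b r s Ha Hb.
  assert (0 <= r) by apply Ha. assert (0 <= s) by apply Hb.
  replace (dsum a b) with (Ie [*] a [*] Ev [+] Io [*] b [*] Od) by cuntz.
  apply ob_mono with (i * r * e + j * s * o); [nra|].
  apply ob_add; repeat apply ob_comp; auto.
Qed.

Variables (d : nat) (M : pt -> Prop).
Notation cont := (cont_on d M).

Definition eqv (T1 T2 : fn -> Bop) : Prop := exists S S' : Bop,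
  S [*] S' = bid /\ S' [*] S = bid /\ forall f, cont f -> ceq (T2 f) (S [*] (T1 f [*] S')).

Definition fdsum (T1 T2 : fn -> Bop) (f : fn) : Bop := dsum (T1 f) (T2 f).

Lemma eqv_of_ceq (T1 T2 : fn -> Bop) : (forall f, cont f -> ceq (T1 f) (T2 f)) -> eqv T1 T2.
Proof.
  intros H. exists bid, bid. split; [bop|split; [bop|]]. intros f Hf. rewrite (H f Hf).
  apply ceq_eq. bop.
Qed.

Lemma eqv_refl (T : fn -> Bop) : eqv T T.
Proof. apply eqv_of_ceq. intros; reflexivity. Qed.

Lemma eqv_sym (T1 T2 : fn -> Bop) : eqv T1 T2 -> eqv T2 T1.
Proof.
  intros (S & S' & H1 & H2 & H). exists S', S. split; auto. split; auto. intros f Hf.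
  rewrite (H f Hf). apply ceq_eq.
  transitivity ((S' [*] S) [*] (T1 f [*] (S' [*] S))); [rewrite H2; bop|bop].
Qed.

Lemma eqv_trans (T1 T2 T3 : fn -> Bop) : eqv T1 T2 -> eqv T2 T3 -> eqv T1 T3.
Proof.
  intros (S & S' & H1 & H2 & H) (R & R' & G1 & G2 & G). exists (R [*] S), (S' [*] R').
  split; [|split].
  - transitivity (R [*] (S [*] S') [*] R'); [bop|]. rewrite H1, bcomp1r. auto.
  - transitivity (S' [*] (R' [*] R) [*] S); [bop|]. rewrite G2, bcomp1r. auto.
  - intros f Hf. rewrite (G f Hf), (H f Hf). apply ceq_eq. bop.
Qed.

Lemma eqv_dsum (T1 T1' T2 T2' : fn -> Bop) : eqv T1 T1' -> eqv T2 T2' ->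
  eqv (fdsum T1 T2) (fdsum T1' T2').
Proof.
  intros (S & S' & H1 & H2 & H) (R & R' & G1 & G2 & G). exists (dsum S R), (dsum S' R').
  split; [|split].
  - rewrite dsum_mul, H1, G1. apply dsum_id.
  - rewrite dsum_mul, H2, G2. apply dsum_id.
  - intros f Hf. unfold fdsum. rewrite !dsum_mul, (H f Hf), (G f Hf). reflexivity.
Qed.

Lemma eqv_comm (T1 T2 : fn -> Bop) : eqv (fdsum T1 T2) (fdsum T2 T1).
Proof.
  assert (H : mat bzero bid bid bzero [*] mat bzero bid bid bzero = bid).
  { transitivity (mat bid bzero bzero bid); [cuntz|apply mat_id]. }
  exists (mat bzero bid bid bzero), (mat bzero bid bid bzero). split; auto. split; auto.
  intros f _. apply ceq_eq. unfold fdsum. cuntz.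
Qed.

Lemma eqv_assoc (T1 T2 T3 : fn -> Bop) : eqv (fdsum (fdsum T1 T2) T3) (fdsum T1 (fdsum T2 T3)).
Proof.
  exists (Ie [*] (Ev [*] Ev) [+] Io [*] (Ie [*] (Od [*] Ev)) [+] Io [*] (Io [*] Od)),
    (Ie [*] (Ie [*] Ev) [+] Ie [*] (Io [*] (Ev [*] Od)) [+] Io [*] (Od [*] Od)).
  split; [|split].
  - apply eo_ext; [cuntz|]. apply eo_ext; cuntz.
  - apply eo_ext; [|cuntz]. apply eo_ext; cuntz.
  - intros f _. apply ceq_eq. unfold fdsum. cuntz.
Qed.

Lemma eqv_interchange (T1 T2 T3 T4 : fn -> Bop) :
  eqv (fdsum (fdsum T1 T2) (fdsum T3 T4)) (fdsum (fdsum T1 T3) (fdsum T2 T4)).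
Proof.
  set (S := Ie [*] (Ie [*] (Ev [*] Ev) [+] Io [*] (Ev [*] Od)) [+] Io [*] (Ie [*] (Od [*] Ev) [+] Io [*] (Od [*] Od))).
  assert (H : S [*] S = bid) by (unfold S; apply eo_ext; apply eo_ext; cuntz).
  exists S, S. split; auto. split; auto. intros f _. apply ceq_eq. unfold fdsum, S. cuntz.
Qed.

(** By self-absorption [Th ~ Th' + P ~ Th' + Th' + P ~ Th' + Th], likewise [Th' ~ Th + Th'], and the
    sum is commutative. *)
Lemma absorbing_unique (Th Th' : fn -> Bop) :
  eqv Th (fdsum Th Th) -> eqv Th' (fdsum Th' Th') ->
  (exists P, eqv Th (fdsum Th' P)) -> (exists P, eqv Th' (fdsum Th P)) -> eqv Th Th'.
Proof.
  intros H H' [P HP] [P' HP'].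
  assert (G : forall A B Q, eqv B (fdsum B B) -> eqv A (fdsum B Q) -> eqv A (fdsum B A)).
  { intros A B Q HB HA. eapply eqv_trans; [apply HA|].
    eapply eqv_trans; [apply eqv_dsum; [apply HB|apply eqv_refl]|].
    eapply eqv_trans; [apply eqv_assoc|]. apply eqv_dsum; [apply eqv_refl|]. apply eqv_sym; auto. }
  eapply eqv_trans; [apply (G Th Th' P H' HP)|].
  eapply eqv_trans; [apply eqv_comm|]. apply eqv_sym. apply (G Th' Th P'); auto.
Qed.

Lemma hommod_dsum (T1 T2 : fn -> Bop) : hommod d M T1 -> hommod d M T2 -> hommod d M (fdsum T1 T2).
Proof.
  intros H1 H2. unfold fdsum. split.
  - intros f g Hf Hg Hfg. rewrite (hm_ext H1 f g), (hm_ext H2 f g) by auto. reflexivity.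
  - intros f g Hf Hg. rewrite (hm_add H1), (hm_add H2), dsum_add by auto. reflexivity.
  - intros c f Hf. rewrite (hm_scale H1), (hm_scale H2), dsum_scale by auto. reflexivity.
  - intros f g Hf Hg. rewrite (hm_mul H1), (hm_mul H2), dsum_mul by auto. reflexivity.
  - rewrite (hm_one H1), (hm_one H2), dsum_id. reflexivity.
  - destruct (hm_bd H1) as (C1 & HC1 & B1). destruct (hm_bd H2) as (C2 & HC2 & B2).
    destruct ob_dsum as (K & HK & HO).
    exists (K * (C1 + C2)). split; [apply Rmult_le_pos; lra|]. intros f s Hf Hs eps He.
    set (e := eps / (2 * (K + 1))).
    assert (He' : 0 < e) by (apply Rmult_lt_0_compat; auto; apply Rinv_0_lt_compat; lra).
    destruct (B1 f s Hf Hs e He') as (K1 & HK1 & O1). destruct (B2 f s Hf Hs e He') as (K2 & HK2 & O2).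
    exists (dsum K1 K2). split.
    + apply (proj1 (ceq_zero _)). apply ceq_zero in HK1. apply ceq_zero in HK2. rewrite HK1, HK2.
      apply ceq_eq. cuntz.
    + rewrite <- dsum_add. eapply ob_mono; [|apply HO; eauto].
      assert (K * (2 * e) <= eps); [|lra].
      apply Rle_trans with ((K + 1) * (2 * e)); [nra|]. right. unfold e. field. lra.
Qed.

End Equivalence.

(** * The universal extension *)

(** Data that depend on [M] alone, so that one model serves all extensions. The increasing finite
    sets [us n] have a union with dense span, and the mesh at scale [n] is fine enough for the
    functions in [us n]. *)
Record family (d : nat) (M : pt -> Prop) (kk : nat -> nat) (gg : nat -> nat -> pt -> R)
  (xx : nat -> nat -> pt) (dls : nat -> R) (us : nat -> list fn) : Prop := {
  fam_part : forall n, is_partition d M (dls n) (2 ^ d) (kk n) (gg n) (xx n);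
  fam_mesh : forall n, dls n <= (/ 2) ^ n;
  fam_cont : forall n f, In f (us n) -> cont_on d M f;
  fam_incl : forall m n f, (m <= n)%nat -> In f (us m) -> In f (us n);
  fam_osc : forall n f x y, In f (us n) -> M x -> M y -> near d x y (dls n) ->
    Cnorm (Cadd (f y) (Copp (f x))) <= (/ 2) ^ n;
  fam_dense : forall f eps, cont_on d M f -> 0 < eps -> exists n k (u : nat -> fn) (c : nat -> CC),
    (forall i, (i < k)%nat -> In (u i) (us n)) /\
    sup_le M (fadd f (fscale (Copp C1) (fsum k (fun i => fscale (c i) (u i))))) eps }.

Arguments fam_part {d M kk gg xx dls us} _.
Arguments fam_mesh {d M kk gg xx dls us} _.
Arguments fam_cont {d M kk gg xx dls us} _.
Arguments fam_incl {d M kk gg xx dls us} _.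
Arguments fam_osc {d M kk gg xx dls us} _.
Arguments fam_dense {d M kk gg xx dls us} _.

Lemma near_weaken (d : nat) (x y : pt) (r s : R) : r <= s -> near d x y r -> near d x y s.
Proof. intros Hrs H i Hi. specialize (H i Hi). lra. Qed.

Lemma family_exists (d : nat) (M : pt -> Prop) : (1 <= d)%nat -> compact_set d M -> (exists x, M x) ->
  exists kk gg xx dls us, family d M kk gg xx dls us.
Proof.
  intros Hd HM Hne.
  assert (Hh : forall n, 0 < (/ 2) ^ n) by (intros; apply pow_lt; lra).
  assert (HP : forall dl : posreal, exists q : nat * (nat -> pt -> R) * (nat -> pt),
    is_partition d M dl (2 ^ d) (fst (fst q)) (snd (fst q)) (snd q)).
  { intros [dl Hdl]. destruct (partition_exists d Hd M HM Hne dl Hdl) as (k & g & x & H). exists (k, g, x). auto. }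
  destruct (choice _ HP) as [P HPP].
  set (P0 := fun m => P (mkposreal _ (Hh m))).
  (* The squares form a genuine partition of unity, so the sums of [f(x_i)] times the [i]-th square
     approximate [f] uniformly. *)
  set (uf := fun m i => fun y => RC (snd (fst (P0 m)) i y * snd (fst (P0 m)) i y)).
  set (us := fun n => flat_map (fun m => map (uf m) (seq 0 (fst (fst (P0 m))))) (seq 0 (S n))).
  assert (Hus : forall n f, In f (us n) -> exists m i, (m <= n)%nat /\ (i < fst (fst (P0 m)))%nat /\ f = uf m i).
  { intros n f Hf. apply in_flat_map in Hf. destruct Hf as (m & Hm & Hf). apply in_map_iff in Hf.
    destruct Hf as (i & <- & Hi). apply in_seq in Hm. apply in_seq in Hi. exists m, i. repeat split; lia. }
  assert (Hus' : forall n m i, (m <= n)%nat -> (i < fst (fst (P0 m)))%nat -> In (uf m i) (us n)).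
  { intros n m i Hm Hi. apply in_flat_map. exists m. split; [apply in_seq; lia|].
    apply in_map. apply in_seq. lia. }
  assert (Hc : forall n f, In f (us n) -> cont_on d M f).
  { intros n f Hf. destruct (Hus n f Hf) as (m & i & _ & _ & ->).
    replace (uf m i) with (fmul (fun y => RC (snd (fst (P0 m)) i y)) (fun y => RC (snd (fst (P0 m)) i y))).
    - apply cont_mul; apply (HPP (mkposreal _ (Hh m))).
    - apply functional_extensionality. intros y. unfold fmul, uf. rewrite RC_mul. reflexivity. }
  (* The functions come from the fixed meshes [(1/2)^m]; the mesh of the model is chosen afterwards,
     so there is no circularity. *)
  assert (Hdl : forall n, exists dl : posreal, dl <= (/ 2) ^ n /\ forall f x y, In f (us n) -> M x -> M y ->
    near d x y dl -> Cnorm (Cadd (f y) (Copp (f x))) <= (/ 2) ^ n).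
  { intros n. assert (Hl : forall l, (forall f, In f l -> cont_on d M f) ->
      exists r, 0 < r /\ r <= (/ 2) ^ n /\ forall f x y, In f l -> M x -> M y ->
      near d x y r -> Cnorm (Cadd (f y) (Copp (f x))) <= (/ 2) ^ n).
    { induction l as [|f l IH]; intros Hl.
      - exists ((/ 2) ^ n). split; auto. split; [lra|]. intros f x y [].
      - destruct IH as (r & Hr & Hr2 & H); [intros; apply Hl; right; auto|].
        destruct (cont_uniform d Hd M HM f ((/ 2) ^ n)) as (s & Hs & H'); [apply Hl; left; auto|auto|].
        exists (Rmin r s). pose proof (Rmin_l r s). pose proof (Rmin_r r s).
        split; [apply Rmin_glb_lt; auto|]. split; [lra|].
        intros g x y [<-|Hg] Mx My Hn.
        + apply H'; auto. apply near_weaken with (Rmin r s); auto.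
        + apply H; auto. apply near_weaken with (Rmin r s); auto. }
    destruct (Hl (us n) (Hc n)) as (r & Hr & Hr2 & H). exists (mkposreal r Hr). auto. }
  destruct (choice _ Hdl) as [dls Hdls].
  exists (fun n => fst (fst (P (dls n)))), (fun n => snd (fst (P (dls n)))), (fun n => snd (P (dls n))),
    (fun n => dls n : R), us.
  split; auto.
  - intros n. apply Hdls.
  - intros m n f Hmn Hf. destruct (Hus m f Hf) as (m' & i & Hm & Hi & ->). apply Hus'; auto. lia.
  - intros n. apply Hdls.
  - intros f eps Hf He. destruct (cont_uniform d Hd M HM f eps Hf He) as (r & Hr & Hu).
    destruct (pow_half_small 1 r 0 Hr) as (m & _ & Hm). rewrite Rmult_1_l in Hm.
    pose proof (HPP (mkposreal _ (Hh m))) as HPm.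
    exists m, (fst (fst (P0 m))), (uf m), (fun i => f (snd (P0 m) i)). split.
    + intros i Hi. apply Hus'; auto.
    + fold (P0 m) in HPm. destruct HPm as (Hx & _ & Hg & Hs & Hn). intros y My.
      destruct (Hs y My) as [Hs1 _].
      set (k := fst (fst (P0 m))) in *. set (g := snd (fst (P0 m))) in *. set (x := snd (P0 m)) in *.
      replace (fadd f (fscale (Copp C1) (fsum k (fun i => fscale (f (x i)) (uf m i)))) y)
        with (csum k (fun i => Cmul (RC (g i y * g i y)) (Cadd (f y) (Copp (f (x i)))))).
      * eapply Rle_trans; [apply csum_norm|].
        apply Rle_trans with (rsum k (fun i => eps * (g i y * g i y))); [|rewrite rsum_scal, Hs1; lra].
        apply rsum_le. intros i _. rewrite Cnorm_mul, Cnorm_RC, Rabs_pos_eq by (apply Rle_0_sqr).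
        destruct (Req_dec (g i y) 0) as [E0|E0]; [rewrite E0; lra|].
        rewrite Rmult_comm. apply Rmult_le_compat_r; [apply Rle_0_sqr|].
        apply Hu; auto. apply near_weaken with ((/ 2) ^ m); [auto|apply (Hn i y My E0)].
      * unfold fadd, fscale, fsum.
        rewrite (gsum_ext _ _ k _ (fun i => Cadd (Cmul (f y) (RC (g i y * g i y)))
          (Cmul (Copp C1) (Cmul (f (x i)) (uf m i y))))) by (intros; unfold uf; fold g; ring).
        rewrite csum_add, !csum_scal, csum_RC, Hs1, RC_1. ring.
Qed.

Section Universal.
Context {E : exponent}.
Notation p := pexp.
Variables (d : nat) (M : pt -> Prop) (x0 : pt) (kk : nat -> nat) (gg : nat -> nat -> pt -> R)
  (xx : nat -> nat -> pt) (dls : nat -> R) (us : nat -> list fn).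
Hypothesis d_pos : (1 <= d)%nat.
Hypothesis M_compact : compact_set d M.
Hypothesis Mx0 : M x0.
Hypothesis Hfam : family d M kk gg xx dls us.

Notation rho0 := (rho x0 kk xx).
Definition sigma (f : fn) : Bop := f x0 [.] bid.
(** The scalar summand is the corner into which [Ua] moves the copy of a given extension that sits
    inside [rho0]. *)
Definition Theta0 : fn -> Bop := fdsum sigma rho0.

Lemma Mxx : forall n i, M (xx n i).
Proof. intros n i. apply (fam_part Hfam n). Qed.

Lemma bounded (f : fn) : cont_on d M f -> exists s, 0 <= s /\ sup_le M f s.
Proof. apply cont_bounded; auto. Qed.

Lemma Theta0_ext (f g : fn) : feq M f g -> Theta0 f = Theta0 g.
Proof.
  intros H. unfold Theta0, fdsum, sigma. rewrite (H x0 Mx0), (rho_ext Mx0 Mxx f g H). reflexivity.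
Qed.

Lemma Theta0_add (f g : fn) : cont_on d M f -> cont_on d M g -> Theta0 (fadd f g) = Theta0 f [+] Theta0 g.
Proof.
  intros Hf Hg. destruct (bounded f Hf) as (s & _ & Hs). destruct (bounded g Hg) as (t & _ & Ht).
  unfold Theta0, fdsum, sigma. rewrite (rho_add Mx0 Mxx f g s t Hs Ht), <- dsum_add.
  f_equal. unfold fadd. bop.
Qed.

Lemma Theta0_scale (c : CC) (f : fn) : cont_on d M f -> Theta0 (fscale c f) = c [.] Theta0 f.
Proof.
  intros Hf. destruct (bounded f Hf) as (s & _ & Hs).
  unfold Theta0, fdsum, sigma. rewrite (rho_scale Mx0 Mxx c f s Hs), <- dsum_scale.
  f_equal. unfold fscale. bop.
Qed.

Lemma Theta0_mul (f g : fn) : cont_on d M f -> cont_on d M g -> Theta0 (fmul f g) = Theta0 f [*] Theta0 g.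
Proof.
  intros Hf Hg. destruct (bounded f Hf) as (s & _ & Hs). destruct (bounded g Hg) as (t & _ & Ht).
  unfold Theta0, fdsum, sigma. rewrite (rho_mul Mx0 Mxx f g s t Hs Ht), dsum_mul.
  f_equal. unfold fmul. bop.
Qed.

Lemma Theta0_one : Theta0 fone = bid.
Proof.
  unfold Theta0, fdsum, sigma. rewrite (rho_one Mx0 Mxx).
  transitivity (dsum bid bid); [f_equal; unfold fone; bop|apply dsum_id].
Qed.

Lemma Theta0_bounded : exists K, 0 <= K /\ forall f s, sup_le M f s -> ob (Theta0 f) (K * s).
Proof.
  destruct (rho_bounded kk Mx0 Mxx) as (Kr & HKr & Hrho). destruct ob_dsum as (K & HK & HO).
  exists (K * (1 + Kr)). split; [apply Rmult_le_pos; lra|]. intros f s Hs.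
  replace (K * (1 + Kr) * s) with (K * (1 * s + Kr * s)) by ring.
  apply (HO (sigma f) (rho0 f)); [|apply Hrho; auto]. unfold sigma.
  apply ob_mono with (Cnorm (f x0) * 1); [specialize (Hs x0 Mx0); lra|]. apply ob_scale, ob_id.
Qed.

Lemma Theta0_hommod : hommod d M Theta0.
Proof.
  split.
  - intros f g _ _ H. rewrite (Theta0_ext f g H). reflexivity.
  - intros f g Hf Hg. rewrite Theta0_add by auto. reflexivity.
  - intros c f Hf. rewrite Theta0_scale by auto. reflexivity.
  - intros f g Hf Hg. rewrite Theta0_mul by auto. reflexivity.
  - rewrite Theta0_one. reflexivity.
  - destruct Theta0_bounded as (K & HK & H). exists K. split; auto. intros f s _ Hs.
    apply calk_le_of_ob. auto.
Qed.

Lemma corner_lower (A B : Bop) (s : R) : calk_le (dsum A B) s -> calk_le B s.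
Proof.
  intros H. rewrite <- (dsum_corner A B). replace s with (1 * s * 1) by ring.
  apply calk_le_sandwich; auto using ob_Od, ob_Io.
Qed.

(** The Calkin norm bounds the values at all points [xx n i]. These are dense, since every point of
    [M] lies in some cell of every scale and the meshes tend to zero. *)
Lemma Theta0_lower (f : fn) (s : R) : cont_on d M f -> calk_le (Theta0 f) s -> sup_le M f s.
Proof.
  intros Hf Hs0 y My. pose proof (corner_lower (sigma f) (rho0 f) s Hs0) as Hs. destruct (bounded f Hf) as (t & _ & Ht).
  apply le_epsilon. intros eps He.
  destruct (cont_uniform d d_pos M M_compact f eps Hf He) as (r & Hr & Hu).
  destruct (pow_half_small 1 r 0 Hr) as (n & _ & Hn). rewrite Rmult_1_l in Hn.
  destruct (fam_part Hfam n) as (Hx & _ & Hg & Hsum & Hnear).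
  destruct (classic (exists i, (i < kk n)%nat /\ gg n i y <> 0)) as [(i & Hi & Hgi)|Hno].
  - pose proof (rho_essential_point Mx0 Mxx f t s n i Ht Hi Hs) as Hp.
    pose proof (fam_mesh Hfam n).
    assert (Ho : Cnorm (Cadd (f y) (Copp (f (xx n i)))) <= eps).
    { apply Hu; auto. apply near_weaken with (dls n); [lra|]. apply Hnear; auto. }
    replace (f y) with (Cadd (f (xx n i)) (Cadd (f y) (Copp (f (xx n i))))) by ring.
    eapply Rle_trans; [apply Cnorm_add|]. lra.
  - exfalso. destruct (Hsum y My) as [H1 _].
    rewrite (gsum_ext _ _ _ _ (fun _ => 0)), rsum_const in H1; [lra|].
    intros i Hi. destruct (Req_dec (gg n i y) 0) as [E0|E0]; [rewrite E0; ring|].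
    exfalso. apply Hno. eauto.
Qed.

(** * Infinite multiplicity of the model *)

Definition amp (A : Bop) : Bop := BD (fun _ => A).

Lemma Cs_amp (n : nat) (A : Bop) : Cs n [*] amp A = A [*] Cs n.
Proof. destruct (ob_exists A) as (r & Hr). exact (Cs_BD (fun _ => A) r n (fun _ => Hr)). Qed.

Lemma amp_Js (n : nat) (A : Bop) : amp A [*] Js n = Js n [*] A.
Proof. destruct (ob_exists A) as (r & Hr). exact (BD_Js (fun _ => A) r n (fun _ => Hr)). Qed.

Lemma amp_mul (A B : Bop) : amp A [*] amp B = amp (A [*] B).
Proof.
  apply slice_ext_op. intros n. rewrite <- bcompA, Cs_amp, bcompA, !Cs_amp, bcompA. reflexivity.
Qed.

Lemma amp_add (A B : Bop) : amp A [+] amp B = amp (A [+] B).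
Proof. apply slice_ext_op. intros n. rewrite bcompDr, !Cs_amp, bcompDl. reflexivity. Qed.

Lemma amp_id : amp bid = bid.
Proof. apply slice_ext_op. intros n. rewrite Cs_amp, bcomp1l, bcomp1r. reflexivity. Qed.

Lemma amp_zero : amp bzero = bzero.
Proof. apply slice_ext_op. intros n. rewrite Cs_amp, bcomp0l, bcomp0r. reflexivity. Qed.

Lemma rc_amp (k i : nat) (A : Bop) : amp A [*] rc k i = rc k i [*] A.
Proof.
  unfold rc. rewrite bsum_comp_l, bsum_comp_r. apply gsum_ext. intros e _.
  rewrite bscale_comp_r, amp_Js, bscale_comp_l. reflexivity.
Qed.

Lemma rr_amp (k i : nat) (A : Bop) : rr k i [*] amp A = A [*] rr k i.
Proof.
  unfold rr. rewrite bsum_comp_l, bsum_comp_r. apply gsum_ext. intros e _.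
  rewrite bscale_comp_r, bscale_comp_l, Cs_amp. reflexivity.
Qed.

Lemma rhon_amp (n : nat) (f : fn) (A : Bop) : rhon x0 kk xx n f [*] amp A = amp A [*] rhon x0 kk xx n f.
Proof.
  unfold rhon, Mb. rewrite bcompDl, bcompDr, bsum_comp_l, bsum_comp_r. f_equal; [bop|].
  apply gsum_ext. intros i _.
  rewrite bscale_comp_l, bscale_comp_r, bcompA, rr_amp, <- !bcompA, rc_amp. reflexivity.
Qed.

(** In [l^p(N; l^p(N; l^p))] the model acts on the first two levels, the scale and the sign vector,
    with scalar entries, whereas the double amplification acts on the third. *)
Lemma rho_amp (f : fn) (s : R) (A : Bop) : sup_le M f s -> rho0 f [*] amp (amp A) = amp (amp A) [*] rho0 f.
Proof.
  intros Hs. apply slice_ext_op. intros n.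
  rewrite <- !bcompA, (Cs_rho Mx0 Mxx f s), Cs_amp by auto.
  rewrite !bcompA, Cs_amp, (Cs_rho Mx0 Mxx f s), <- !bcompA, rhon_amp by auto. reflexivity.
Qed.

(** The innermost copy of l^p is split into even and odd coordinates; by [rho_amp] the model passes
    through the splitting, and the equivalence holds exactly. *)
Lemma rho_double : eqv d M rho0 (fdsum rho0 rho0).
Proof.
  set (D := fun A => amp (amp A)).
  assert (Dm : forall A B, D A [*] D B = D (A [*] B)) by (intros; unfold D; rewrite !amp_mul; reflexivity).
  assert (D1 : D bid = bid) by (unfold D; rewrite !amp_id; reflexivity).
  assert (D0 : D bzero = bzero) by (unfold D; rewrite !amp_zero; reflexivity).
  exists (Ie [*] D Ev [+] Io [*] D Od), (D Ie [*] Ev [+] D Io [*] Od). split; [|split].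
  - transitivity (Ie [*] (D Ev [*] D Ie) [*] Ev [+] Ie [*] (D Ev [*] D Io) [*] Od
      [+] (Io [*] (D Od [*] D Ie) [*] Ev [+] Io [*] (D Od [*] D Io) [*] Od)); [bop|].
    rewrite !Dm, Ev_Ie, Ev_Io, Od_Ie, Od_Io, D1, D0.
    transitivity (Ie [*] Ev [+] Io [*] Od); [bop|apply IeEv_IoOd].
  - transitivity (D Ie [*] (Ev [*] Ie) [*] D Ev [+] D Ie [*] (Ev [*] Io) [*] D Od
      [+] (D Io [*] (Od [*] Ie) [*] D Ev [+] D Io [*] (Od [*] Io) [*] D Od)); [bop|].
    rewrite Ev_Ie, Ev_Io, Od_Ie, Od_Io.
    transitivity (D Ie [*] D Ev [+] D Io [*] D Od); [bop|].
    rewrite !Dm. unfold D. rewrite !amp_add, IeEv_IoOd. apply D1.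
  - intros f Hf. destruct (bounded f Hf) as (s & _ & Hs). apply ceq_eq. unfold fdsum.
    assert (HD : forall A B, D A [*] rho0 f [*] D B = rho0 f [*] D (A [*] B)).
    { intros A B. unfold D at 1. rewrite <- (rho_amp f s) by auto. rewrite bcompA. fold (D A). rewrite Dm. reflexivity. }
    transitivity (Ie [*] (D Ev [*] rho0 f [*] D Ie) [*] Ev [+] Ie [*] (D Ev [*] rho0 f [*] D Io) [*] Od
      [+] (Io [*] (D Od [*] rho0 f [*] D Ie) [*] Ev [+] Io [*] (D Od [*] rho0 f [*] D Io) [*] Od)); [|bop].
    rewrite !HD, Ev_Ie, Ev_Io, Od_Ie, Od_Io, D1, D0. cuntz.
Qed.

Lemma Theta0_double : eqv d M Theta0 (fdsum Theta0 Theta0).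
Proof.
  eapply eqv_trans; [|apply eqv_interchange]. apply eqv_dsum; [|apply rho_double].
  apply eqv_of_ceq. intros f _. apply ceq_eq. unfold fdsum, sigma. rewrite dsum_scale, dsum_id. reflexivity.
Qed.

(** * The complement of a given extension *)

Section Inverse.
Variable T : fn -> Bop.
Hypothesis HT : hommod d M T.
Variables V W : Bop.
Hypothesis HWV : W [*] V = bid.
Hypothesis HV : forall f, cont_on d M f -> ceq (V [*] T f) (rho0 f [*] V).
Hypothesis HW : forall f, cont_on d M f -> ceq (T f [*] W) (W [*] rho0 f).

Definition Nc : Bop := bid [-] V [*] W.
(** [V [*] W] and [Nc] are complementary idempotents. Filling the range of the former with the
    scalar [f x0] makes the compression to the range of [Nc] unital. *)
Definition psi (f : fn) : Bop := f x0 [.] (V [*] W) [+] Nc [*] rho0 f [*] Nc.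

Lemma W_Nc : W [*] Nc = bzero.
Proof. transitivity (W [-] (W [*] V) [*] W); [unfold Nc; bop|]. rewrite HWV. bop. Qed.
Lemma Nc_V : Nc [*] V = bzero.
Proof. transitivity (V [-] V [*] (W [*] V)); [unfold Nc; bop|]. rewrite HWV. bop. Qed.
Lemma Nc_Nc : Nc [*] Nc = Nc.
Proof. transitivity (Nc [-] V [*] (W [*] Nc)); [unfold Nc at 1; bop|]. rewrite W_Nc. bop. Qed.

(** The two intertwining relations carry [rho0 f] through [W] and then through [V]. This makes the
    compression by [Nc] multiplicative and kills the off-diagonal entries in [Theta0_split]. *)
Lemma Nc_rho (f : fn) : cont_on d M f -> ceq (Nc [*] rho0 f) (rho0 f [*] Nc).
Proof.
  intros Hf. transitivity (rho0 f [-] V [*] (W [*] rho0 f)); [apply ceq_eq; unfold Nc; bop|].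
  rewrite <- (HW f Hf), <- bcompA, (HV f Hf). apply ceq_eq. unfold Nc. bop.
Qed.

Definition Ua : Bop := mat bzero W V Nc.

Lemma Ua_Ua : Ua [*] Ua = bid.
Proof.
  assert (EN : V [*] W [+] Nc = bid) by (unfold Nc; bop).
  unfold Ua. rewrite mat_mul, W_Nc, Nc_V, Nc_Nc, HWV, EN.
  transitivity (mat bid bzero bzero bid); [cuntz|apply mat_id].
Qed.

Lemma Theta0_split : eqv d M Theta0 (fdsum T psi).
Proof.
  exists Ua, Ua. split; [apply Ua_Ua|split; [apply Ua_Ua|]]. intros f Hf.
  unfold Theta0, fdsum, Ua, dsum. rewrite !mat_mul.
  apply mat_ceq.
  - transitivity (W [*] (rho0 f [*] V)); [|apply ceq_eq; bop].
    rewrite <- (HV f Hf), <- bcompA, HWV, bcomp1l. reflexivity.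
  - transitivity (W [*] (rho0 f [*] Nc)); [|apply ceq_eq; bop].
    rewrite <- (Nc_rho f Hf), <- bcompA, W_Nc. apply ceq_eq. bop.
  - transitivity (Nc [*] rho0 f [*] V); [|apply ceq_eq; bop].
    rewrite (Nc_rho f Hf), bcompA, Nc_V. apply ceq_eq. bop.
  - apply ceq_eq. unfold psi, sigma. bop.
Qed.

Lemma psi_hommod : hommod d M psi.
Proof.
  split.
  - intros f g _ _ H. unfold psi. rewrite (H x0 Mx0), (rho_ext Mx0 Mxx f g H). reflexivity.
  - intros f g Hf Hg. destruct (bounded f Hf) as (s & _ & Hs). destruct (bounded g Hg) as (t & _ & Ht).
    unfold psi. rewrite (rho_add Mx0 Mxx f g s t Hs Ht). apply ceq_eq. unfold fadd. bop.
  - intros c f Hf. destruct (bounded f Hf) as (s & _ & Hs).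
    unfold psi. rewrite (rho_scale Mx0 Mxx c f s Hs). apply ceq_eq. unfold fscale. bop.
  - intros f g Hf Hg. destruct (bounded f Hf) as (s & _ & Hs). destruct (bounded g Hg) as (t & _ & Ht).
    unfold psi. rewrite (rho_mul Mx0 Mxx f g s t Hs Ht).
    transitivity (Cmul (f x0) (g x0) [.] (V [*] (W [*] V) [*] W)
      [+] f x0 [.] (V [*] (W [*] Nc) [*] rho0 g [*] Nc)
      [+] g x0 [.] (Nc [*] rho0 f [*] (Nc [*] V) [*] W)
      [+] Nc [*] rho0 f [*] (Nc [*] Nc) [*] rho0 g [*] Nc); [|apply ceq_eq; bop].
    rewrite HWV, W_Nc, Nc_V, Nc_Nc.
    rewrite (bcompA (Nc [*] rho0 f) Nc (rho0 g)), (Nc_rho g Hg).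
    transitivity (Cmul (f x0) (g x0) [.] (V [*] W) [+] Nc [*] rho0 f [*] rho0 g [*] (Nc [*] Nc)); [|apply ceq_eq; bop].
    rewrite Nc_Nc. apply ceq_eq. unfold fmul. bop.
  - unfold psi. rewrite (rho_one Mx0 Mxx), bcomp1r, Nc_Nc. apply ceq_eq. unfold fone, Nc. bop.
  - destruct (rho_bounded kk Mx0 Mxx) as (Kr & HKr & Hrho).
    destruct (ob_exists (V [*] W)) as (q & Hq). destruct (ob_exists Nc) as (r & Hr).
    assert (Hq0 : 0 <= q) by apply Hq. assert (Hr0 : 0 <= r) by apply Hr.
    exists (q + r * Kr * r). split.
    { apply Rplus_le_le_0_compat; auto. apply Rmult_le_pos; auto. apply Rmult_le_pos; auto. }
    intros f s Hf Hs. apply calk_le_of_ob. unfold psi.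
    apply ob_mono with (Cnorm (f x0) * q + r * (Kr * s) * r).
    + specialize (Hs x0 Mx0). nra.
    + apply ob_add; [apply ob_scale; auto|]. repeat apply ob_comp; auto.
Qed.

End Inverse.

(** The compression [psi] may fail to be bounded below, so a copy of [Theta0] is added to it;
    [Theta0_double] pays for this copy. *)
Lemma Theta0_absorbs (T : fn -> Bop) : hommod d M T -> exists P : fn -> Bop,
  hommod d M P /\ (forall f s, cont_on d M f -> calk_le (P f) s -> sup_le M f s) /\
  eqv d M Theta0 (fdsum T P).
Proof.
  intros HT. destruct (hm_bd HT) as (C & HC0 & HC).
  destruct (dilation d M x0 kk gg xx dls us Mx0 (fam_part Hfam) (fam_cont Hfam)
    (fam_incl Hfam) (fam_osc Hfam) T HT C HC0 HC bounded
    (fam_dense Hfam)) as (V & W & HWV & HVW).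
  assert (HV : forall f, cont_on d M f -> ceq (V [*] T f) (rho0 f [*] V))
    by (intros f Hf; exact (proj1 (HVW f Hf))).
  assert (HW : forall f, cont_on d M f -> ceq (T f [*] W) (W [*] rho0 f))
    by (intros f Hf; exact (proj2 (HVW f Hf))).
  exists (fdsum (psi V W) Theta0). split; [|split].
  - apply hommod_dsum; [apply (psi_hommod T V W); auto|apply Theta0_hommod].
  - intros f s Hf Hs. apply Theta0_lower; auto. exact (corner_lower (psi V W f) (Theta0 f) s Hs).
  - eapply eqv_trans; [apply Theta0_double|].
    eapply eqv_trans; [apply eqv_dsum; [apply (Theta0_split T V W); auto|apply eqv_refl]|].
    apply eqv_assoc.
Qed.

End Universal.

(** * Raw operators and bounded operators *)

Section Transfer.
Context {E : exponent}.
Notation p := pexp.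

Definition repr (T : op) (A : Bop) : Prop := forall x : LP, T (lv x) = lv (A x).

(** Raw operators are total on sequences; outside l^p the zero sequence is a default value. *)
Definition ofB (A : Bop) : op := fun x =>
  match excluded_middle_informative (lp p x) with
  | left H => lv (A (exist _ x H))
  | right _ => fun _ => C0
  end.

Lemma repr_ofB (A : Bop) : repr (ofB A) A.
Proof.
  intros [x Hx]. unfold ofB, lv at 1 2. simpl.
  destruct (excluded_middle_informative (lp p x)) as [H|H]; [|contradiction].
  replace H with Hx by apply proof_irrelevance. reflexivity.
Qed.

Lemma lp_ex (x : vec) : lp p x -> exists y : LP, lv y = x.
Proof. intros H. exists (exist _ x H). reflexivity. Qed.

Lemma op_bound_iff (T : op) (A : Bop) (r : R) : repr T A -> (op_bound p T r <-> ob A r).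
Proof.
  intros HR. split.
  - intros H. split.
    (* The sign of [r] is read off at the zero vector, because [lp_norm_le] includes the
       nonnegativity of its bound. *)
    + pose proof (H (lv lzero) 1) as H0. destruct H0 as [H0 _]; [|lra].
      apply nrm_le_iff. rewrite nrm_zero. lra.
    + intros x. apply nrm_le_iff. rewrite <- HR. apply H. apply nrm_self.
  - intros [Hr H] x s Hx. destruct (lp_ex x) as [y <-]; [exists s; auto|].
    apply nrm_le_iff in Hx. rewrite HR. apply nrm_le_iff. eapply Rle_trans; [apply H|].
    apply Rmult_le_compat_l; auto.
Qed.

Lemma bdd_repr (T : op) (A : Bop) : repr T A -> bdd p T.
Proof.
  intros HR. split; [|split].
  - intros x y Hx Hy n. destruct (lp_ex x Hx) as [x' <-]. destruct (lp_ex y Hy) as [y' <-].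
    change (vadd (lv x') (lv y')) with (lv (ladd x' y')). rewrite !HR, b_add. reflexivity.
  - intros c x Hx n. destruct (lp_ex x Hx) as [x' <-].
    change (vscale c (lv x')) with (lv (lscale c x')). rewrite !HR, b_scale. reflexivity.
  - destruct (ob_exists A) as [r Hr]. exists r. apply (op_bound_iff T A); auto.
Qed.

Definition toB (T : op) : Bop := mkB (fun x => T (lv x)).

Lemma repr_toB (T : op) : bdd p T -> repr T (toB T).
Proof.
  intros (H1 & H2 & r & H3) x. unfold toB. apply functional_extensionality. intros n.
  rewrite mkB_app; auto.
  assert (Hr : 0 <= r).
  { pose proof (H3 (lv lzero) 1) as H0. destruct H0 as [H0 _]; [|lra].
    apply nrm_le_iff. rewrite nrm_zero. lra. }
  apply good_map_intro with r; auto.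
  - intros u v m. exact (H1 (lv u) (lv v) (proj2_sig u) (proj2_sig v) m).
  - intros c u m. exact (H2 c (lv u) (proj2_sig u) m).
  - intros u. apply H3. apply nrm_self.
Qed.

Lemma repr_add (T S : op) (A B : Bop) : repr T A -> repr S B -> repr (op_add T S) (A [+] B).
Proof. intros HA HB x. unfold op_add. rewrite HA, HB. reflexivity. Qed.

Lemma repr_sub (T S : op) (A B : Bop) : repr T A -> repr S B -> repr (op_sub T S) (A [-] B).
Proof.
  intros HA HB x. unfold op_sub. rewrite HA, HB. apply functional_extensionality. intros n.
  unfold vsub. bapps. lvs. ring.
Qed.

Lemma repr_scale (c : CC) (T : op) (A : Bop) : repr T A -> repr (op_scale c T) (c [.] A).
Proof. intros HA x. unfold op_scale. rewrite HA. reflexivity. Qed.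

Lemma repr_comp (T S : op) (A B : Bop) : repr T A -> repr S B -> repr (op_comp T S) (A [*] B).
Proof. intros HA HB x. unfold op_comp. rewrite HB, HA. reflexivity. Qed.

Lemma repr_id : repr op_id bid.
Proof. intros x. reflexivity. Qed.

Lemma repr_sum (P Q : fn -> op) (f : fn) (A B : Bop) : repr (P f) A -> repr (Q f) B ->
  repr (sum_ext P Q f) (dsum A B).
Proof.
  intros HA HB x. unfold sum_ext. apply functional_extensionality. intros n.
  assert (He : evens (lv x) = lv (Ev x)).
  { apply functional_extensionality. intros m. rewrite Ev_app. reflexivity. }
  assert (Ho : odds (lv x) = lv (Od x)).
  { apply functional_extensionality. intros m. rewrite Od_app. reflexivity. }
  rewrite He, Ho, HA, HB. unfold dsum, mat, interleave. bapps. lvs. rewrite Ie_app, Io_app.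
  destruct (Nat.even n); lvs; ring.
Qed.

Lemma op_eq_iff (T S : op) (A B : Bop) : repr T A -> repr S B -> (op_eq p T S <-> A = B).
Proof.
  intros HA HB. split.
  - intros H. apply Bop_ext. intros x. apply LP_ext. intros n. rewrite <- HA, <- HB.
    exact (H (lv x) (proj2_sig x) n).
  - intros -> x Hx n. destruct (lp_ex x Hx) as [y <-]. rewrite HA, HB. reflexivity.
Qed.

Lemma compact_op_iff (T : op) (A : Bop) : repr T A -> (compact_op p T <-> cpt A).
Proof.
  intros HR. split.
  - intros [_ H] eps He. destruct (H eps He) as [ys Hy].
    (* Net points of the raw definition may lie outside l^p and are then replaced by zero. A point
       within [eps] of an image lies in l^p, so no point in use is changed. *)
    exists (map (fun y => match excluded_middle_informative (lp p y) with
      left Hl => exist _ y Hl | right _ => lzero end) ys).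
    intros x Hx. destruct (Hy (lv x)) as (y & Iy & Ny); [apply nrm_le_iff; auto|].
    rewrite HR in Ny.
    assert (Hly : lp p y).
    { exists (nrm (A x) + 1 * eps). replace y with (vadd (lv (A x)) (vscale (Copp C1) (vsub (lv (A x)) y))).
      - apply lp_norm_le_add; [apply nrm_self|]. rewrite <- Cnorm_C1, <- (Cnorm_opp C1).
        apply lp_norm_le_scale; auto.
      - apply functional_extensionality. intros n. unfold vadd, vscale, vsub. ring. }
    exists (exist _ y Hly). split.
    + apply in_map_iff. exists y. split; auto.
      destruct (excluded_middle_informative (lp p y)) as [Hl|Hl]; [|contradiction].
      f_equal. apply proof_irrelevance.
    + apply nrm_le_iff. replace (lv (lsub (A x) (exist _ y Hly))) with (vsub (lv (A x)) y); auto.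
      apply functional_extensionality. intros n. unfold vsub, lsub. lvs. simpl. ring.
  - intros H. split; [eapply bdd_repr; eauto|]. intros eps He. destruct (H eps He) as [ys Hy].
    exists (map lv ys). intros x Hx. destruct (lp_ex x) as [x' <-]; [exists 1; auto|].
    destruct (Hy x') as (y & Iy & Ny); [apply nrm_le_iff; auto|].
    exists (lv y). split; [apply in_map; auto|]. rewrite HR. apply nrm_le_iff in Ny.
    replace (vsub (lv (A x')) (lv y)) with (lv (lsub (A x') y)); auto.
    apply functional_extensionality. intros n. unfold vsub, lsub. lvs. ring.
Qed.

Lemma calk_eq_iff (T S : op) (A B : Bop) : repr T A -> repr S B -> (calk_eq p T S <-> ceq A B).
Proof. intros HA HB. apply compact_op_iff. apply repr_sub; auto. Qed.

Lemma calk_norm_iff (T : op) (A : Bop) (r : R) : repr T A -> (calk_norm_le p T r <-> calk_le A r).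
Proof.
  intros HA. split; intros H eps He; destruct (H eps He) as (K & HK & HO).
  - assert (HR : repr K (toB K)) by (apply repr_toB; apply HK).
    exists (toB K). split; [apply (compact_op_iff K); auto|].
    apply (op_bound_iff (op_add T K)); auto. apply repr_add; auto.
  - exists (ofB K). pose proof (repr_ofB K) as HR. split; [apply (compact_op_iff (ofB K) K); auto|].
    apply (op_bound_iff (op_add T (ofB K)) (A [+] K)); auto. apply repr_add; auto.
Qed.

(** * Extensions as homomorphisms modulo the compacts *)

Variables (d : nat) (M : pt -> Prop).

Lemma hommod_of_ext (Phi : fn -> op) : is_ext p d M Phi ->
  hommod d M (fun f => toB (Phi f)) /\ forall f, cont_on d M f -> repr (Phi f) (toB (Phi f)).
Proof.
  intros (H1 & H2 & H3 & H4 & H5 & H6 & C & HC & H7).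
  assert (HR : forall f, cont_on d M f -> repr (Phi f) (toB (Phi f))) by (intros; apply repr_toB; auto).
  split; auto. split.
  - intros f g Hf Hg Hfg. apply (calk_eq_iff (Phi f) (Phi g)); auto.
  - intros f g Hf Hg. apply (calk_eq_iff (Phi (fadd f g)) (op_add (Phi f) (Phi g))); auto.
    + apply HR, cont_add; auto.
    + apply repr_add; auto.
  - intros c f Hf. apply (calk_eq_iff (Phi (fscale c f)) (op_scale c (Phi f))); auto.
    + apply HR, cont_scale; auto.
    + apply repr_scale; auto.
  - intros f g Hf Hg. apply (calk_eq_iff (Phi (fmul f g)) (op_comp (Phi f) (Phi g))); auto.
    + apply HR, cont_mul; auto.
    + apply repr_comp; auto.
  - apply (calk_eq_iff (Phi fone) op_id); auto; [apply HR, cont_const|apply repr_id].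
  - exists C. split; [lra|]. intros f s Hf Hs. apply (calk_norm_iff (Phi f)); auto. apply H7; auto.
Qed.

Lemma ext_of_hommod (T : fn -> Bop) : (exists x, M x) -> hommod d M T ->
  (forall f s, cont_on d M f -> calk_le (T f) s -> sup_le M f s) ->
  is_ext p d M (fun f => ofB (T f)).
Proof.
  intros [x0 Mx0] HT Hlow. assert (HR : forall f, repr (ofB (T f)) (T f)) by (intros; apply repr_ofB).
  split; [|split; [|split; [|split; [|split; [|split]]]]].
  - intros f _. eapply bdd_repr; apply HR.
  - intros f g Hf Hg Hfg. apply (calk_eq_iff _ _ (T f) (T g)); auto. apply (hm_ext HT); auto.
  - intros f g Hf Hg. apply (calk_eq_iff _ _ (T (fadd f g)) (T f [+] T g)); auto using repr_add.
    apply (hm_add HT); auto.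
  - intros c f Hf. apply (calk_eq_iff _ _ (T (fscale c f)) (c [.] T f)); auto using repr_scale.
    apply (hm_scale HT); auto.
  - intros f g Hf Hg. apply (calk_eq_iff _ _ (T (fmul f g)) (T f [*] T g)); auto using repr_comp.
    apply (hm_mul HT); auto.
  - apply (calk_eq_iff _ _ (T fone) bid); auto using repr_id. apply (hm_one HT); auto.
  (* Adding 1 makes the constant at least 1. Enlarging it is harmless, since a bound for [f] on the
     nonempty set [M] is nonnegative. *)
  - destruct (hm_bd HT) as (C & HC & HB). exists (C + 1). split; [lra|]. intros f Hf. split.
    + intros s Hs. apply (calk_norm_iff _ (T f)) in Hs; auto. pose proof (Hlow f s Hf Hs) as Hl.
      intros x Mx. specialize (Hl x Mx). pose proof (Cnorm_nonneg (f x)). nra.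
    + intros s Hs. apply (calk_norm_iff _ (T f)); auto.
      assert (Hs0 : 0 <= s) by (specialize (Hs x0 Mx0); pose proof (Cnorm_nonneg (f x0)); lra).
      intros eps He. destruct (HB f s Hf Hs eps He) as (K & HK & HO). exists K. split; auto.
      apply ob_mono with (C * s + eps); auto. lra.
Qed.

Lemma equiv_ext_iff (P1 P2 : fn -> op) (T1 T2 : fn -> Bop) :
  (forall f, cont_on d M f -> repr (P1 f) (T1 f)) -> (forall f, cont_on d M f -> repr (P2 f) (T2 f)) ->
  (equiv_ext p d M P1 P2 <-> eqv d M T1 T2).
Proof.
  intros R1 R2. split.
  - intros (S & S' & (B1 & B2 & I1 & I2) & H).
    pose proof (repr_toB S B1) as RS. pose proof (repr_toB S' B2) as RS'.
    exists (toB S), (toB S'). split; [|split].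
    + apply (op_eq_iff (op_comp S S') op_id); auto using repr_comp, repr_id.
    + apply (op_eq_iff (op_comp S' S) op_id); auto using repr_comp, repr_id.
    + intros f Hf. apply (calk_eq_iff (P2 f) (op_comp S (op_comp (P1 f) S'))); auto using repr_comp.
  - intros (S & S' & H1 & H2 & H).
    pose proof (repr_ofB S) as RS. pose proof (repr_ofB S') as RS'.
    exists (ofB S), (ofB S'). split; [split; [|split; [|split]]|].
    + eapply bdd_repr; eauto.
    + eapply bdd_repr; eauto.
    + apply (op_eq_iff _ _ (S [*] S') bid); auto using repr_comp, repr_id.
    + apply (op_eq_iff _ _ (S' [*] S) bid); auto using repr_comp, repr_id.
    + intros f Hf. apply (calk_eq_iff _ _ (T2 f) (S [*] (T1 f [*] S'))); auto using repr_comp.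
Qed.

Lemma universal_extension : (1 <= d)%nat -> (exists x, M x) -> compact_set d M ->
  exists Theta : fn -> op,
    is_ext p d M Theta /\ trivial_ext p d M Theta /\
    equiv_ext p d M Theta (sum_ext Theta Theta) /\
    (forall Phi, is_ext p d M Phi ->
       exists Psi, is_ext p d M Psi /\ equiv_ext p d M Theta (sum_ext Phi Psi)) /\
    (forall Theta', is_ext p d M Theta' ->
       equiv_ext p d M Theta' (sum_ext Theta' Theta') ->
       (forall Phi, is_ext p d M Phi ->
          exists Psi, is_ext p d M Psi /\ equiv_ext p d M Theta' (sum_ext Phi Psi)) ->
       equiv_ext p d M Theta Theta').
Proof.
  intros Hd Hne HM. destruct Hne as [x0 Mx0]. pose proof (ex_intro M x0 Mx0) as Hne.
  destruct (family_exists d M Hd HM Hne) as (kk & gg & xx & dls & us & Hfam).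
  set (Th := Theta0 x0 kk xx).
  assert (HTh : hommod d M Th) by (eapply Theta0_hommod; eauto).
  assert (HR : forall f, repr (ofB (Th f)) (Th f)) by (intros; apply repr_ofB).
  assert (Hlow : forall f s, cont_on d M f -> calk_le (Th f) s -> sup_le M f s)
    by (eapply Theta0_lower; eauto).
  assert (Hdbl : eqv d M Th (fdsum Th Th)) by (eapply Theta0_double; eauto).
  assert (Habs : forall T : fn -> Bop, hommod d M T -> exists P : fn -> Bop,
    hommod d M P /\ (forall f s, cont_on d M f -> calk_le (P f) s -> sup_le M f s) /\
    eqv d M Th (fdsum T P)) by (eapply Theta0_absorbs; eauto).
  assert (HE : is_ext p d M (fun f => ofB (Th f))) by (apply ext_of_hommod; auto).
  assert (Hsum : forall P Q A B, (forall f, cont_on d M f -> repr (P f) (A f)) ->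
    (forall f, cont_on d M f -> repr (Q f) (B f)) ->
    forall f, cont_on d M f -> repr (sum_ext P Q f) (fdsum A B f))
    by (intros; apply repr_sum; auto).
  exists (fun f => ofB (Th f)). split; [exact HE|]. split; [|split; [|split]].
  (* [Th] is multiplicative exactly and not only modulo the compacts, so it is its own lift. *)
  - exists (fun f => ofB (Th f)). split.
    + split; [|split; [|split; [|split; [|split; [|split]]]]].
      * intros f _. eapply bdd_repr; apply HR.
      * intros f g Hf Hg Hfg. apply (op_eq_iff _ _ (Th f) (Th g)); auto. eapply Theta0_ext; eauto.
      * intros f g Hf Hg. apply (op_eq_iff _ _ (Th (fadd f g)) (Th f [+] Th g)); auto using repr_add.
        eapply Theta0_add; eauto.
      * intros c f Hf. apply (op_eq_iff _ _ (Th (fscale c f)) (c [.] Th f)); auto using repr_scale.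
        eapply Theta0_scale; eauto.
      * intros f g Hf Hg. apply (op_eq_iff _ _ (Th (fmul f g)) (Th f [*] Th g)); auto using repr_comp.
        eapply Theta0_mul; eauto.
      * apply (op_eq_iff _ _ (Th fone) bid); auto using repr_id. eapply Theta0_one; eauto.
      * assert (HB : exists K, 0 <= K /\ forall f s, sup_le M f s -> ob (Th f) (K * s))
          by (eapply Theta0_bounded; eauto).
        destruct HB as (K & HK & HB). exists (K + 1). split; [lra|]. intros f Hf. split.
        -- intros s Hs. apply (op_bound_iff _ (Th f)) in Hs; auto.
           pose proof (Hlow f s Hf (calk_le_of_ob _ _ Hs)) as Hl. intros x Mx. specialize (Hl x Mx).
           pose proof (Cnorm_nonneg (f x)). nra.
        -- intros s Hs. apply (op_bound_iff _ (Th f)); auto.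
           assert (Hs0 : 0 <= s) by (specialize (Hs x0 Mx0); pose proof (Cnorm_nonneg (f x0)); lra).
           apply ob_mono with (K * s); auto. lra.
    + intros f Hf. apply (calk_eq_iff _ _ (Th f) (Th f)); auto. reflexivity.
  - apply (equiv_ext_iff _ _ Th (fdsum Th Th)); auto.
  - intros Phi HPhi. destruct (hommod_of_ext Phi HPhi) as [HT RT].
    destruct (Habs _ HT) as (P & HP & LP' & EP). exists (fun f => ofB (P f)). split.
    + apply ext_of_hommod; auto.
    + apply (equiv_ext_iff _ _ Th (fdsum (fun f => toB (Phi f)) P)); auto.
      apply Hsum; auto. intros; apply repr_ofB.
  - intros Theta' HT' Hd' Habs'. destruct (hommod_of_ext Theta' HT') as [HTT RT].
    set (Th' := fun f => toB (Theta' f)) in *.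
    apply (equiv_ext_iff _ _ Th Th'); auto.
    apply absorbing_unique; auto.
    + apply (equiv_ext_iff Theta' (sum_ext Theta' Theta')); auto.
    + destruct (Habs Th' HTT) as (P & _ & _ & EP). exists P. auto.
    (* The absorption property of [Theta'] is applied to the extension just constructed. *)
    + destruct (Habs' _ HE) as (Psi & HPsi & EPsi). destruct (hommod_of_ext Psi HPsi) as [_ RPsi].
      exists (fun f => toB (Psi f)).
      apply (equiv_ext_iff Theta' (sum_ext (fun f => ofB (Th f)) Psi)); auto.
Qed.

End Transfer.

Theorem theorem1p1 (p : R) (d : nat) (M : pt -> Prop) :
  1 < p -> (1 <= d)%nat ->
  (exists x, M x) -> in_Rd d M -> compact_set d M ->
  exists Theta : fn -> op,
    is_ext p d M Theta /\ trivial_ext p d M Theta /\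
    equiv_ext p d M Theta (sum_ext Theta Theta) /\
    (forall Phi, is_ext p d M Phi ->
       exists Psi, is_ext p d M Psi /\ equiv_ext p d M Theta (sum_ext Phi Psi)) /\
    (forall Theta', is_ext p d M Theta' -> trivial_ext p d M Theta' ->
       equiv_ext p d M Theta' (sum_ext Theta' Theta') ->
       (forall Phi, is_ext p d M Phi ->
          exists Psi, is_ext p d M Psi /\ equiv_ext p d M Theta' (sum_ext Phi Psi)) ->
       equiv_ext p d M Theta Theta').
Proof.
  intros Hp Hd Hne _ HM.
  destruct (@universal_extension (Exponent p Hp) d M Hd Hne HM) as (Theta & H1 & H2 & H3 & H4 & H5).
  exists Theta. split; [exact H1|]. split; [exact H2|]. split; [exact H3|]. split; [exact H4|].
  intros Theta' G1 _ G2 G3. exact (H5 Theta' G1 G2 G3).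
Qed.
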